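(* Let $N\ge2$, let $\Omega\subset\mathbb R^N$ be a bounded $C^2$ domain satisfying condition (C-1), and let $\mu\ge\mu_1:=-\frac{N^2}{4}$. Then there exists a positive function $\phi^\Omega_\mu$ in $\Omega$ satisfying $-\Delta\phi^\Omega_\mu+\frac{\mu}{|x|^2}\phi^\Omega_\mu=0$ in $\Omega$, vanishing on $\partial\Omega\setminus\{0\}$, and such that $$\phi^\Omega_\mu(x)=\rho(x)|x|^{\alpha_--1}(1+o(1))\quad\text{as }x\to0,\ \text{if }\mu>\mu_1,$$ $$\phi^\Omega_{\mu_1}(x)=\rho(x)|x|^{-\frac N2}\big(|\ln|x||+1\big)(1+o(1))\quad\text{as }x\to0,\ \text{if }\mu=\mu_1.$$
   Context: Condition (C-1): $0\in\partial\Omega$, $\Omega\subset\mathbb R^N_+=\{x\in\mathbb R^N:x_N>0\}$, and $\langle x,\mathbf n_x\rangle=O(|x|^2)$ for $x\in\partial\Omega$, where $\mathbf n_x$ is the outward unit normal at $x$. $\rho(x)=\operatorname{dist}(x,\partial\Omega)$. For $\mu\ge -N^2/4$, $\alpha_-=\frac{2-N}{2}-\sqrt{\mu+\frac{N^2}{4}}$. *)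

(* Defs.v *)
From HB Require Import structures.
From mathcomp Require Import all_boot all_order all_algebra.
From mathcomp Require Import all_classical all_reals all_analysis.
Set Implicit Arguments. Unset Strict Implicit. Unset Printing Implicit Defensive.
Import Order.TTheory GRing.Theory Num.Theory.
Import numFieldNormedType.Exports.
Local Open Scope classical_set_scope.
Local Open Scope ring_scope.

Section Defs.
Variables (R : realType) (N : nat).
Notation V := 'rV[R]_N.

Definition evec (i : 'I_N) : V := delta_mx ord0 i.
Definition dot (x y : V) : R := \sum_(i < N) x ord0 i * y ord0 i.
Definition enorm (x : V) : R := Num.sqrt (dot x x).
Definition eball (p : V) (r : R) : set V := [set y | enorm (y - p) < r].

Definition pderiv (i : 'I_N) (f : V -> R) (x : V) : R := derive f x (evec i).
Definition grad (f : V -> R) (x : V) : V := \row_(i < N) pderiv i f x.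
Definition lap (f : V -> R) (x : V) : R := \sum_(i < N) pderiv i (pderiv i f) x.

Definition C2_on (U : set V) (f : V -> R) : Prop :=
  forall x, U x ->
    [/\ {for x, continuous f},
        (forall i, derivable f x (evec i) /\ {for x, continuous (pderiv i f)}) &
        (forall i j, derivable (pderiv i f) x (evec j) /\
                     {for x, continuous (pderiv j (pderiv i f))})].

Definition bdry (A : set V) : set V := closure A `\` interior A.

Definition bounded_domain (O : set V) : Prop :=
  [/\ open O, connected O, O !=set0 & exists M : R, forall x, O x -> enorm x <= M].

(* O is a C^2 domain and nrm is its outward unit normal on the boundary:
   near every boundary point O is locally the sublevel set {g < 0} of a C^2
   function g with nonvanishing gradient, and nrm = grad g / |grad g| there. *)
Definition C2_boundary_with_normal (O : set V) (nrm : V -> V) : Prop :=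
  forall p, bdry O p ->
    exists (r : R) (g : V -> R),
      [/\ 0 < r, C2_on (eball p r) g,
          (forall x, eball p r x -> grad g x != 0),
          (forall x, eball p r x -> (O x <-> g x < 0)) &
          (forall x, eball p r x -> bdry O x ->
             nrm x = (enorm (grad g x))^-1 *: grad g x)].

Definition cond_C1 (O : set V) (nrm : V -> V) : Prop :=
  [/\ bdry O 0,
      (forall x, O x -> forall i : 'I_N, i.+1 = N -> 0 < x ord0 i) &
      exists C d : R, 0 < d /\
        forall x, bdry O x -> enorm x < d -> `|dot x (nrm x)| <= C * enorm x ^+ 2].

Definition rho (O : set V) (x : V) : R :=
  inf [set t | exists2 y, bdry O y & t = enorm (x - y)].

End Defs.

Definition mu1 (R : realType) (N : nat) : R := - (N%:R ^+ 2) / 4.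
Definition alpha_minus (R : realType) (N : nat) (mu : R) : R :=
  (2 - N%:R) / 2 - Num.sqrt (mu + N%:R ^+ 2 / 4).

(* Main.v *)
(** Write [s = |x|^2], [tau = tau0 - ln s] and [2 b = - N/2 - sqrt (mu + N^2/4)],
    and let [G] be a C^2 defining function of [O] near 0 with [|grad G(0)| = 1].
    Then [u0 = G s^b tau^a0], with [a0 = 0] ([a0 = 1] if [mu = mu1]), solves the
    equation near 0 up to lower-order errors, and it has the required behaviour
    since [G ~ rho].  With a smaller exponent [a1], the function [G s^b tau^a1],
    corrected by a negative multiple of [G^2], is a strict supersolution [w] of
    lower order, so that [u0 - K w] and [u0 + K w] are a sub- and a
    supersolution.  Away from 0 they are glued to 0 and to the global
    supersolution [x_N (s^b tau^a0 + s^b tau^a1)], which exists because [O] lies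
    in a half space.

    The solution in between comes from Perron's method on grids of mesh [h],
    where an infimum of supersolutions is a solution without any regularity
    theory.  A gradient bound obtained by reflection, applied to iterated
    difference quotients, makes the discrete solutions locally compact, and
    their limit along an ultrafilter of meshes is a C^2 solution lying below
    every continuous supersolution.  Boundary values then follow from local
    barriers, and positivity from Hopf's comparison function. *)

Set Implicit Arguments.
Unset Strict Implicit.
Unset Printing Implicit Defensive.
Require Import Defs.
From HB Require Import structures.
From mathcomp Require Import all_boot all_order all_algebra.
From mathcomp Require Import all_classical all_reals all_analysis.
From mathcomp Require Import ring lra.
Import Order.TTheory GRing.Theory Num.Theory.
Import numFieldNormedType.Exports.
Local Open Scope classical_set_scope.
Local Open Scope ring_scope.

(** * Coordinates, lines and cubes *)

Section Coordinates.
Variables (R : realType) (N : nat).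
Implicit Types (x y : 'rV[R]_N) (f g : 'rV[R]_N -> R) (i j : 'I_N).

(** The potential may be negative, so no comparison principle is at hand for the equation or its
    discretization. Minimality of Perron's solution takes its place: the upper bound at 0 and the
    boundary values come from exhibiting continuous supersolutions above one fixed subsolution,
    which is why the discrete existence theorem carries a minimality clause through the limit. In a
    half space [x_N s^b] is an exact solution when [mu = 4 b^2 + 2 N b], and the chosen [b] is the
    smaller root. The two barriers must agree at 0 up to a factor [1 + o(1)], so their difference
    has to be of lower order than [u0] and still outweigh the errors made by replacing [x_N] with
    [G]. Those errors gain a power of [s], whereas changing the exponent of [tau] costs only
    logarithms; this leaves room for both demands, and it treats [mu = mu1], where the two roots [b]
    coincide and a logarithm enters [u0] itself, by the same computation. The barriers satisfy
    strict differential inequalities, because the gap is what absorbs the discretization error. *)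

Definition cube x (d : R) : set 'rV[R]_N :=
  [set y | forall i, `|y ord0 i - x ord0 i| < d].

Lemma nbhs_cube x (P : set 'rV[R]_N) :
  nbhs x P <-> exists2 d, 0 < d & cube x d `<=` P.
Proof.
split=> [/nbhs_ballP[d /= d0 dP]|[d d0 dP]].
  exists d => // y xy; apply: dP; split=> // i j.
  by rewrite (ord1 i) /ball /= distrC; exact: xy.
apply/nbhs_ballP; exists d => //= y xy; apply: dP => i.
by have := xy.2 ord0 i; rewrite /ball /= distrC.
Qed.

Lemma cube_nbhs x d : 0 < d -> nbhs x (cube x d).
Proof. by move=> d0; apply/nbhs_cube; exists d. Qed.

Lemma subset_cube x d d' : d <= d' -> cube x d `<=` cube x d'.
Proof. by move=> dd y yx i; exact: lt_le_trans (yx i) dd. Qed.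

Lemma cube_minl x a b : cube x (Num.min a b) `<=` cube x a.
Proof. by apply: subset_cube; rewrite ge_min lexx. Qed.

Lemma cube_minr x a b : cube x (Num.min a b) `<=` cube x b.
Proof. by apply: subset_cube; rewrite ge_min lexx orbT. Qed.

Lemma cube_center x d : 0 < d -> cube x d x.
Proof. by move=> d0 i; rewrite subrr normr0. Qed.

Lemma cube_trans x y z d d' : cube x d y -> cube y d' z -> cube x (d + d') z.
Proof.
move=> xy yz i; rewrite [d + d']addrC.
have -> : z ord0 i - x ord0 i = (z ord0 i - y ord0 i) + (y ord0 i - x ord0 i).
  by ring.
by apply: le_lt_trans (ler_normD _ _) _; rewrite ltrD.
Qed.

Lemma row_ext x y : (forall i, x ord0 i = y ord0 i) -> x = y.
Proof. by move=> xy; apply/rowP => i; exact: xy. Qed.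

Lemma evecE i (k : 'I_1) j : (evec R i) k j = (j == i)%:R.
Proof. by rewrite mxE (ord1 k) eqxx. Qed.

Lemma shiftE x (t : R) i j :
  (x + t *: evec R i) ord0 j = x ord0 j + t * (j == i)%:R.
Proof. by rewrite !mxE eqxx. Qed.

Lemma shift_cube x y (t d d' : R) i : cube x d y -> `|t| <= d' ->
  cube x (d + d') (y + t *: evec R i).
Proof.
move=> xy td j; rewrite shiftE addrAC.
apply: le_lt_trans (ler_normD _ _) _; apply: ltr_leD; first exact: xy.
by case: (j == i); rewrite ?mulr1 ?mulr0 ?normr0 //; apply: le_trans td.
Qed.

Lemma shift_cube0 x (t d : R) i : `|t| < d -> cube x d (x + t *: evec R i).
Proof.
move=> td j; rewrite shiftE addrAC subrr add0r.
case: (j == i); rewrite ?mulr1 ?mulr0 ?normr0 //.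
exact: le_lt_trans td.
Qed.

Lemma is_derive_line f x (v : 'rV[R]_N) (t df : R) :
  is_derive (x + t *: v) v f df ->
  is_derive t 1 (fun t : R => f (x + t *: v)) df.
Proof.
have H : (fun h : R => h^-1 *: (f (h *: v + (x + t *: v)) - f (x + t *: v))) =
  (fun h : R => h^-1 *: (f (x + (h *: 1 + t) *: v) - f (x + t *: v))).
  apply/funext => h; congr (_ *: (f _ - _)).
  by rewrite scalerDl [h *: 1]mulr1 addrCA.
move=> [fd fE]; split.
  by rewrite /derivable -[X in cvg (X @ _)]H.
by rewrite /derive -[X in lim (X @ _)]H.
Qed.

Lemma is_derive_of_line f x (v : 'rV[R]_N) (df : R) :
  is_derive (0 : R) 1 (fun t : R => f (x + t *: v)) df -> is_derive x v f df.
Proof.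
have H : (fun h : R => h^-1 *: (f (h *: v + x) - f x)) =
  (fun h : R => h^-1 *: (f (x + (h *: 1 + 0) *: v) - f (x + 0 *: v))).
  apply/funext => h; congr (_ *: (f _ - f _)).
    by rewrite addr0 [h *: 1]mulr1 addrC.
  by rewrite scale0r addr0.
move=> [fd fE]; split.
  by rewrite /derivable [X in cvg (X @ _)]H.
by rewrite /derive [X in lim (X @ _)]H.
Qed.

Lemma is_derive1_continuous (f : R -> R) (t df : R) :
  is_derive t 1 f df -> {for t, continuous f}.
Proof.
by move=> [/derivable1_diffP fd _]; exact: differentiable_continuous.
Qed.

(** The intermediate point is parametrized by [th] in [0, 1] rather than by an interval with end
    points 0 and [t], so that the sign of [t] does not matter. *)
Lemma mvt_coord f f' i x (t : R) :
  (forall th : R, 0 <= th <= 1 ->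
     is_derive (x + (th * t) *: evec R i) (evec R i) f
       (f' (x + (th * t) *: evec R i))) ->
  exists2 th : R, 0 <= th <= 1 &
    f (x + t *: evec R i) - f x = t * f' (x + (th * t) *: evec R i).
Proof.
move=> fd.
pose G th := f (x + (th * t) *: evec R i).
have Gd (th : R) : 0 <= th <= 1 -> is_derive th 1 G (f' (x + (th * t) *: evec R i) * t).
  move=> /fd /is_derive_line H.
  have Hm : is_derive th 1 (fun s : R => s * t) t.
    rewrite (_ : (fun s : R => s * t) = t \*: id); last first.
      by apply/funext => s; rewrite /= mulrC.
    apply: is_derive_eq; by rewrite [LHS]mulr1.
  exact: (@is_derive1_comp _ (fun u : R => f (x + u *: evec R i))
    (fun s : R => s * t) th _ _ H Hm).
have [||c c01 E] := @MVT_segment R G (fun th => f' (x + (th * t) *: evec R i) * t) 0 1 ler01.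
- by move=> c /andP[/= c0 c1]; apply: Gd; rewrite !ltW.
- apply: continuous_in_subspaceT => c; rewrite inE/= in_itv/= => c01.
  by apply: is_derive1_continuous; exact: Gd.
exists c; first by move: c01; rewrite in_itv.
by move: E; rewrite /G mul1r mul0r scale0r addr0 subr0 mulr1 mulrC => ->.
Qed.

Lemma finite_radius (T : finType) (P : T -> R -> Prop) :
  (forall z d d', d' <= d -> P z d -> P z d') ->
  (forall z, exists2 d, 0 < d & P z d) -> exists2 d, 0 < d & forall z, P z d.
Proof.
move=> Pm PE.
suff [d d0 dP] : exists2 d, 0 < d & forall z, z \in enum T -> P z d.
  by exists d => // i; apply: dP; rewrite mem_enum.
elim: (enum T) => [|i s [d d0 dP]]; first by exists 1.
have [e e0 eP] := PE i.
exists (Num.min d e); first by rewrite lt_min d0.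
move=> j; rewrite inE => /predU1P[->|js].
  by apply: Pm eP; rewrite ge_min lexx orbT.
by apply: Pm (dP _ js); rewrite ge_min lexx.
Qed.

(** A path from [x] to [y] that changes one coordinate at a time: it reduces increments to
    one-variable statements about partial derivatives. Its vertices stay in any cube containing [x]
    and [y], which is the reason for working with cubes instead of balls. *)
Definition stair x y (k : nat) : 'rV[R]_N :=
  \row_j (if (j < k)%N then y ord0 j else x ord0 j).

Lemma stair0 x y : stair x y 0 = x.
Proof. by apply: row_ext => j; rewrite mxE. Qed.

Lemma stairN x y : stair x y N = y.
Proof. by apply: row_ext => j; rewrite mxE ltn_ord. Qed.

Lemma stairS x y i :
  stair x y i.+1 = stair x y i + (y ord0 i - x ord0 i) *: evec R i.
Proof.
apply: row_ext => j; rewrite shiftE !mxE ltnS leq_eqVlt.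
case: (eqVneq j i) => [->|ji]; first by rewrite eqxx ltnn mulr1; ring.
by rewrite -[(j : nat) == i]/(j == i) (negbTE ji) mulr0 addr0.
Qed.

Lemma stair_cube z x y k d : cube z d x -> cube z d y -> cube z d (stair x y k).
Proof. by move=> zx zy j; rewrite mxE; case: ifP. Qed.

Lemma stair_telescope f x y : f y - f x =
  \sum_(i < N) (f (stair x y i + (y ord0 i - x ord0 i) *: evec R i)
               - f (stair x y i)).
Proof.
rewrite -[in LHS](stairN x y) -[X in _ - f X](stair0 x y).
rewrite -(telescope_sumr (fun k => f (stair x y k)) (leq0n N)) big_mkord.
by apply: eq_bigr => i _; rewrite stairS.
Qed.

Lemma continuous_cube f x : {for x, continuous f} <->
  forall e, 0 < e -> exists2 d, 0 < d & forall y, cube x d y -> `|f y - f x| < e.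
Proof.
split=> [/(@cvgrPdist_lt _ _ _ _ (nbhs_filter x)) H e /H /nbhs_cube[d d0 dP]|H].
  by exists d => // y /dP; rewrite /= distrC.
apply/(@cvgrPdist_lt _ _ _ _ (nbhs_filter x)) => e /H[d d0 dP].
by apply/nbhs_cube; exists d => // y /dP; rewrite /= distrC.
Qed.

(** Telescoping along [stair]. Limits of grid functions are controlled in this way only, one
    coordinate direction at a time. *)
Lemma coord_lipschitz_continuous f x :
  (forall i, exists C d, 0 < d /\ forall y t, cube x d y ->
     cube x d (y + t *: evec R i) -> `|f (y + t *: evec R i) - f y| <= C * `|t|) ->
  {for x, continuous f}.
Proof.
move=> H.
have {}H i : exists C, exists2 d, 0 < d & forall y t, cube x d y ->
     cube x d (y + t *: evec R i) -> `|f (y + t *: evec R i) - f y| <= C * `|t|.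
  by have [C [d [d0 dP]]] := H i; exists C, d.
have [C CP] := choice H.
have [|d d0 dP] := finite_radius _ CP.
  move=> i d d' dd dP y t yx ytx.
  by apply: dP; apply: subset_cube dd _ _.
pose K := \sum_i `|C i| + 1.
have K0 : 0 < K by rewrite ltr_wpDl // sumr_ge0.
apply/continuous_cube => e e0.
have ek : 0 < Num.min d (e / K) by rewrite lt_min d0 divr_gt0.
exists (Num.min d (e / K)) => // y yx.
have ydx : cube x d y by exact: cube_minl yx.
rewrite (stair_telescope f x y); apply: le_lt_trans (ler_norm_sum _ _ _) _.
apply: (@le_lt_trans _ _ (\sum_i `|C i| * (e / K))).
  apply: ler_sum => i _.
  apply: (@le_trans _ _ (C i * `|y ord0 i - x ord0 i|)).
    apply: dP; first by apply: stair_cube => //; exact: cube_center.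
    by rewrite -stairS; apply: stair_cube => //; exact: cube_center.
  apply: (@le_trans _ _ (`|C i| * `|y ord0 i - x ord0 i|)).
    by rewrite ler_wpM2r // ler_norm.
  rewrite ler_wpM2l //; apply: le_trans (ltW (yx i)) _.
  by rewrite ge_min lexx orbT.
by rewrite -mulr_suml mulrA ltr_pdivrMr // mulrC ltr_pM2l // /K ltrDl.
Qed.

End Coordinates.

(** * Euclidean norm *)

Section Euclidean.
Variables (R : realType) (N : nat).
Implicit Types (x y z : 'rV[R]_N) (i j : 'I_N).

Lemma dotC x y : dot x y = dot y x.
Proof. by apply: eq_bigr => i _; rewrite mulrC. Qed.

Lemma dotDl x y z : dot (x + y) z = dot x z + dot y z.
Proof. by rewrite -big_split; apply: eq_bigr => i _; rewrite mxE mulrDl. Qed.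

Lemma dotZl (a : R) x y : dot (a *: x) y = a * dot x y.
Proof. by rewrite mulr_sumr; apply: eq_bigr => i _; rewrite mxE mulrA. Qed.

Lemma dotNl x y : dot (- x) y = - dot x y.
Proof. by rewrite -scaleN1r dotZl mulN1r. Qed.

Lemma dotBl x y z : dot (x - y) z = dot x z - dot y z.
Proof. by rewrite dotDl dotNl. Qed.

Lemma dot_ge0 x : 0 <= dot x x.
Proof. by apply: sumr_ge0 => i _; rewrite -expr2 sqr_ge0. Qed.

Lemma sqr_enorm x : enorm x ^+ 2 = dot x x.
Proof. by rewrite /enorm sqr_sqrtr // dot_ge0. Qed.

Lemma enorm_ge0 x : 0 <= enorm x.
Proof. exact: sqrtr_ge0. Qed.

Lemma enormN x : enorm (- x) = enorm x.
Proof. by rewrite /enorm dotNl dotC dotNl opprK. Qed.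

Lemma enorm_sym x y : enorm (x - y) = enorm (y - x).
Proof. by rewrite -opprB enormN. Qed.

Lemma coord_enorm x i : `|x ord0 i| <= enorm x.
Proof.
rewrite -sqrtr_sqr /enorm ler_sqrt ?dot_ge0 // /dot (bigD1 i) //= -expr2 lerDl.
by apply: sumr_ge0 => j _; rewrite -expr2 sqr_ge0.
Qed.

Lemma enorm_gt0 x : x != 0 -> 0 < enorm x.
Proof.
move=> x0; rewrite lt0r enorm_ge0 andbT; apply: contra x0 => /eqP x0.
apply/eqP/row_ext => i; rewrite mxE; apply/eqP; rewrite -normr_le0 -x0.
exact: coord_enorm.
Qed.

Lemma dot_gt0 x : x != 0 -> 0 < dot x x.
Proof. by move=> /enorm_gt0 x0; rewrite -sqr_enorm exprn_gt0. Qed.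

Lemma enorm0 : enorm (0 : 'rV[R]_N) = 0.
Proof. by rewrite /enorm /dot big1 ?sqrtr0 // => i _; rewrite mxE mul0r. Qed.

Lemma enormZ (a : R) x : enorm (a *: x) = `|a| * enorm x.
Proof.
by rewrite /enorm dotZl dotC dotZl mulrA -expr2 sqrtrM ?sqr_ge0 // sqrtr_sqr.
Qed.

Lemma dot_le x y : dot x y <= enorm x * enorm y.
Proof.
have H (u v : 'rV[R]_N) : 2 * dot u v <= dot u u + dot v v.
  have := dot_ge0 (u - v); rewrite dotBl ![dot _ (u - v)]dotC !dotBl.
  by rewrite (dotC v u); lra.
case: (eqVneq x 0) => [->|x0].
  by rewrite enorm0 mul0r /dot big1 // => i _; rewrite mxE mul0r.
case: (eqVneq y 0) => [->|y0].
  by rewrite enorm0 mulr0 /dot big1 // => i _; rewrite mxE mulr0.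
(* Scaling each vector by the norm of the other gives both the same length, the case in which [H]
   yields the sharp product of norms. *)
have := H (enorm y *: x) (enorm x *: y).
have := enorm_gt0 x0; have := enorm_gt0 y0.
rewrite !dotZl ![dot _ (_ *: _)]dotC !dotZl -!sqr_enorm (dotC y x).
set a := enorm x; set b := enorm y; set c := dot x y => b0 a0 K.
have ab0 : 0 < a * b by rewrite mulr_gt0.
rewrite -(ler_pM2l ab0); move: K; rewrite !expr2; lra.
Qed.

Lemma enorm_triangle x y : enorm (x + y) <= enorm x + enorm y.
Proof.
rewrite -(@ler_pXn2r _ 2) ?nnegrE ?enorm_ge0 ?addr_ge0 ?enorm_ge0 //.
rewrite sqr_enorm dotDl ![dot _ (x + y)]dotC !dotDl -!sqr_enorm (dotC y x).
by have := dot_le x y; rewrite sqrrD mulr2n; lra.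
Qed.

Lemma cube_enorm x d : 0 <= d -> cube 0 d x -> enorm x <= N%:R * d.
Proof.
move=> d0 xd; rewrite -(@ler_pXn2r _ 2) ?nnegrE ?enorm_ge0 ?mulr_ge0 //.
rewrite sqr_enorm /dot; case: (posnP N) => [N0|Npos].
  by rewrite big1 ?sqr_ge0 // => i; have := ltn_ord i; rewrite {2}N0.
apply: (@le_trans _ _ (\sum_(i < N) d ^+ 2)).
  apply: ler_sum => i _; rewrite -expr2 -[leLHS]real_normK ?num_real //.
  rewrite lerXn2r ?nnegrE //; have := xd i; rewrite mxE subr0; exact: ltW.
rewrite sumr_const card_ord -[leLHS]mulr_natl exprMn ler_wpM2r ?sqr_ge0 //.
by rewrite expr2 ler_peMl // ler1n.
Qed.

Lemma eball_cube x y d : enorm (y - x) < d -> cube x d y.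
Proof.
move=> yx i; apply: le_lt_trans yx; have := coord_enorm (y - x) i.
by rewrite !mxE.
Qed.

Lemma cube_eball x y d : 0 <= d -> cube x d y -> enorm (y - x) <= N%:R * d.
Proof.
move=> d0 yx; apply: cube_enorm => // i; rewrite !mxE subr0; exact: yx.
Qed.

Lemma eball_nbhs x d : 0 < d -> nbhs x (eball x d).
Proof.
move=> d0; apply/nbhs_cube; have N1 : 0 < N%:R + 1 :> R by rewrite ltr_wpDl.
exists (d / (N%:R + 1)); first by rewrite divr_gt0.
move=> y /(cube_eball (ltW (divr_gt0 d0 N1))) yx; apply: le_lt_trans yx _.
rewrite mulrCA gtr_pMr // ltr_pdivrMr // mul1r; lra.
Qed.

Lemma nbhs_eball x (P : set 'rV[R]_N) :
  nbhs x P <-> exists2 d, 0 < d & eball x d `<=` P.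
Proof.
split=> [/nbhs_cube[d d0 dP]|[d d0 dP]].
  by exists d => // y /eball_cube; exact: dP.
have /nbhs_cube[e e0 eP] := eball_nbhs x d0.
by apply/nbhs_cube; exists e => //; apply: subset_trans eP dP.
Qed.

Lemma continuous_eball (f : 'rV[R]_N -> R) x : {for x, continuous f} <->
  forall e, 0 < e -> exists2 d, 0 < d & forall y, enorm (y - x) < d -> `|f y - f x| < e.
Proof.
split=> [/continuous_cube H e /H [d d0 dP]|H]; last first.
  apply/continuous_cube => e /H [d d0 dP].
  have /nbhs_cube[d' d'0 dP'] := eball_nbhs x d0.
  by exists d' => // y /dP'; exact: dP.
by exists d => // y /eball_cube; exact: dP.
Qed.

Lemma coord_cvg x i : {for x, continuous (fun y : 'rV[R]_N => y ord0 i)}.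
Proof. by apply/continuous_cube => e e0; exists e => // y yx; exact: yx. Qed.

Lemma continuous_mul (f g : 'rV[R]_N -> R) x : {for x, continuous f} ->
  {for x, continuous g} -> {for x, continuous (fun y => f y * g y)}.
Proof. by move=> fc gc; apply: (@continuousM _ _ f g). Qed.

Lemma continuous_add (f g : 'rV[R]_N -> R) x : {for x, continuous f} ->
  {for x, continuous g} -> {for x, continuous (fun y => f y + g y)}.
Proof. by move=> fc gc; apply: (@continuousD _ _ _ f g). Qed.

Lemma continuous_cst (a : R) x : {for x, continuous (fun _ : 'rV[R]_N => a)}.
Proof. exact: cst_continuous. Qed.

Lemma continuous_bigsum n (f : 'I_n -> 'rV[R]_N -> R) x :
  (forall k, {for x, continuous (f k)}) ->
  {for x, continuous (fun y => \sum_k f k y)}.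
Proof.
elim: n f => [|n IH] f fc.
  rewrite (_ : (fun y => _) = fun=> 0); first exact: continuous_cst.
  by apply/funext => y; rewrite big_ord0.
rewrite (_ : (fun y => _) = fun y =>
  (fun y => \sum_(i < n) f (widen_ord (leqnSn n) i) y) y + f ord_max y).
  by apply: continuous_add => //; exact: IH.
by apply/funext => y; rewrite big_ord_recr.
Qed.

Lemma dist2_continuous (z x : 'rV[R]_N) :
  {for x, continuous (fun y => dot (y - z) (y - z))}.
Proof.
apply: continuous_bigsum => i.
rewrite (_ : (fun y => _) = fun y : 'rV[R]_N =>
  (y ord0 i + - z ord0 i) * (y ord0 i + - z ord0 i)).
  by apply: continuous_mul; apply: continuous_add;
    [exact: coord_cvg|exact: continuous_cst|exact: coord_cvg|exact: continuous_cst].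
by apply/funext => y; rewrite !mxE.
Qed.

Lemma potential_continuous (mu : R) x : x != 0 ->
  {for x, continuous (fun y : 'rV[R]_N => mu / enorm y ^+ 2)}.
Proof.
move=> x0.
have H : {for x, continuous (fun y : 'rV[R]_N => enorm y ^+ 2)}.
  rewrite (_ : (fun y => _) = fun y => dot (y - 0) (y - 0)).
    exact: dist2_continuous.
  by apply/funext => y; rewrite subr0 sqr_enorm.
apply: continuous_mul; first exact: continuous_cst.
by apply: continuousV => //; rewrite sqr_enorm gt_eqF // dot_gt0.
Qed.

End Euclidean.

(** * Discrete gradient bound *)

(** A maximum principle without an attained maximum: the domain [D] used below is infinite, since
    all coordinates but one vary continuously. The uniform gain [eps] at points of positivity
    contradicts the existence of points where [w] almost reaches its supremum. *)
Lemma sup_principle (R : realType) (T : Type) (D : set T) (w : T -> R) (C eps : R) :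
  0 < eps -> (forall x, D x -> w x <= C) ->
  (forall x S, D x -> 0 < w x -> 0 <= S -> (forall y, D y -> w y <= S) ->
     w x + eps <= S) ->
  forall x, D x -> w x <= 0.
Proof.
move=> eps0 wC wS x0 Dx0; rewrite leNgt; apply/negP => w0.
pose E := [set w x | x in D].
have hE : has_sup E.
  split; first by exists (w x0), x0.
  by exists C => _ [x Dx <-]; exact: wC.
have ub x : D x -> w x <= sup E.
  by move=> Dx; apply: ub_le_sup; [exact: hE.2|exists x].
have S0 : 0 < sup E by exact: lt_le_trans w0 (ub _ Dx0).
have m0 : 0 < Num.min (sup E) eps by rewrite lt_min S0.
have [_ [x Dx <-] xs] := sup_adherent m0 hE.
have m1 : Num.min (sup E) eps <= sup E by rewrite ge_min lexx.
have m2 : Num.min (sup E) eps <= eps by rewrite ge_min lexx orbT.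
have wx0 : 0 < w x by lra.
have := wS x (sup E) Dx wx0 (ltW S0) ub.
lra.
Qed.

Section Differences.
Variables (R : realType) (N : nat).
Local Notation V := 'rV[R]_N.
Implicit Types (x y : V) (u v : V -> R) (i j : 'I_N) (h : R).

Definition sdiff h i u (x : V) : R :=
  u (x + h *: evec R i) + u (x + (- h) *: evec R i) - 2 * u x.
Definition lapd h u (x : V) : R := (\sum_(i < N) sdiff h i u x) / h ^+ 2.
Definition fdiff h i u (x : V) : R := (u (x + h *: evec R i) - u x) / h.

Lemma sdiffB h i u v x :
  sdiff h i (fun z => u z - v z) x = sdiff h i u x - sdiff h i v x.
Proof. by rewrite /sdiff; ring. Qed.

Definition reflect i (y : V) h x : V :=
  x + (2 * y ord0 i + h - 2 * x ord0 i) *: evec R i.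

Lemma reflectE i y h x j : reflect i y h x ord0 j =
  if j == i then 2 * y ord0 i + h - x ord0 i else x ord0 j.
Proof.
rewrite /reflect shiftE; case: eqVneq => [->|_]; first by rewrite mulr1; ring.
by rewrite mulr0 addr0.
Qed.

(* [phi], the difference of [u] and its reflection in [x_i = y_i + h/2], is
   compared with the quadratic barrier [psi] on the half cube [D].  The
   reflection preserves the grid and exchanges [y] and [y + h e_i]. *)
Section GradientBound.
Variables (u : V -> R) (i : 'I_N) (y : V) (h d M F : R).
Hypotheses (h0 : 0 < h) (hd : 2 * h <= d).
Hypothesis uM : forall x, cube y (2 * d) x -> `|u x| <= M.
Hypothesis uF : forall x, cube y (2 * d) x -> `|lapd h u x| <= F.

(** The concavity [- 2 a] of [psi] in direction [i] outweighs the other directions, [4 M / d^2]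
    each, and the bound [2 F] on [lapd phi], with a surplus of 2. The slope [b] makes the polynomial
    part at least [2 M] for [d <= s <= 2 d]. The constant [a h^2 / 4] gives that part the opposite
    values [b h / 2] and [- b h / 2] at [s = h / 2] and [s = - h / 2], in accordance with the
    oddness of [phi]. *)
Let a := 2 * N%:R * M / d ^+ 2 + F + 1.
Let b := 2 * a * d + 2 * M / d.

Local Notation refl := (reflect i y h).
Let D : set V := [set x | (forall j, j != i -> `|x ord0 j - y ord0 j| < d) /\
  (exists k : nat, x ord0 i = y ord0 i + k.+1%:R * h) /\
  x ord0 i - y ord0 i - h / 2 < d].
Let q x : R := \sum_(j < N | j != i) (x ord0 j - y ord0 j) ^+ 2.
Let s x : R := x ord0 i - y ord0 i - h / 2.
Let phi x := u x - u (refl x).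
Let psi x := 2 * M / d ^+ 2 * q x + (b * s x - a * s x ^+ 2 + a * h ^+ 2 / 4).

Let d0 : 0 < d. Proof. by move: h0 hd; lra. Qed.
Let M0 : 0 <= M.
Proof.
apply: le_trans (uM (cube_center y _)) => //.
by have := d0; lra.
Qed.
Let F0 : 0 <= F.
Proof.
apply: le_trans (uF (cube_center y _)) => //.
by have := d0; lra.
Qed.
Let a0 : 1 <= a.
Proof.
rewrite /a; have : 0 <= 2 * N%:R * M / d ^+ 2.
  by rewrite divr_ge0 ?mulr_ge0 ?exprn_ge0 ?ler0n // ltW.
by have := F0; lra.
Qed.

Let Md0 : 0 <= M / d. Proof. by rewrite divr_ge0 // ltW. Qed.

Let refl_shift x j t : refl (x + t *: evec R j) =
  refl x + (if j == i then - t else t) *: evec R j.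
Proof.
apply: row_ext => k; rewrite [RHS]shiftE !reflectE !shiftE.
case: (eqVneq j i) => [->|ji]; case: (eqVneq k i) => [ki|ki].
- by rewrite ?eqxx ?mulr1; ring.
- by rewrite ?mulr0.
- by rewrite ?ki !(eq_sym i j) (negbTE ji) !mulr0; ring.
- by [].
Qed.

Let refl_refl x : refl (refl x) = x.
Proof.
apply: row_ext => k; rewrite [LHS]reflectE !reflectE; case: eqVneq => [->|//].
by rewrite eqxx; ring.
Qed.

Let sdiff_refl j x : sdiff h j (fun z => u (refl z)) x = sdiff h j u (refl x).
Proof.
rewrite /sdiff !refl_shift; case: (j == i) => //.
by rewrite opprK; congr (_ - _); rewrite addrC.
Qed.

Let qE j x t : q (x + t *: evec R j) =
  if j == i then q x else q x + 2 * t * (x ord0 j - y ord0 j) + t ^+ 2.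
Proof.
rewrite /q; case: (eqVneq j i) => [->|ji].
  apply: eq_bigr => k ki; rewrite shiftE (negbTE ki) mulr0 addr0 //.
rewrite (bigD1 j) //= [in RHS](bigD1 j) //= shiftE eqxx mulr1.
rewrite (eq_bigr (fun k => (x ord0 k - y ord0 k) ^+ 2)); first by ring.
by move=> k /andP[_ kj]; rewrite shiftE (negbTE kj) mulr0 addr0.
Qed.

Let sE j x t : s (x + t *: evec R j) = s x + t * (i == j)%:R.
Proof. by rewrite /s shiftE; ring. Qed.

Let sdiff_psi j x : sdiff h j psi x =
  if j == i then - (2 * a * h ^+ 2) else 4 * M / d ^+ 2 * h ^+ 2.
Proof.
rewrite /sdiff /psi !qE !sE eq_sym; case: (i == j) => /=; rewrite ?mulr1 ?mulr0.
  by rewrite !mulrA; ring.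
by rewrite !addr0 !mulrA; ring.
Qed.

Let q0 x : 0 <= q x.
Proof. by apply: sumr_ge0 => j _; exact: sqr_ge0. Qed.

Let poly0 t : 0 <= t -> t <= 2 * d ->
  0 <= b * t - a * t ^+ 2 + a * h ^+ 2 / 4.
Proof.
move=> t1 t2; rewrite /b.
have : 0 <= t * (a * (2 * d - t) + 2 * (M / d)).
  rewrite mulr_ge0 // addr_ge0 //; apply: mulr_ge0 => //.
    by move: a0; lra.
  by move: t2; lra.
have : 0 <= a * h ^+ 2 by rewrite mulr_ge0 ?sqr_ge0 //; move: a0; lra.
by rewrite -!mulrA; lra.
Qed.

Let polyd t : d <= t -> t <= 2 * d ->
  2 * M <= b * t - a * t ^+ 2 + a * h ^+ 2 / 4.
Proof.
move=> t1 t2; rewrite /b.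
have : 0 <= t * (a * (2 * d - t)).
  apply: mulr_ge0; first by move: t1 d0; lra.
  by apply: mulr_ge0; move: a0 t2; lra.
have : 0 <= a * h ^+ 2 by rewrite mulr_ge0 ?sqr_ge0 //; move: a0; lra.
have : 2 * (M / d) * d <= 2 * (M / d) * t.
  by rewrite ler_wpM2l // mulr_ge0.
rewrite -[2 * (M / d) * d]mulrA divfK ?gt_eqF // -!mulrA; lra.
Qed.

Let D_s x : D x -> h / 2 <= s x.
Proof.
move=> [_ [[k xk] _]]; rewrite /s xk -[k.+1%:R]natr1 mulrDl mul1r.
have : 0 <= k%:R * h by rewrite mulr_ge0 ?ler0n // ltW.
by lra.
Qed.

Let D_cube x : D x -> cube y (2 * d - h) x.
Proof.
move=> Dx j; case: (eqVneq j i) => [->|ji].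
  have := D_s Dx; case: Dx => _ [_]; rewrite /s => sd hs.
  by rewrite ltr_norml; move: hd h0; lra.
by case: Dx => /(_ _ ji) + _; move: hd h0; lra.
Qed.

Let D_refl x : D x -> cube y (2 * d - h) (refl x).
Proof.
move=> Dx j; rewrite reflectE; case: (eqVneq j i) => [->|ji].
  have := D_s Dx; case: Dx => _ [_]; rewrite /s => sd hs.
  by rewrite ltr_norml; move: hd h0; lra.
by case: Dx => /(_ _ ji) + _; move: hd h0; lra.
Qed.

Let phi_le x j t : D x -> `|t| <= h -> phi (x + t *: evec R j) <= 2 * M.
Proof.
move=> Dx th; rewrite /phi refl_shift.
have H1 := shift_cube j (D_cube Dx) th.
have th' : `|if j == i then - t else t| <= h by case: (j == i); rewrite ?normrN.
have H2 := shift_cube j (D_refl Dx) th'.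
rewrite subrK in H1 H2.
have := uM H1; have := uM H2.
by rewrite !ler_norml; lra.
Qed.

Let D_phi x : D x -> - (2 * F) <= lapd h phi x.
Proof.
move=> Dx; have := @subset_cube _ _ y (2 * d - h) (2 * d).
move=> /(_ ltac:(by move: h0; lra)) sub.
have := uF (sub _ (D_cube Dx)); have := uF (sub _ (D_refl Dx)).
have -> : lapd h phi x = lapd h u x - lapd h u (refl x).
  rewrite /lapd -mulrBl -sumrB; congr (_ / _); apply: eq_bigr => j _.
  by rewrite /phi sdiffB sdiff_refl.
by rewrite !ler_norml; lra.
Qed.

Let D_lap x : D x -> 2 * h ^+ 2 <= \sum_j sdiff h j (fun z => phi z - psi z) x.
Proof.
move=> Dx; have := D_phi Dx.
have h2 : 0 < h ^+ 2 by rewrite exprn_gt0.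
rewrite /lapd ler_pdivlMr // => phiF.
under eq_bigr do rewrite sdiffB; rewrite sumrB.
have -> : \sum_(j < N) sdiff h j psi x =
    - (2 * a * h ^+ 2) + (N.-1)%:R * (4 * M / d ^+ 2 * h ^+ 2).
  rewrite (bigD1 i) //= sdiff_psi eqxx; congr (_ + _).
  rewrite (eq_bigr (fun=> 4 * M / d ^+ 2 * h ^+ 2)).
    by rewrite sumr_const cardC1 card_ord [RHS]mulr_natl.
  by move=> j ji; rewrite sdiff_psi (negbTE ji).
have : (N.-1)%:R * (4 * M / d ^+ 2 * h ^+ 2) <=
       N%:R * (4 * M / d ^+ 2 * h ^+ 2) :> R.
  rewrite ler_wpM2r ?ler_nat ?leq_pred // mulr_ge0 ?(ltW h2) //.
  by rewrite divr_ge0 ?mulr_ge0 ?exprn_ge0 // ltW.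
move: phiF; rewrite /a; lra.
Qed.

Let nb_le x j t S : D x -> 0 < phi x - psi x -> 0 <= S ->
  (forall z, D z -> phi z - psi z <= S) -> t = h \/ t = - h ->
  phi (x + t *: evec R j) - psi (x + t *: evec R j) <= S.
Proof.
move=> Dx w0 S0 wS th.
have tn : `|t| <= h by case: th => ->; rewrite ?normrN gtr0_norm.
have phiM := phi_le j Dx tn; have sx := D_s Dx.
have sx' : s x < d by case: Dx => _ [].
have hd' : h / 2 + h <= d by move: hd h0; lra.
(* A neighbour stays in [D], or leaves through an outer face, where [psi >= 2 M] dominates [phi], or
   steps back across the mirror. *)
suff [|] : D (x + t *: evec R j) \/ 2 * M <= psi (x + t *: evec R j) \/
  phi (x + t *: evec R j) - psi (x + t *: evec R j) <= phi x - psi x.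
- exact: wS.
- case; first by move: phiM S0; lra.
  by move=> ?; apply: le_trans (wS _ Dx).
rewrite /psi qE sE; case: (eqVneq j i) => [->|ji].
  rewrite /= mulr1; case: th => ->.
    case: (ltP (s x + h) d) => sd; [left|right; left].
      case: Dx => Dx1 [[k xk] Dx2]; split.
        by move=> l li; rewrite shiftE (negbTE li) mulr0 addr0; exact: Dx1.
      split; first by exists k.+1; rewrite shiftE eqxx mulr1 xk -[k.+2%:R]natr1; ring.
      by rewrite shiftE eqxx mulr1; move: sd; rewrite /s; lra.
    apply: le_trans (polyd sd _) _; first by move: sx' hd'; lra.
    by rewrite lerDr mulr_ge0 // divr_ge0 ?mulr_ge0 ?exprn_ge0 // ltW.
  (* In the first layer the neighbour is the mirror image, and [phi] is odd. *)
  case: Dx => Dx1 [[[|k] xk] Dx2].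
    right; right.
    have E : refl x = x + (- h) *: evec R i.
      by rewrite /reflect xk; congr (_ + _ *: _); ring.
    have -> : phi (x + (- h) *: evec R i) = - phi x.
      by rewrite -E /phi refl_refl opprB.
    have sh : s x = h / 2 by rewrite /s xk; field.
    move: w0; rewrite /psi sh.
    have : 0 <= 2 * M / d ^+ 2 * q x.
      by rewrite mulr_ge0 // divr_ge0 ?mulr_ge0 ?exprn_ge0 // ltW.
    have -> : h / 2 + - h = - (h / 2) by field.
    by rewrite sqrrN; lra.
  left; split.
    by move=> l li; rewrite shiftE (negbTE li) mulr0 addr0; exact: Dx1.
  split; first by exists k; rewrite shiftE eqxx mulr1 xk -[k.+2%:R]natr1; ring.
  by rewrite shiftE eqxx mulr1; move: Dx2 h0; lra.
rewrite /= mulr0 addr0.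
case: (ltP `|x ord0 j + t - y ord0 j| d) => xjd; [left|right; left].
  case: Dx => Dx1 [[k xk] Dx2]; split.
    move=> l li; rewrite shiftE; case: (eqVneq l j) => [->|lj].
      by rewrite mulr1.
    by rewrite mulr0 addr0; exact: Dx1.
  rewrite shiftE eq_sym (negbTE ji) mulr0 addr0; split => //.
  by exists k.
have p0 : 0 <= b * s x - a * s x ^+ 2 + a * h ^+ 2 / 4.
  by apply: poly0; move: sx sx' h0 d0; lra.
have qd : d ^+ 2 <= q x + 2 * t * (x ord0 j - y ord0 j) + t ^+ 2.
  have -> : q x + 2 * t * (x ord0 j - y ord0 j) + t ^+ 2 =
      \sum_(k < N | (k != i) && (k != j)) (x ord0 k - y ord0 k) ^+ 2 +
      `|x ord0 j + t - y ord0 j| ^+ 2.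
    by rewrite /q (bigD1 j) //= real_normK ?num_real //; ring.
  rewrite -[d ^+ 2]add0r lerD //.
    by apply: sumr_ge0 => k _; exact: sqr_ge0.
  by rewrite lerXn2r // nnegrE // ltW.
have : 2 * M / d ^+ 2 * d ^+ 2 <=
    2 * M / d ^+ 2 * (q x + 2 * t * (x ord0 j - y ord0 j) + t ^+ 2).
  by rewrite ler_wpM2l // divr_ge0 ?mulr_ge0 ?exprn_ge0 // ltW.
rewrite divfK ?expf_neq0 ?gt_eqF //; move: p0; lra.
Qed.

Let w_le x : D x -> phi x - psi x <= 0.
Proof.
have h2 : 0 < h ^+ 2 by rewrite exprn_gt0.
have N0 : 0 < N%:R :> R by rewrite ltr0n; exact: leq_trans (ltn_ord i).
(* The surplus [2 h^2] of [D_lap] is spread over the [2 N] neighbours, which gives the gain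
   [h^2 / N]. *)
apply: (@sup_principle R V D (fun x => phi x - psi x) (2 * M) (h ^+ 2 / N%:R)).
- by rewrite divr_gt0.
- move=> z Dz; have := @phi_le z i 0 Dz; rewrite normr0 scale0r addr0.
  move=> /(_ (ltW h0)) phiM.
  have : 0 <= psi z.
    rewrite /psi addr_ge0 //.
      by rewrite mulr_ge0 // divr_ge0 ?mulr_ge0 ?exprn_ge0 // ltW.
    have := D_s Dz; case: Dz => _ [_]; rewrite -/(s z) => *.
    by apply: poly0; move: h0 d0; lra.
  by lra.
move=> z S Dz w0 S0 wS.
have := D_lap Dz.
rewrite /sdiff.
set W := fun z => phi z - psi z.
move=> H; have {}H : 2 * h ^+ 2 <= \sum_(j < N) (2 * S - 2 * W z).
  apply: le_trans H _; apply: ler_sum => j _; rewrite lerD2r.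
  rewrite mulr_natl mulr2n; apply: lerD.
    by apply: nb_le => //; left.
  by apply: nb_le => //; right.
move: H; rewrite sumr_const card_ord -[leRHS]mulr_natl -mulrBr [leRHS]mulrCA.
rewrite ler_pM2l ?ltr0n // => H.
by rewrite -/(W z) -lerBrDl ler_pdivrMr // mulrC.
Qed.

(** At [y + h e_i], whose mirror image is [y], [phi] is the difference to be bounded and [psi]
    equals [b h / 2]. *)
Lemma upper_bound_fdiff : fdiff h i u y <= a * d + M / d.
Proof.
have Dy : D (y + h *: evec R i).
  split; first by move=> j ji; rewrite shiftE (negbTE ji) mulr0 addr0 subrr normr0.
  rewrite shiftE eqxx mulr1; split; first by exists 0; rewrite mul1r.
  by move: h0 hd; lra.
have := w_le Dy; rewrite /psi /phi qE sE eqxx mulr1.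
have -> : q y = 0.
  by rewrite /q big1 // => j _; rewrite subrr expr0n.
have -> : refl (y + h *: evec R i) = y.
  apply: row_ext => j; rewrite [LHS]reflectE !shiftE.
  by case: eqVneq => [->|_] /=; [rewrite eqxx !mulr1; ring|rewrite mulr0 addr0].
have -> : s y = - (h / 2) by rewrite /s; ring.
have -> : - (h / 2) + h = h / 2 by field.
rewrite /fdiff ler_pdivrMr // /b mulr0 add0r.
have -> : 2 * M / d = 2 * (M / d) by rewrite mulrA.
by lra.
Qed.

End GradientBound.

(** The lower bound is the upper one for [- u]. The right-hand side does not contain [h]: this
    uniformity in the mesh is what compactness rests on. *)
Lemma fdiff_bound u i (y : V) h d M F : 0 < h -> 2 * h <= d ->
  (forall x, cube y (2 * d) x -> `|u x| <= M) ->
  (forall x, cube y (2 * d) x -> `|lapd h u x| <= F) ->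
  `|fdiff h i u y| <= (2 * N%:R * M / d ^+ 2 + F + 1) * d + M / d.
Proof.
move=> h0 hd uM uF; rewrite ler_norml; apply/andP; split.
  2: exact: upper_bound_fdiff.
have E : fdiff h i (fun x => - u x) y = - fdiff h i u y.
  by rewrite /fdiff -mulNr; congr (_ / _); ring.
rewrite lerNl -E; apply: upper_bound_fdiff => // x /[dup] cx.
  by rewrite normrN => /uM.
have -> : lapd h (fun x => - u x) x = - lapd h u x.
  rewrite /lapd -mulNr -sumrN; congr (_ / _); apply: eq_bigr => j _.
  by rewrite /sdiff; ring.
by rewrite normrN => /uF.
Qed.

End Differences.

(** * Perron's method on grids *)

Section Perron.
Variables (R : realType) (N : nat).
Local Notation V := 'rV[R]_N.
Implicit Types (x y : V) (u v : V -> R) (i j : 'I_N) (h : R) (O K : set V).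

Lemma lapdE h u x : lapd h u x =
  (\sum_(i < N) (u (x + h *: evec R i) + u (x + (- h) *: evec R i))
   - 2 * N%:R * u x) / h ^+ 2.
Proof.
rewrite /lapd sumrB sumr_const card_ord -[in LHS]mulr_natl.
by congr ((_ - _) / _); ring.
Qed.

(** The sign of [c] is free. Positivity of [2 N + h^2 c] alone makes the value solving the equation
    at a node increasing in the neighbouring values, so that infima of supersolutions are
    supersolutions. The equation is imposed on [K] only, whose neighbours still lie in [O]. *)
Lemma perron_discrete O K (A B c : V -> R) h : 0 < h ->
  (forall x, O x -> A x <= B x) ->
  (forall x, K x -> O x) ->
  (forall x i t, K x -> t = h \/ t = - h -> O (x + t *: evec R i)) ->
  (forall x, K x -> 0 < 2 * N%:R + h ^+ 2 * c x) ->
  (forall x, K x -> c x * A x <= lapd h A x) ->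
  (forall x, K x -> lapd h B x <= c x * B x) ->
  exists u : V -> R, [/\
    forall x, O x -> A x <= u x <= B x,
    forall x, K x -> lapd h u x = c x * u x &
    forall S : V -> R, (forall x, O x -> A x <= S x) ->
      (forall x, K x -> lapd h S x <= c x * S x) ->
      forall x, O x -> u x <= S x].
Proof.
move=> h0 AB KO nb cpos Asub Bsup.
have h2 : 0 < h ^+ 2 by rewrite exprn_gt0.
pose Nb (v : V -> R) x :=
  \sum_(i < N) (v (x + h *: evec R i) + v (x + (- h) *: evec R i)).
have supE v x : (lapd h v x <= c x * v x) =
    (Nb v x <= (2 * N%:R + h ^+ 2 * c x) * v x).
  rewrite lapdE ler_pdivrMr // -/(Nb v x) lerBlDr.
  by congr (_ <= _); ring.
have subE v x : (c x * v x <= lapd h v x) =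
    ((2 * N%:R + h ^+ 2 * c x) * v x <= Nb v x).
  rewrite lapdE ler_pdivlMr // -/(Nb v x) lerBrDr.
  by congr (_ <= _); ring.
have NbS v w x : K x -> (forall y, O y -> v y <= w y) -> Nb v x <= Nb w x.
  move=> Kx vw; apply: ler_sum => i _; apply: lerD; apply: vw; apply: nb => //.
    by left.
  by right.
pose Fam v := (forall x, O x -> A x <= v x) /\
  (forall x, K x -> lapd h v x <= c x * v x).
pose E x := [set v x | v in [set v | Fam v]].
pose u x := inf (E x).
have FB : Fam B by split.
have uS S x : Fam S -> O x -> u x <= S x.
  move=> FS Ox; apply: ge_inf; last by exists S.
  by exists (A x) => _ [v [Av _] <-]; exact: Av.
have Au x : O x -> A x <= u x.
  move=> Ox; apply: lb_le_inf; first by exists (B x), B.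
  by move=> _ [v [Av _] <-]; exact: Av.
have uSup x : K x -> Nb u x <= (2 * N%:R + h ^+ 2 * c x) * u x.
  move=> Kx; rewrite -ler_pdivrMl ?cpos //; apply: lb_le_inf.
    by exists (B x), B.
  move=> _ [v Fv <-]; rewrite ler_pdivrMl ?cpos // -?supE.
  apply: (@le_trans _ _ (Nb v x)); first by apply: NbS => // y; exact: uS.
  by rewrite -supE; exact: Fv.2.
exists u; split.
- by move=> x Ox; rewrite Au //= uS.
- move=> x Kx; apply/eqP; rewrite eq_le supE uSup //= subE.
  (* Lowering [u] at [x] to the value [T] that solves the equation there gives
     another member of the family. *)
  pose T := Nb u x / (2 * N%:R + h ^+ 2 * c x).
  have Tu : T <= u x by rewrite ler_pdivrMr ?cpos // mulrC uSup.
  pose u' y := if y == x then T else u y.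
  have u'u y : u' y <= u y by rewrite /u'; case: eqP => [->|].
  suff Fu' : Fam u'.
    have := uS _ _ Fu' (KO _ Kx); rewrite /u' eqxx /T.
    by rewrite ler_pdivlMr ?cpos // mulrC.
  split=> y Hy; last first.
    rewrite supE; apply: (@le_trans _ _ (Nb u y)); first exact: NbS.
    rewrite /u'; case: eqP => [->|_]; last exact: uSup.
    by rewrite mulrC divfK // gt_eqF ?cpos.
  rewrite /u'; case: eqP => [->|_]; last exact: Au.
  rewrite ler_pdivlMr ?cpos // mulrC.
  by apply: (@le_trans _ _ (Nb A x)); [rewrite -subE; exact: Asub|exact: NbS].
- by move=> S AS Ssup x Ox; apply: uS.
Qed.

(** Point and mesh become small together, independently of each other. Compactness then yields one
    mesh threshold valid on a whole compact set. *)
Definition near_step x (P : V -> R -> Prop) :=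
  exists2 d, 0 < d & forall y h, cube x d y -> 0 < h -> h < d -> P y h.

Lemma near_step_and x (P Q : V -> R -> Prop) : near_step x P -> near_step x Q ->
  near_step x (fun y h => P y h /\ Q y h).
Proof.
move=> [d d0 dP] [e e0 eQ]; exists (Num.min d e); first by rewrite lt_min d0.
move=> y h yc h0; rewrite lt_min => /andP[hd he].
split; [apply: dP => //|apply: eQ => //].
  exact: cube_minl yc.
exact: cube_minr yc.
Qed.

Lemma near_step_imp x (P Q : V -> R -> Prop) :
  near_step x P -> (forall y h, 0 < h -> P y h -> Q y h) -> near_step x Q.
Proof. by move=> [d d0 dP] PQ; exists d => // y h yc h0 hd; apply: PQ => //; apply: dP. Qed.

Lemma near_step_compact K (P : V -> R -> Prop) : compact K ->
  (forall x, K x -> near_step x P) ->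
  exists2 d, 0 < d & forall h, 0 < h -> h < d -> forall y, K y -> P y h.
Proof.
move=> /compact_near_coveringP Kc KP.
have H : \forall h \near (0 : R)^'+, K `<=` (fun y => P y h).
  apply: Kc => x /KP[d d0 dP].
  exists (cube x d, [set h | 0 < h < d]) => /=; last first.
    by move=> [y h] /= [yc /andP[h0 hd]]; exact: dP.
  split; first exact: cube_nbhs.
  near=> h; apply/andP; split; near: h; first exact: nbhs_right_gt.
  exact: nbhs_right_lt.
move: H => [d /= d0 dP]; exists d => // h h0 hd y Ky; apply: dP => //=.
by rewrite sub0r normrN gtr0_norm.
Unshelve. all: by end_near. Qed.

(* The inequality is required for all small meshes, locally uniformly; unlike
   the differential inequality, this is stable under minima. *)
Definition dsuper O (c S : V -> R) := forall x, O x ->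
  near_step x (fun y h => lapd h S y <= c y * S y).
Definition dsub O (c S : V -> R) := forall x, O x ->
  near_step x (fun y h => c y * S y <= lapd h S y).

Definition inner O (n : nat) : set V :=
  [set x | `|x| <= n%:R /\ forall y, ~ O y -> n.+1%:R^-1 <= `|x - y|].

Lemma inner_compact O n : compact (inner O n).
Proof.
apply: bounded_closed_compact.
  exists n%:R; split; first exact: num_real.
  by move=> r nr x [xn _]; apply: le_trans xn (ltW nr).
have -> : inner O n = [set x | `|x| <= n%:R] `&`
    \bigcap_(y in ~` O) [set x | n.+1%:R^-1 <= `|x - y|].
  by apply/seteqP; split.
apply: closedI.
  apply: (@preimage_closed _ _ (fun x : V => `|x|) [set r | r <= n%:R]).
    by move=> x _; exact: norm_continuous.
  exact: closed_le.
apply: closed_bigI => y _.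
apply: (@preimage_closed _ _ (fun x : V => `|x - y|) [set r | n.+1%:R^-1 <= r]).
  move=> x _; apply: (@continuous_comp _ _ _ (fun x : V => x - y) Num.norm).
    by apply: continuousB; [move=> ?; exact: cvg_id|exact: cst_continuous].
  exact: norm_continuous.
exact: closed_ge.
Qed.

Lemma inner_sub O n : inner O n `<=` O.
Proof.
move=> x [_ xO]; apply: contrapT => /xO.
by rewrite subrr normr0 leNgt invr_gt0 ltr0n.
Qed.

Lemma cube_norm x y d : 0 < d -> cube x d y -> `|y - x| < d.
Proof.
move=> d0 yx; rewrite /Num.norm /= mx_normrE; apply/bigmax_ltP; split=> // -[k i] _.
by rewrite !mxE (ord1 k); exact: yx.
Qed.

Lemma norm_cube x y d : `|y - x| < d -> cube x d y.
Proof.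
move=> + i; rewrite /Num.norm /= mx_normrE => /bigmax_ltP[_ /(_ (ord0, i))].
by rewrite !mxE; apply.
Qed.

Lemma open_cube O x : open O -> O x -> exists2 d, 0 < d & cube x d `<=` O.
Proof. by move=> oO Ox; apply/nbhs_cube; apply: open_nbhs_nbhs. Qed.

Lemma inner_nbhs O x : open O -> O x ->
  exists n0 : nat, exists2 d : R, 0 < d &
  forall n, (n0 <= n)%N -> cube x d `<=` inner O n.
Proof.
move=> oO Ox; have [d d0 dO] := open_cube oO Ox.
have d2 : 0 < d / 2 by rewrite divr_gt0.
have [n1 _ n1P] := @near_infty_natSinv_lt R (PosNum d2).
have [n2 _ n2P] := @nbhs_infty_ger R (`|x| + d).
exists (maxn n1 n2), (d / 2) => // n; rewrite geq_max => /andP[hn1 hn2] y yx.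
have yx' := cube_norm d2 yx; split.
  apply: le_trans (n2P _ hn2).
  rewrite -[y](subrK x) addrC; apply: le_trans (ler_normD _ _) _.
  by rewrite lerD2l; lra.
move=> z Oz; have := n1P _ hn1; rewrite /= => nd.
rewrite leNgt; apply/negP => yz; apply: Oz; apply: dO.
rewrite (_ : d = d / 2 + d / 2); last by field.
apply: cube_trans yx _; apply: norm_cube; rewrite distrC.
exact: lt_trans yz nd.
Qed.

(* [h -> 0] first, and then the compact sets [inner O n] exhaust [O]. *)
Definition mesh_filter : set_system (nat * R) := [set P |
  exists n0 : nat, forall n, (n0 <= n)%N ->
  exists2 d : R, 0 < d & forall h, 0 < h -> h < d -> P (n, h)].

Lemma mesh_filter_proper : ProperFilter mesh_filter.
Proof.
split.
  move=> [n0 /(_ n0 (leqnn _))[d d0 /(_ (d / 2))]].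
  by apply; [rewrite divr_gt0|lra].
split.
- by exists 0%N => n _; exists 1.
- move=> P Q [n1 n1P] [n2 n2Q]; exists (maxn n1 n2) => n.
  rewrite geq_max => /andP[/n1P[d d0 dP] /n2Q[e e0 eQ]].
  exists (Num.min d e); first by rewrite lt_min d0.
  by move=> h h0; rewrite lt_min => /andP[hd he]; split; [exact: dP|exact: eQ].
- move=> P Q PQ [n0 n0P]; exists n0 => n /n0P[d d0 dP].
  by exists d => // h h0 hd; apply: PQ; exact: dP.
Qed.

Lemma mesh_step (P : V -> R -> Prop) O : open O ->
  (forall x, O x -> near_step x P) ->
  mesh_filter [set p | 0 < p.2 /\ forall y, inner O p.1 y -> P y p.2].
Proof.
move=> oO OP; exists 0%N => n _.
have [|d d0 dP] := near_step_compact (@inner_compact O n) (P := P).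
  by move=> x /inner_sub; exact: OP.
by exists d => // h h0 hd; split => // y; exact: dP.
Qed.

(** The family [u] is fixed before [S] is given: a further supersolution affects only the stage of
    the filter from which its bound holds. *)
Lemma discrete_family O (c A B : V -> R) : open O ->
  (forall x, O x -> {for x, continuous c}) ->
  (forall x, O x -> A x <= B x) -> dsub O c A -> dsuper O c B ->
  (0 < N)%N ->
  exists u : nat * R -> V -> R, [/\
    \forall p \near mesh_filter, forall x, O x -> A x <= u p x <= B x,
    \forall p \near mesh_filter, forall x, inner O p.1 x ->
      lapd p.2 (u p) x = c x * u p x &
    forall S, (forall x, O x -> A x <= S x) -> dsuper O c S ->
      \forall p \near mesh_filter, forall x, O x -> u p x <= S x].
Proof.
move=> oO cc AB Asub Bsup N0.
have FF := mesh_filter_proper.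
pose ok (p : nat * R) := [/\ 0 < p.2,
  (forall x i t, inner O p.1 x -> t = p.2 \/ t = - p.2 -> O (x + t *: evec R i)),
  (forall x, inner O p.1 x -> 0 < 2 * N%:R + p.2 ^+ 2 * c x),
  (forall x, inner O p.1 x -> c x * A x <= lapd p.2 A x) &
  (forall x, inner O p.1 x -> lapd p.2 B x <= c x * B x)].
have okF : \forall p \near mesh_filter, ok p.
  have s1 : forall x, O x -> near_step x (fun y h =>
      forall i t, t = h \/ t = - h -> O (y + t *: evec R i)).
    move=> x Ox; have [d d0 dO] := open_cube oO Ox.
    exists (d / 2); first by rewrite divr_gt0.
    move=> y h yx h0 hd i t th; apply: dO.
    rewrite (_ : d = d / 2 + d / 2); last by field.
    apply: shift_cube => //; case: th => ->; rewrite ?normrN gtr0_norm //; lra.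
  have s2 : forall x, O x -> near_step x (fun y h => 0 < 2 * N%:R + h ^+ 2 * c y).
    move=> x Ox; have /cc cx := Ox.
    have : \forall y \near x, `|c x - c y| < 1.
      by move/cvgrPdist_lt : cx; apply.
    move=> /nbhs_cube[d d0 dP].
    have e0 : 0 < (`|c x| + 1)^-1 by rewrite invr_gt0; have := normr_ge0 (c x); lra.
    exists (Num.min d (Num.min 1 (`|c x| + 1)^-1)).
      by rewrite !lt_min d0 e0 ltr01.
    move=> y h yx h0; rewrite !lt_min => /and3P[hd h1 he].
    have {}yx : cube x d y by exact: cube_minl yx.
    have := dP _ yx; rewrite /= ltr_norml => /andP[c1 c2].
    have cy : - (`|c x| + 1) <= c y.
      by have := ler_norm (c x); have := ler_norm (- c x); rewrite normrN; lra.
    have hC : h * (`|c x| + 1) < 1.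
      by rewrite -ltr_pdivlMr ?div1r //; have := normr_ge0 (c x); lra.
    have N1 : 1 <= N%:R :> R by rewrite ler1n.
    have : h * h * - (`|c x| + 1) <= h * h * c y.
      by rewrite ler_wpM2l // mulr_ge0 // ltW.
    have : h * (h * (`|c x| + 1)) < h * 1 by rewrite ltr_pM2l.
    rewrite expr2; lra.
  apply: filterS (filterI (mesh_step oO s1) (filterI (mesh_step oO s2)
    (filterI (mesh_step oO Asub) (mesh_step oO Bsup)))).
  move=> p [[h0 p1] [[_ p2] [[_ p3] [_ p4]]]]; split => // x i t px.
  exact: p1.
have solve p : exists u : V -> R, ok p -> [/\
    forall x, O x -> A x <= u x <= B x,
    forall x, inner O p.1 x -> lapd p.2 u x = c x * u x &
    forall S : V -> R, (forall x, O x -> A x <= S x) ->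
      (forall x, inner O p.1 x -> lapd p.2 S x <= c x * S x) ->
      forall x, O x -> u x <= S x].
  (* For inadmissible pairs [A] is a mere default; all claims are made eventually along the
     filter. *)
  case: (pselect (ok p)) => [pok|npok]; last by exists A.
  have [p1 p2 p3 p4 p5] := pok.
  have [u uP] := perron_discrete p1 AB (@inner_sub O p.1) p2 p3 p4 p5.
  by exists u.
have [u uP] := choice solve.
exists u; split.
- by apply: filterS okF => p /uP[].
- by apply: filterS okF => p /uP[].
- move=> S AS /(mesh_step oO) Ssup.
  by apply: filterS (filterI okF Ssup) => p [/uP[_ _ H] [_ ?]]; exact: H.
Qed.

End Perron.

(** * Uniform bounds on difference quotients *)

Section BoundedDifferences.
Variables (R : realType) (N : nat) (I : Type) (U : set_system I) (hh : I -> R).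
Hypotheses (FU : Filter U)
  (hh_small : forall e, 0 < e -> \forall p \near U, 0 < hh p < e).
Local Notation V := 'rV[R]_N.
Implicit Types (x y : V) (f g : I -> V -> R) (i j : 'I_N).

Definition locally_mesh x (P : I -> V -> Prop) :=
  exists2 d, 0 < d & \forall p \near U, forall y, cube x d y -> P p y.

Definition locb f x := exists C, locally_mesh x (fun p y => `|f p y| <= C).

Definition mesh_diff i f : I -> V -> R := fun p => fdiff (hh p) i (f p).
Definition mesh_shift i f : I -> V -> R := fun p y => f p (y + hh p *: evec R i).

(** The discrete counterpart of a [C^k] bound, locally uniform in the point and eventually uniform
    in the mesh. Recursing through [mesh_diff] lets product rules and commutation with [lapd] be
    applied one order at a time. *)
Fixpoint BD (k : nat) f x : Prop :=
  locb f x /\ if k is k'.+1 then forall i, BD k' (mesh_diff i f) x else True.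

Lemma locally_meshI x (P Q : I -> V -> Prop) :
  locally_mesh x P -> locally_mesh x Q ->
  locally_mesh x (fun p y => P p y /\ Q p y).
Proof.
move=> [d d0 dP] [e e0 eQ]; exists (Num.min d e); first by rewrite lt_min d0.
apply: filterS (filterI dP eQ) => p [pP pQ] y yx.
by split; [apply: pP|apply: pQ]; apply: subset_cube yx; rewrite ge_min lexx ?orbT.
Qed.

Lemma locally_meshS x (P Q : I -> V -> Prop) :
  (forall p y, P p y -> Q p y) -> locally_mesh x P -> locally_mesh x Q.
Proof.
move=> PQ [d d0 dP]; exists d => //.
by apply: filterS dP => p pP y yx; apply: PQ; apply: pP.
Qed.

Lemma locally_mesh_shift x i (P : I -> V -> Prop) : locally_mesh x P ->
  locally_mesh x (fun p y => P p (y + hh p *: evec R i)).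
Proof.
move=> [d d0 dP]; have d2 : 0 < d / 2 by rewrite divr_gt0.
exists (d / 2) => //.
apply: filterS (filterI dP (hh_small d2)) => p [pP /andP[h0 hd]] y yx.
apply: pP; rewrite (_ : d = d / 2 + d / 2); last by field.
by apply: shift_cube yx _; rewrite gtr0_norm // ltW.
Qed.

Lemma locally_mesh_step x : locally_mesh x (fun p _ => 0 < hh p).
Proof.
exists 1 => //; apply: filterS (hh_small ltr01) => p /andP[h0 _] y _.
exact: h0.
Qed.

Lemma BD_locb k f x : BD k f x -> locb f x.
Proof. by case: k => [|k] []. Qed.

Lemma BDW k f x : BD k.+1 f x -> BD k f x.
Proof.
elim: k f => [|k IH] f [fb fD]; first by split.
by split => // i; apply: IH.
Qed.

Lemma BD_eq k f g x : locally_mesh x (fun p y => f p y = g p y) ->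
  BD k f x -> BD k g x.
Proof.
elim: k f g => [|k IH] f g fg [[C fC] fD]; (split; [|move=> //]).
- exists C; apply: locally_meshS (locally_meshI fg fC) => p y [<-] //.
- by exists C; apply: locally_meshS (locally_meshI fg fC) => p y [<-].
- move=> i; apply: IH (fD i).
  apply: locally_meshS (locally_meshI fg (locally_mesh_shift i fg)) => p y.
  by rewrite /mesh_diff /fdiff => -[-> ->].
Qed.

Lemma BD_ext k f g x : (forall p y, f p y = g p y) -> BD k f x -> BD k g x.
Proof. by move=> fg; apply: BD_eq; exists 1 => //; apply: filterE => p y _. Qed.

Lemma BD_shift k f i x : BD k f x -> BD k (mesh_shift i f) x.
Proof.
elim: k f => [|k IH] f [[C fC] fD]; (split; [|move=> //]).
- by exists C; exact: locally_mesh_shift fC.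
- by exists C; exact: locally_mesh_shift fC.
- move=> j; apply: BD_ext (IH _ (fD j)) => p y.
  by rewrite /mesh_diff /mesh_shift /fdiff addrAC.
Qed.

Lemma BD_add k f g x : BD k f x -> BD k g x -> BD k (fun p y => f p y + g p y) x.
Proof.
have lb f' g' : locb f' x -> locb g' x -> locb (fun p y => f' p y + g' p y) x.
  move=> [C fC] [C' gC]; exists (C + C').
  apply: locally_meshS (locally_meshI fC gC) => p y [a b].
  by apply: le_trans (ler_normD _ _) _; exact: lerD.
elim: k f g => [|k IH] f g [fb fD] [gb gD]; (split; [exact: lb|move=> //]).
move=> i; apply: BD_ext (IH _ _ (fD i) (gD i)) => p y.
by rewrite /mesh_diff /fdiff -mulrDl; congr (_ / _); ring.
Qed.

(** The discrete Leibniz rule is [D (f g) = (D f) (shift g) + f (D g)]; the shifted factor is the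
    reason for [BD_shift]. *)
Lemma BD_mul k f g x : BD k f x -> BD k g x -> BD k (fun p y => f p y * g p y) x.
Proof.
have lb f' g' : locb f' x -> locb g' x -> locb (fun p y => f' p y * g' p y) x.
  move=> [C fC] [C' gC]; exists (C * C').
  apply: locally_meshS (locally_meshI fC gC) => p y [a b].
  by rewrite normrM ler_pM.
elim: k f g => [|k IH] f g fk gk.
  by split=> //; apply: lb; apply: BD_locb; [exact: fk|exact: gk].
split; first by apply: lb; apply: BD_locb; [exact: fk|exact: gk].
move=> i.
have H1 := IH _ _ (fk.2 i) (BD_shift i (BDW gk)).
have H2 := IH _ _ (BDW fk) (gk.2 i).
apply: BD_ext (BD_add H1 H2) => p y.
by rewrite /mesh_diff /mesh_shift /fdiff mulrAC mulrA -mulrDl; congr (_ / _); ring.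
Qed.

Lemma locb_cst (a : R) x : locb (fun _ _ => a) x.
Proof. by exists `|a|; exists 1 => //; apply: filterE => p y _. Qed.

Lemma BD_cst k (a : R) x : BD k (fun _ _ => a) x.
Proof.
elim: k a => [|k IH] a; (split; [exact: locb_cst|move=> //]).
by move=> i; apply: BD_ext (IH 0) => p y; rewrite /mesh_diff /fdiff subrr mul0r.
Qed.

Lemma BD_coord k j x : BD k (fun _ y => y ord0 j) x.
Proof.
have lb : locb (fun _ y => y ord0 j) x.
  exists (`|x ord0 j| + 1); exists 1 => //; apply: filterE => p y /(_ j) yx.
  rewrite -[y ord0 j](subrK (x ord0 j)) addrC.
  by apply: le_trans (ler_normD _ _) _; rewrite lerD2l ltW.
case: k => [|k]; split=> // i.
apply: BD_eq (BD_cst k (j == i)%:R x).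
apply: locally_meshS (locally_mesh_step x) => p y h0.
rewrite /mesh_diff /fdiff shiftE addrAC subrr add0r mulrAC divff ?mul1r //.
by rewrite lt0r_neq0.
Qed.

Lemma BD_sum k n (f : 'I_n -> I -> V -> R) x : (forall l, BD k (f l) x) ->
  BD k (fun p y => \sum_(l < n) f l p y) x.
Proof.
elim: n f => [|n IH] f fk.
  by apply: BD_ext (BD_cst k 0 x) => p y; rewrite big_ord0.
have := BD_add (IH (fun l => f (widen_ord (leqnSn n) l)) (fun l => fk _)) (fk ord_max).
by apply: BD_ext => p y; rewrite big_ord_recr.
Qed.

(** Induction on the order through [D (1 / f) = - (D f) / (f (shift f))], where the lower bound [a]
    controls both denominators. *)
Lemma BD_inv k f x (a : R) : 0 < a -> locally_mesh x (fun p y => a <= f p y) ->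
  BD k f x -> BD k (fun p y => (f p y)^-1) x.
Proof.
move=> a0 fa; have lb : locb (fun p y => (f p y)^-1) x.
  exists a^-1; apply: locally_meshS fa => p y fa.
  have f0 : 0 < f p y by exact: lt_le_trans fa.
  by rewrite gtr0_norm ?invr_gt0 // lef_pV2 ?posrE.
elim: k => [|k IH] fk; split => // i.
have H1 := IH (BDW fk).
have := BD_mul (BD_cst k (-1) x) (BD_mul (fk.2 i) (BD_mul H1 (BD_shift i H1))).
apply: BD_eq.
apply: locally_meshS (locally_meshI (locally_mesh_step x)
  (locally_meshI fa (locally_mesh_shift i fa))) => p y [h0 [f1 f2]].
have n1 := lt0r_neq0 (lt_le_trans a0 f1).
have n2 := lt0r_neq0 (lt_le_trans a0 f2).
have n3 := lt0r_neq0 h0.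
by rewrite /mesh_diff /mesh_shift /fdiff; field; rewrite n1 n2 n3.
Qed.

Lemma fdiff_lapd h i (u : V -> R) y : fdiff h i (lapd h u) y = lapd h (fdiff h i u) y.
Proof.
rewrite /fdiff /lapd -mulrBl mulrAC; congr (_ / _).
rewrite -sumrB mulr_suml; apply: eq_bigr => j _.
rewrite /sdiff /fdiff; set e := evec R i; set e' := evec R j.
rewrite (_ : y + h *: e + h *: e' = y + h *: e' + h *: e); last by rewrite addrAC.
rewrite (_ : y + h *: e + (- h) *: e' = y + (- h) *: e' + h *: e); last by rewrite addrAC.
ring.
Qed.

Lemma locb_mesh_diff i f x : locb f x -> locb (fun p => lapd (hh p) (f p)) x ->
  locb (mesh_diff i f) x.
Proof.
move=> [M fM] [F fF].
have [d d0 dP] := locally_meshI fM fF.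
(* The gradient bound at [y] looks at the cube of radius [2 d / 3] around [y], so [y] may range over
   radius [d / 3], and the mesh must satisfy [2 h <= d / 3]. *)
have d3 : 0 < d / 3 by rewrite divr_gt0.
have d6 : 0 < d / 6 by rewrite divr_gt0.
exists ((2 * N%:R * M / (d / 3) ^+ 2 + F + 1) * (d / 3) + M / (d / 3)).
exists (d / 3) => //.
apply: filterS (filterI dP (hh_small d6)) => p [pP /andP[h0 hd]] y yx.
have sub z : cube y (2 * (d / 3)) z -> cube x d z.
  move=> zy; rewrite (_ : d = d / 3 + 2 * (d / 3)); last by field.
  exact: cube_trans yx zy.
apply: fdiff_bound => //; first by lra.
  by move=> z /sub /pP [].
by move=> z /sub /pP [].
Qed.

(* [fdiff] commutes with [lapd], so the gradient bound can be iterated. *)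
Lemma BD_regularity k f x : BD k f x -> BD k (fun p => lapd (hh p) (f p)) x ->
  BD k.+1 f x.
Proof.
elim: k f => [|k IH] f fk Lk.
  split; first exact: (BD_locb fk).
  by move=> i; split => //; apply: locb_mesh_diff; [exact: BD_locb fk|exact: BD_locb Lk].
split; first exact: (BD_locb fk).
move=> i; apply: IH; first exact: fk.2.
by apply: BD_ext (Lk.2 i) => p y; rewrite /mesh_diff fdiff_lapd.
Qed.

(** Bootstrap: by the equation, [lapd f = c f] has as many bounded differences as [f], and
    [BD_regularity] then gains one order. *)
Lemma BD_solution k f (c : V -> R) x : (forall l, BD l (fun _ => c) x) ->
  locb f x -> locally_mesh x (fun p y => lapd (hh p) (f p) y = c y * f p y) ->
  BD k f x.
Proof.
move=> cB fb fc; elim: k => [|k IH]; first by split.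
apply: BD_regularity => //.
apply: BD_eq (BD_mul (cB k) IH).
by apply: locally_meshS fc => p y ->.
Qed.

Lemma BD_inverse_square k (mu : R) x : x != 0 ->
  BD k (fun _ y => mu / enorm y ^+ 2) x.
Proof.
move=> x0.
have [i xi] : exists i, x ord0 i != 0.
  apply: contrapT => H; case/eqP: x0; apply: row_ext => i; rewrite mxE.
  by apply/eqP; apply: contrapT => /negP xi; apply: H; exists i.
have xi0 : 0 < `|x ord0 i| / 2 by rewrite divr_gt0 // normr_gt0.
have dE y : enorm y ^+ 2 = \sum_(j < N) y ord0 j * y ord0 j.
  rewrite /enorm sqr_sqrtr // /dot; apply: sumr_ge0 => j _.
  by rewrite -expr2 sqr_ge0.
apply: BD_mul; first exact: BD_cst.
apply: (@BD_inv _ _ _ ((`|x ord0 i| / 2) ^+ 2)); first by rewrite exprn_gt0.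
  exists (`|x ord0 i| / 2) => //; apply: filterE => p y /(_ i) yx.
  rewrite dE (bigD1 i) //= -[leLHS]addr0; apply: lerD; last first.
    by apply: sumr_ge0 => j _; rewrite -expr2 sqr_ge0.
  rewrite -expr2 -[y _ _ ^+ 2]real_normK ?num_real //.
  rewrite lerXn2r ?nnegrE ?(ltW xi0) //.
  have := ler_normD (y ord0 i) (x ord0 i - y ord0 i).
  rewrite addrCA subrr addr0 distrC; lra.
have : BD k (fun _ y => \sum_(j < N) y ord0 j * y ord0 j) x.
  by apply: BD_sum => j; apply: BD_mul; exact: BD_coord.
by apply: BD_ext => p y; rewrite dE.
Qed.

End BoundedDifferences.

(** * Vanishing mesh *)

(** The limit is the supremum of the eventual lower bounds; since any set or its complement belongs
    to [U], the family is eventually below every larger number. Values and difference quotients thus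
    converge at all points along the same [U], with no diagonal extraction. *)
Lemma ultra_bounded_cvg (R : realType) (I : Type) (U : set_system I) (a : I -> R)
  (C : R) : UltraFilter U -> (\forall p \near U, `|a p| <= C) -> cvg (a @ U).
Proof.
move=> UU aC; have FU : ProperFilter U := ultra_proper.
pose E := [set r | \forall p \near U, r <= a p].
have hE : has_sup E.
  split; first by exists (- C); apply: filterS aC => p; rewrite ler_norml => /andP[].
  exists C => r rE; have [p [ra]] := filter_ex (filterI rE aC).
  by rewrite ler_norml => /andP[_]; exact: le_trans.
apply/cvg_ex; exists (sup E); apply/cvgrPdist_le => e e0.
have [r rE re] := sup_adherent e0 hE.
have up : \forall p \near U, a p < sup E + e.
  have [H|] := in_ultra_setVsetC [set p | sup E + e <= a p] UU.
    have := ub_le_sup hE.2 H; lra.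
  by apply: filterS => p /= /negP; rewrite -ltNge.
apply: filterS (filterI rE up) => p [ra au].
rewrite ler_norml; apply/andP; split; lra.
Qed.

Lemma cvg_near_eq (R : realType) (T : Type) (F : set_system T) (f g : T -> R)
  (l : R) {FF : Filter F} : f @ F --> l -> (\forall p \near F, f p = g p) -> g @ F --> l.
Proof.
move=> /cvgrPdist_lt fl fg; apply/cvgrPdist_lt => e /fl fe.
by apply: filterS (filterI fg fe) => p [->].
Qed.

Lemma cvg_bigsum (R : realType) (T : Type) (F : set_system T) n
    (f : 'I_n -> T -> R) (l : 'I_n -> R) : Filter F ->
  (forall i, f i @ F --> l i) -> (fun p => \sum_i f i p) @ F --> \sum_i l i.
Proof.
move=> FF; elim: n f l => [|n IH] f l fl.
  rewrite big_ord0; apply: (cvg_near_eq (cvg_cst (0 : R))).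
  by apply: filterE => p; rewrite big_ord0.
rewrite big_ord_recr; have K := cvgD (IH _ _ (fun i => fl (widen_ord (leqnSn n) i)))
  (fl ord_max).
by apply: (cvg_near_eq (K FF)); apply: filterE => p; rewrite big_ord_recr.
Qed.

Lemma quadratic_is_derive (R : realType) (g : R -> R) (a C d : R) : 0 < d ->
  (forall t, `|t| < d -> `|g t - g 0 - t * a| <= C * t ^+ 2) ->
  is_derive (0 : R) 1 g a.
Proof.
move=> d0 gC; apply/is_derive1_caratheodory.
exists (fun z => if z == 0 then a else (g z - g 0) / z); split.
- move=> z; rewrite subr0; case: eqVneq => [->|z0]; first by rewrite subrr mulr0.
  by rewrite divfK.
- apply/cvgrPdist_lt => e e0; rewrite eqxx.
  have C0 : 0 < `|C| + 1 by rewrite ltr_wpDl.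
  have m0 : 0 < Num.min d (e / (`|C| + 1)) by rewrite lt_min d0 divr_gt0.
  exists (Num.min d (e / (`|C| + 1))) => // t /=.
  rewrite sub0r normrN lt_min => /andP[td te].
  case: eqVneq => [_|t0]; first by rewrite subrr normr0.
  have := gC _ td.
  rewrite (_ : g t - g 0 - t * a = - (t * (a - (g t - g 0) / t))); last by field.
  rewrite normrN normrM -[t ^+ 2]real_normK ?num_real // expr2.
  rewrite mulrCA ler_pM2l ?normr_gt0 // => H; apply: le_lt_trans H _.
  apply: (@le_lt_trans _ _ ((`|C| + 1) * `|t|)).
    by rewrite ler_wpM2r //; have := ler_norm C; lra.
  by rewrite mulrC -ltr_pdivlMr.
- by rewrite eqxx.
Qed.

(** First and second derivatives are carried as explicit functions [d] and [H], so that the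
    Laplacian of sums, products and radial factors is computed algebraically as the trace of [H]. *)
Definition jet2 (R : realType) (N : nat) (O : set 'rV[R]_N) (f : 'rV[R]_N -> R)
    (d : 'I_N -> 'rV[R]_N -> R) (H : 'I_N -> 'I_N -> 'rV[R]_N -> R) :=
  forall x, O x -> [/\ {for x, continuous f},
    forall i, {for x, continuous (d i)} /\ is_derive x (evec R i) f (d i x) &
    forall i j, {for x, continuous (H i j)} /\
      is_derive x (evec R j) (d i) (H i j x)].

Section MeshLimit.
Variables (R : realType) (N : nat) (I : Type) (U : set_system I) (hh : I -> R).
Hypotheses (UU : UltraFilter U)
  (hh_small : forall e, 0 < e -> \forall p \near U, 0 < hh p < e).
Local Notation V := 'rV[R]_N.
Implicit Types (x y z : V) (f g : I -> V -> R) (i j : 'I_N).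

Local Instance U_proper : ProperFilter U := ultra_proper.
Local Notation mesh_diff := (mesh_diff hh).

Definition grid_floor (h : R) x : V := \row_j (h * (Num.floor (x ord0 j / h))%:~R).

Lemma grid_floor_near h x j : 0 < h -> x ord0 j - h < grid_floor h x ord0 j <= x ord0 j.
Proof.
move=> h0; have /andP[f1 f2] := floor_itv (x ord0 j / h); rewrite mxE.
rewrite ler_pdivlMr // mulrC in f1; rewrite f1 andbT.
rewrite ltr_pdivrMr // intrD mulrDl mul1r mulrC in f2; lra.
Qed.

Lemma grid_floor_shift h x i t : 0 < h -> 0 <= t ->
  exists m : nat, grid_floor h (x + t *: evec R i) = grid_floor h x + (m%:R * h) *: evec R i /\
    `|m%:R * h - t| <= h.
Proof.
move=> h0 t0.
have ge : (0 <= Num.floor ((x + t *: evec R i) ord0 i / h) -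
                Num.floor (x ord0 i / h))%R.
  rewrite subr_ge0; apply: le_floor; rewrite ler_pM2r ?invr_gt0 //.
  by rewrite shiftE eqxx mulr1 lerDl.
have [m mE] : exists m : nat, Num.floor ((x + t *: evec R i) ord0 i / h) -
                Num.floor (x ord0 i / h) = m%:Z.
  by case: (Num.floor _ - _) ge => // m _; exists m.
have mR : m%:R * h = grid_floor h (x + t *: evec R i) ord0 i - grid_floor h x ord0 i.
  by rewrite [grid_floor _ _ _ _]mxE [grid_floor h x _ _]mxE -mulrBr -intrB mE mulrC.
exists m; split.
  apply: row_ext => j; rewrite [RHS]shiftE; case: (eqVneq j i) => [->|ji].
    by rewrite mulr1 mR; ring.
  by rewrite mulr0 addr0 ![grid_floor _ _ _ _]mxE shiftE (negbTE ji) mulr0 addr0.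
rewrite mR; have := grid_floor_near x i h0; have := grid_floor_near (x + t *: evec R i) i h0.
rewrite shiftE eqxx mulr1 => /andP[? ?] /andP[? ?].
by rewrite ler_norml; apply/andP; split; lra.
Qed.

Lemma cube_open x d y : cube x d y -> exists2 e, 0 < e & cube y e `<=` cube x d.
Proof.
move=> yx.
have [|j|e e0 eP] := @finite_radius R 'I_N
    (fun j e => `|y ord0 j - x ord0 j| + e <= d).
- by move=> j e e' ee; apply: le_trans; rewrite lerD2l.
- by exists (d - `|y ord0 j - x ord0 j|); [rewrite subr_gt0|rewrite subrKC].
exists e => // z zy j; apply: lt_le_trans (eP j).
rewrite -(subrK (y ord0 j) (z ord0 j)) -addrA addrC.
by apply: le_lt_trans (ler_normD _ _) _; rewrite ltrD2l.
Qed.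

Lemma grid_floor_cube x d y : cube x d y -> \forall p \near U, cube x d (grid_floor (hh p) y).
Proof.
move=> /cube_open[e e0 eP]; apply: filterS (hh_small e0) => p /andP[h0 he].
apply: eP => j; have /andP[a b] := grid_floor_near y j h0.
by rewrite ltr_norml; apply/andP; split; lra.
Qed.

(* The values of [f p] on different translates of the grid are unrelated, so
   the limit is taken along the grid through 0. *)
Definition mesh_lim f x : R := lim ((fun p => f p (grid_floor (hh p) x)) @ U).

Lemma mesh_lim_cvg f x : locb U f x -> (fun p => f p (grid_floor (hh p) x)) @ U --> mesh_lim f x.
Proof.
move=> [C [d d0 fC]]; apply: (@ultra_bounded_cvg _ _ _ _ C) => //.
by apply: filterS (filterI fC (grid_floor_cube (cube_center x d0))) => p [H /H].
Qed.

Lemma locb_cube f x C d y : (\forall p \near U, forall z, cube x d z -> `|f p z| <= C) ->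
  cube x d y -> locb U f y.
Proof.
move=> fC /cube_open[e e0 eP]; exists C, e => //.
by apply: filterS fC => p H z /eP /H.
Qed.

Lemma cube_segment x d y i (m k : nat) h : 0 <= h -> (k <= m)%N ->
  cube x d y -> cube x d (y + (m%:R * h) *: evec R i) ->
  cube x d (y + (k%:R * h) *: evec R i).
Proof.
move=> h0 km yx yx' j; have := yx j; have := yx' j; rewrite !shiftE.
case: (j == i); rewrite ?mulr1 ?mulr0 ?addr0 // !ltr_norml.
have : k%:R * h <= m%:R * h by rewrite ler_wpM2r ?ler_nat.
have : 0 <= k%:R * h by rewrite mulr_ge0.
by move=> ? ? /andP[? ?] /andP[? ?]; apply/andP; split; lra.
Qed.

Lemma discrete_taylor (u : V -> R) h i x d C y (m : nat) : 0 < h ->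
  (forall z, cube x d z -> `|fdiff h i u z| <= C) ->
  cube x d y -> cube x d (y + (m%:R * h) *: evec R i) ->
  `|u (y + (m%:R * h) *: evec R i) - u y| <= C * (m%:R * h).
Proof.
move=> h0 uC yx; elim: m => [|m IH] ym.
  by rewrite !mul0r scale0r addr0 subrr normr0 mulr0.
have ym' := cube_segment (ltW h0) (leqnSn m) yx ym.
have {}IH := IH ym'; have := uC _ ym'.
rewrite /fdiff -addrA -scalerDl -{2}[h]mul1r -mulrDl natr1.
rewrite normrM normfV (gtr0_norm h0) ler_pdivrMr // => H.
rewrite -[m.+1%:R in leRHS]natr1 mulrDl mul1r mulrDr.
rewrite [X in `|X|](_ : _ = (u (y + (m.+1%:R * h) *: evec R i) -
  u (y + (m%:R * h) *: evec R i)) + (u (y + (m%:R * h) *: evec R i) - u y)).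
  by apply: le_trans (ler_normD _ _) _; rewrite [leRHS]addrC; exact: lerD.
by ring.
Qed.

(** Induction on the number of steps, using the first-order estimate for the difference quotient
    itself. The constant [C] in place of [C / 2] suffices, since only the quadratic order enters. *)
Lemma discrete_taylor2 (u : V -> R) h i x d C y (m : nat) : 0 < h ->
  (forall z, cube x d z -> `|fdiff h i (fdiff h i u) z| <= C) ->
  cube x d y -> cube x d (y + (m%:R * h) *: evec R i) ->
  `|u (y + (m%:R * h) *: evec R i) - u y - m%:R * h * fdiff h i u y|
    <= C * (m%:R * h) ^+ 2.
Proof.
move=> h0 uC yx; elim: m => [|m IH] ym.
  by rewrite !mul0r scale0r addr0 subrr subr0 normr0 expr0n mulr0.
have ym' := cube_segment (ltW h0) (leqnSn m) yx ym.
have C0 : 0 <= C by apply: le_trans (uC _ yx).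
have {}IH := IH ym'; have := discrete_taylor h0 uC yx ym'.
rewrite {1}/fdiff -addrA -scalerDl -{2}[h]mul1r -mulrDl natr1.
set a := u (y + (m.+1%:R * h) *: _); set b := u (y + _) in IH *; set q := fdiff h i u y in IH *.
rewrite (_ : (a - b) / h - q = (a - b - h * q) / h); last first.
  by field; rewrite gt_eqF.
rewrite normrM normfV (gtr0_norm h0) ler_pdivrMr // => H.
have -> : a - u y - m.+1%:R * h * q = (a - b - h * q) + (b - u y - m%:R * h * q).
  by rewrite -[m.+1%:R]natr1; ring.
apply: le_trans (ler_normD _ _) _; apply: le_trans (lerD H IH) _.
rewrite -[m.+1%:R]natr1 -mulrA -mulrDr ler_wpM2l //.
have : 0 <= m%:R * h * h + h ^+ 2 by rewrite addr_ge0 ?mulr_ge0 ?sqr_ge0 // ltW.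
lra.
Qed.

Lemma lim_bound (a : I -> R) (l K C : R) : a @ U --> l ->
  (\forall p \near U, `|a p| <= K + C * hh p) -> `|l| <= K.
Proof.
move=> al aK; apply/ler_addgt0Pl => e e0.
have C0 : 0 < `|C| + 1 by rewrite ltr_wpDl.
have e2 : 0 < e / 2 by rewrite divr_gt0.
have eC : 0 < e / 2 / (`|C| + 1) by rewrite divr_gt0.
have /cvgrPdist_lt /(_ _ e2) al' := al.
have [p [[ap /andP[h0 hp]] lp]] :=
  filter_ex (filterI (filterI aK (hh_small eC)) al').
have H1 := ler_normD (l - a p) (a p); rewrite subrK in H1.
have H2 : C * hh p <= e / 2.
  apply: (@le_trans _ _ ((`|C| + 1) * hh p)).
    by rewrite ler_wpM2r ?(ltW h0) //; have := ler_norm C; lra.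
  by rewrite mulrC -ler_pdivlMr // ltW.
lra.
Qed.

Lemma mesh_lim_cvg_cube f x C d y : (\forall p \near U, forall z, cube x d z -> `|f p z| <= C) ->
  cube x d y -> (fun p => f p (grid_floor (hh p) y)) @ U --> mesh_lim f y.
Proof. by move=> fC yx; apply: mesh_lim_cvg; exact: locb_cube fC yx. Qed.

Lemma hh_pos : \forall p \near U, 0 < hh p.
Proof. by apply: filterS (hh_small ltr01) => p /andP[]. Qed.

Lemma mesh_lim_lipschitz f x i : locb U f x -> locb U (mesh_diff i f) x ->
  exists C d, 0 < d /\ forall y t, cube x d y -> cube x d (y + t *: evec R i) ->
    `|mesh_lim f (y + t *: evec R i) - mesh_lim f y| <= C * `|t|.
Proof.
move=> [C1 fC1] [C fC]; have [d d0 dP] := locally_meshI _ fC1 fC.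
have f1 : \forall p \near U, forall z, cube x d z -> `|f p z| <= C1.
  by apply: filterS dP => p H z /H [].
have f2 : \forall p \near U, forall z, cube x d z -> `|mesh_diff i f p z| <= C.
  by apply: filterS dP => p H z /H [].
have C0 : 0 <= C.
  by have [p /(_ x (cube_center x d0))] := filter_ex f2; exact: le_trans.
exists C, d; split => //.
suff pos : forall y t, 0 <= t -> cube x d y -> cube x d (y + t *: evec R i) ->
    `|mesh_lim f (y + t *: evec R i) - mesh_lim f y| <= C * t.
  move=> y t yx yt; case: (leP 0 t) => t0; first by rewrite (ger0_norm t0); apply: pos.
  rewrite (ltr0_norm t0).
  have yE : (y + t *: evec R i) + (- t) *: evec R i = y.
    by rewrite scaleNr addrK.
  have := pos (y + t *: evec R i) (- t); rewrite yE distrC.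
  by apply => //; rewrite oppr_ge0 ltW.
move=> y t t0 yx yt.
apply: (@lim_bound (fun p => f p (grid_floor (hh p) (y + t *: evec R i)) - f p (grid_floor (hh p) y))
  _ _ C).
  by apply: cvgB; apply: mesh_lim_cvg_cube f1 _.
apply: filterS (filterI hh_pos (filterI f2 (filterI (grid_floor_cube yx) (grid_floor_cube yt)))).
move=> p [h0 [fp [fy ft]]]; have [m [mE mt]] := grid_floor_shift y i h0 t0.
rewrite mE in ft *; apply: le_trans (discrete_taylor h0 fp fy ft) _.
by rewrite -mulrDr ler_wpM2l //; have := ler_norm (m%:R * hh p - t); lra.
Qed.

Lemma mesh_lim_continuous f x : locb U f x -> (forall i, locb U (mesh_diff i f) x) ->
  {for x, continuous (mesh_lim f)}.
Proof.
by move=> fb fD; apply: coord_lipschitz_continuous => i; exact: mesh_lim_lipschitz.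
Qed.

Lemma mesh_lim_is_derive f x i : locb U f x -> locb U (mesh_diff i f) x ->
  locb U (mesh_diff i (mesh_diff i f)) x -> is_derive x (evec R i) (mesh_lim f) (mesh_lim (mesh_diff i f) x).
Proof.
move=> fb fD fDD.
have [K [d1 [d10 lip]]] := mesh_lim_lipschitz fD fDD.
case: fb fD fDD => [C1 fC1] [C2 fC2] [C fC].
have [d2 d20 dP] := locally_meshI _ fC1 (locally_meshI _ fC2 fC).
pose d := Num.min d1 d2.
have d0 : 0 < d by rewrite lt_min d10.
have sub1 : cube x d `<=` cube x d1 by apply: subset_cube; rewrite ge_min lexx.
have sub2 : cube x d `<=` cube x d2.
  by apply: subset_cube; rewrite ge_min lexx orbT.
have f1 : \forall p \near U, forall z, cube x d z -> `|f p z| <= C1.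
  by apply: filterS dP => p H z /sub2 /H [].
have f2 : \forall p \near U, forall z, cube x d z -> `|mesh_diff i f p z| <= C2.
  by apply: filterS dP => p H z /sub2 /H [_ []].
have f3 : \forall p \near U, forall z, cube x d z -> `|mesh_diff i (mesh_diff i f) p z| <= C.
  by apply: filterS dP => p H z /sub2 /H [_ []].
have C0 : 0 <= C.
  by have [p /(_ x (cube_center x d0))] := filter_ex f3; exact: le_trans.
have C20 : 0 <= C2.
  by have [p /(_ x (cube_center x d0))] := filter_ex f2; exact: le_trans.
(* Replacing [t] by the grid multiple [m h] costs at most [h]; the resulting terms are at most
   linear in [h] and disappear in the limit. *)
have pos y t : 0 <= t -> cube x d y -> cube x d (y + t *: evec R i) ->
    `|mesh_lim f (y + t *: evec R i) - mesh_lim f y - t * mesh_lim (mesh_diff i f) y| <= C * t ^+ 2.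
  move=> t0 yx yt.
  apply: (@lim_bound (fun p => f p (grid_floor (hh p) (y + t *: evec R i))
    - f p (grid_floor (hh p) y) - t * mesh_diff i f p (grid_floor (hh p) y)) _ _ (C * (2 * t + 1) + C2)).
    apply: cvgB; first by apply: cvgB; apply: mesh_lim_cvg_cube f1 _.
    by apply: cvgM; [exact: cvg_cst|exact: mesh_lim_cvg_cube f2 _].
  apply: filterS (filterI (hh_small ltr01)
    (filterI f2 (filterI f3 (filterI (grid_floor_cube yx) (grid_floor_cube yt))))).
  move=> p [/andP[h0 h1] [f2p [f3p [fy ft]]]].
  have [m [mE mt]] := grid_floor_shift y i h0 t0.
  rewrite mE in ft *; have := discrete_taylor2 h0 f3p fy ft.
  rewrite -/(mesh_diff i f p); set q := mesh_diff i f p _; set T := m%:R * hh p; set a := f p _ - f p _ => H.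
  have -> : a - t * q = (a - T * q) + (T - t) * q by ring.
  apply: le_trans (ler_normD _ _) _.
  have qC : `|(T - t) * q| <= hh p * C2 by rewrite normrM ler_pM //; exact: f2p.
  apply: le_trans (lerD H qC) _.
  have T0 : 0 <= T by rewrite mulr_ge0 // ltW.
  have TT : T <= t + hh p by have := ler_norm (T - t); lra.
  have : T ^+ 2 <= (t + hh p) ^+ 2 by rewrite lerXn2r // nnegrE; lra.
  move=> TT2; have : hh p * hh p <= hh p * 1 by rewrite ler_wpM2l // ltW.
  move=> hh2; have : C * T ^+ 2 <= C * (t ^+ 2 + (2 * t + 1) * hh p).
    by rewrite ler_wpM2l //; lra.
  by lra.
have xE : x + (0 : R) *: evec R i = x by rewrite scale0r addr0.
apply: is_derive_of_line.
apply: (@quadratic_is_derive _ _ _ (C + K) d) => // t td.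
rewrite xE.
have xt : cube x d (x + t *: evec R i) by exact: shift_cube0.
case: (leP 0 t) => t0.
  have := pos x t t0 (cube_center x d0) xt.
  have : 0 <= K * t ^+ 2.
    rewrite expr2 mulrA mulr_ge0 //.
    have := lip x t (cube_center x d10) (sub1 _ xt).
    by rewrite (ger0_norm t0); exact: le_trans.
  by rewrite mulrDl; lra.
(* For [t < 0] the forward estimate is applied from the left end point [x + t e_i]. Moving the
   derivative back to [x] costs [K t^2] by its Lipschitz bound. *)
have nt : 0 <= - t by rewrite oppr_ge0 ltW.
have yE : (x + t *: evec R i) + (- t) *: evec R i = x.
  by rewrite scaleNr addrK.
have := pos (x + t *: evec R i) (- t) nt xt.
rewrite yE => /(_ (cube_center x d0)); rewrite sqrrN.
have := lip x t (cube_center x d10) (sub1 _ xt).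
set F := mesh_lim f (x + _); set F' := mesh_lim f x; set q := mesh_lim (mesh_diff i f) (x + _).
set q' := mesh_lim (mesh_diff i f) x.
rewrite (ltr0_norm t0) => H1 H2.
have -> : F - F' - t * q' = - (F' - F - - t * q) + t * (q - q') by ring.
apply: le_trans (ler_normD _ _) _; rewrite normrN mulrDl lerD //.
rewrite normrM (ltr0_norm t0).
have : - t * `|q - q'| <= - t * (K * - t) by rewrite ler_wpM2l.
by rewrite (_ : - t * (K * - t) = K * t ^+ 2) //; ring.
Qed.

(** Three orders are used because bounded third differences make the limits of the second ones
    Lipschitz in each coordinate, hence continuous. *)
Lemma mesh_lim_jet2 (O : set V) f : (forall x, O x -> BD U hh 3 f x) ->
  jet2 O (mesh_lim f) (fun i => mesh_lim (mesh_diff i f)) (fun i j => mesh_lim (mesh_diff j (mesh_diff i f))).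
Proof.
move=> fB x /fB f3; have [fb fD] := f3.
have Db k g : BD U hh k.+1 g x -> forall i, BD U hh k (mesh_diff i g) x by move=> [].
have b1 i : BD U hh 2 (mesh_diff i f) x by exact: Db.
have b2 i j : BD U hh 1 (mesh_diff j (mesh_diff i f)) x by exact: Db.
have b3 i j k : BD U hh 0 (mesh_diff k (mesh_diff j (mesh_diff i f))) x by exact: Db.
split.
- by apply: mesh_lim_continuous => // i; exact: BD_locb (b1 i).
- move=> i; split.
    by apply: mesh_lim_continuous => [|j]; [exact: BD_locb (b1 i)|exact: BD_locb (b2 i j)].
  by apply: mesh_lim_is_derive => //; [exact: BD_locb (b1 i)|exact: BD_locb (b2 i i)].
- move=> i j; split.
    by apply: mesh_lim_continuous => [|k]; [exact: BD_locb (b2 i j)|exact: BD_locb (b3 i j k)].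
  apply: mesh_lim_is_derive; [exact: BD_locb (b1 i)|exact: BD_locb (b2 i j)|].
  exact: BD_locb (b3 i j j).
Qed.

Lemma sdiff_fdiff h i (u : V -> R) y : h != 0 ->
  sdiff h i u y = h ^+ 2 * fdiff h i (fdiff h i u) (y + (- h) *: evec R i).
Proof.
move=> h0; rewrite /sdiff /fdiff scaleNr subrK; by field.
Qed.

(** The centred second difference at [y] is the iterated forward one at [y - h e_i]. Bounded third
    differences make this displacement negligible, so [lapd] converges to the trace of the limit
    second derivatives. *)
Lemma mesh_lim_lapd f (c : V -> R) x : BD U hh 3 f x -> {for x, continuous c} ->
  locally_mesh U x (fun p y => lapd (hh p) (f p) y = c y * f p y) ->
  \sum_i mesh_lim (mesh_diff i (mesh_diff i f)) x = c x * mesh_lim f x.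
Proof.
move=> f3 cc fc; have [fb fD] := f3.
have Db k g : BD U hh k.+1 g x -> forall i, BD U hh k (mesh_diff i g) x by move=> [].
have b1 i : BD U hh 2 (mesh_diff i f) x by exact: Db.
have b2 i j : BD U hh 1 (mesh_diff j (mesh_diff i f)) x by exact: Db.
have b3 i j k : locb U (mesh_diff k (mesh_diff j (mesh_diff i f))) x by exact: BD_locb (Db _ _ (b2 i j) k).
have cv1 i : (fun p => mesh_diff i (mesh_diff i f) p (grid_floor (hh p) x + (- hh p) *: evec R i)) @ U -->
    mesh_lim (mesh_diff i (mesh_diff i f)) x.
  have [C [d d0 dP]] := b3 i i i.
  have H := mesh_lim_cvg (BD_locb (b2 i i)).
  have C0 : 0 <= C.
    by have [p /(_ x (cube_center x d0))] := filter_ex dP; exact: le_trans.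
  have d2 : 0 < d / 2 by rewrite divr_gt0.
  have dif : (fun p => mesh_diff i (mesh_diff i f) p (grid_floor (hh p) x) -
      mesh_diff i (mesh_diff i f) p (grid_floor (hh p) x + (- hh p) *: evec R i)) @ U --> (0 : R).
    apply/cvgrPdist_le => e e0.
    have eC : 0 < e / (C + 1) by rewrite divr_gt0 //; lra.
    apply: filterS (filterI dP (filterI (grid_floor_cube (cube_center x d2))
      (filterI (hh_small eC) (hh_small d2)))).
    move=> p [fp [fx [/andP[h0 he] /andP[_ hd]]]].
    have zx : cube x d (grid_floor (hh p) x + (- hh p) *: evec R i).
      rewrite (_ : d = d / 2 + d / 2); last by field.
      by apply: shift_cube fx _; rewrite normrN gtr0_norm // ltW.
    have := fp _ zx; rewrite {1}/mesh_diff /fdiff {1}scaleNr subrK normrM normfV (gtr0_norm h0).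
    rewrite ler_pdivrMr //. rewrite sub0r normrN => /le_trans; apply.
    move: he; rewrite ltr_pdivlMr; last by lra.
    by move: (C) => ?; lra.
  have K := cvgB H dif; rewrite subr0 in K.
  apply: (cvg_near_eq (K _)); apply: filterE => p /=.
  by rewrite opprB addrCA subrr addr0.
have cv2 : (fun p => \sum_i mesh_diff i (mesh_diff i f) p (grid_floor (hh p) x + (- hh p) *: evec R i)) @ U
    --> \sum_i mesh_lim (mesh_diff i (mesh_diff i f)) x.
  by apply: cvg_bigsum => i; exact: cv1.
have cv3 : (fun p => c (grid_floor (hh p) x) * f p (grid_floor (hh p) x)) @ U --> c x * mesh_lim f x.
  apply: cvgM; last exact: mesh_lim_cvg.
  apply/cvgrPdist_lt => e e0; have /continuous_cube /(_ e e0) [d d0 dP] := cc.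
  by apply: filterS (grid_floor_cube (cube_center x d0)) => p /dP; rewrite distrC.
rewrite -(cvg_lim (@norm_hausdorff R R) cv2); apply: (cvg_lim (@norm_hausdorff R R)).
apply: (cvg_near_eq cv3).
have [d d0 dP] := fc.
apply: filterS (filterI dP (filterI hh_pos (grid_floor_cube (cube_center x d0)))).
move=> p [fp [h0 fx]]; rewrite -fp // /lapd.
have h2 : hh p ^+ 2 != 0 by rewrite expf_neq0 // gt_eqF.
apply: (mulIf h2); rewrite divfK // mulr_suml; apply: eq_bigr => i _.
by rewrite sdiff_fdiff ?gt_eqF // mulrC.
Qed.

End MeshLimit.

(** The bounds [A] and [B] make the discrete solutions locally bounded, and [BD_solution] then
    bounds all their differences. Continuity of [S] at [x] carries the comparison from the grid
    point near [x] to the limit. *)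
Theorem sub_super_solution (R : realType) (N : nat) (O : set 'rV[R]_N) (mu : R)
    (A B : 'rV[R]_N -> R) (c := fun x : 'rV[R]_N => mu / enorm x ^+ 2) :
  (0 < N)%N -> open O -> (forall x, O x -> x != 0) ->
  (forall x, O x -> {for x, continuous A}) ->
  (forall x, O x -> {for x, continuous B}) ->
  (forall x, O x -> A x <= B x) -> dsub O c A -> dsuper O c B ->
  exists phi d H, [/\ jet2 O phi d H,
    forall x, O x -> \sum_i H i i x = c x * phi x,
    forall x, O x -> A x <= phi x <= B x &
    forall S, (forall x, O x -> A x <= S x) -> dsuper O c S ->
      forall x, O x -> {for x, continuous S} -> phi x <= S x].
Proof.
move=> N0 oO O0 cA cB AB Asub Bsup.
have cc x : O x -> {for x, continuous c}.
  by move=> /O0; exact: potential_continuous.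
have [u [uAB uE uS]] := discrete_family oO cc AB Asub Bsup N0.
have [U [UU UF]] := ultraFilterLemma (@mesh_filter_proper R).
pose hh := @snd nat R.
have hh_small e : 0 < e -> \forall p \near U, 0 < hh p < e.
  move=> e0; apply: UF; exists 0%N => n _; exists e => // h h0 he.
  by rewrite /= h0.
have FU : ProperFilter U := ultra_proper.
have mesh x : O x -> locally_mesh U x (fun p y => inner O p.1 y).
  move=> Ox; have [n0 [d d0 dP]] := inner_nbhs oO Ox.
  exists d => //; apply: UF; exists n0 => n n0n; exists 1 => // h _ _ y.
  exact: dP.
have cube_O x : O x -> locally_mesh U x (fun p y => O y).
  by move=> /mesh; apply: locally_meshS => p y; exact: inner_sub.
have ub x : O x -> locb U u x.
  move=> Ox.
  have /continuous_cube /(_ 1 ltr01) [d1 d10 d1P] := cA _ Ox.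
  have /continuous_cube /(_ 1 ltr01) [d2 d20 d2P] := cB _ Ox.
  have [d dO dP] := open_cube oO Ox.
  exists (`|A x| + `|B x| + 1).
  exists (Num.min d (Num.min d1 d2)); first by rewrite !lt_min dO d10.
  apply: filterS (UF _ uAB) => p up y yx.
  have y1 : cube x d1 y by apply: subset_cube yx; rewrite !ge_min lexx orbT.
  have y2 : cube x d2 y by apply: subset_cube yx; rewrite !ge_min lexx !orbT.
  have y3 : cube x d y by exact: cube_minl yx.
  have /andP[u1 u2] := up _ (dP _ y3).
  have := d1P _ y1; have := d2P _ y2; rewrite !ltr_norml => /andP[? ?] /andP[? ?].
  have := ler_norm (B x); have := ler_norm (- A x); rewrite normrN => ? ?.
  have := normr_ge0 (A x); have := normr_ge0 (B x) => ? ?.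
  by rewrite ler_norml; apply/andP; split; lra.
have ueq x : O x -> locally_mesh U x (fun p y => lapd (hh p) (u p) y = c y * u p y).
  move=> /mesh [d d0 dP]; exists d => //.
  by apply: filterS (filterI dP (UF _ uE)) => p [H1 H2] y /H1 /H2.
have u3 x : O x -> BD U hh 3 u x.
  move=> Ox; apply: (BD_solution _ hh_small 3 _ (ub _ Ox) (ueq _ Ox)) => l.
  by apply: BD_inverse_square => //; exact: O0.
have grid_floor_cvg (S : 'rV[R]_N -> R) x : {for x, continuous S} ->
    (fun p => S (grid_floor (hh p) x)) @ U --> S x.
  move=> cS; apply/cvgrPdist_lt => e e0.
  have /continuous_cube /(_ e e0) [d d0 dP] := cS.
  by apply: filterS (grid_floor_cube UU hh_small (cube_center x d0)) => p /dP; rewrite distrC.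
have flO x : O x -> \forall p \near U, O (grid_floor (hh p) x).
  move=> Ox; have [d d0 dO] := open_cube oO Ox.
  by apply: filterS (grid_floor_cube UU hh_small (cube_center x d0)) => p /dO.
exists (mesh_lim U hh u), (fun i => mesh_lim U hh (mesh_diff hh i u)), (fun i j => mesh_lim U hh (mesh_diff hh j (mesh_diff hh i u))).
split.
- exact: mesh_lim_jet2.
- by move=> x Ox; apply: mesh_lim_lapd => //; [exact: u3|exact: cc|exact: ueq].
- move=> x Ox; have uc := mesh_lim_cvg UU hh_small (ub _ Ox).
  apply/andP; split.
    apply: (ler_cvg_to (grid_floor_cvg _ _ (cA _ Ox)) uc).
    by apply: filterS (filterI (UF _ uAB) (flO _ Ox)) => p [H /H /andP[]].
  apply: (ler_cvg_to uc (grid_floor_cvg _ _ (cB _ Ox))).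
  by apply: filterS (filterI (UF _ uAB) (flO _ Ox)) => p [H /H /andP[]].
- move=> S AS Ssup x Ox cS; have uc := mesh_lim_cvg UU hh_small (ub _ Ox).
  apply: (ler_cvg_to uc (grid_floor_cvg _ _ cS)).
  by apply: filterS (filterI (UF _ (uS _ AS Ssup)) (flO _ Ox)) => p [H /H].
Qed.

(** * Second-order jets *)

Section Jets.
Variables (R : realType) (N : nat).
Local Notation V := 'rV[R]_N.
Implicit Types (x y z : V) (i j : 'I_N) (O : set V) (f g : V -> R).

Lemma jet2_sub O O' f d H : O' `<=` O -> jet2 O f d H -> jet2 O' f d H.
Proof. by move=> OO fJ x /OO /fJ. Qed.

Lemma jet2_pderiv O f : C2_on O f ->
  jet2 O f (fun i => pderiv i f) (fun i j => pderiv j (pderiv i f)).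
Proof.
move=> fC x /fC[fc fd fdd]; split=> // [i|i j].
  by have [? ?] := fd i; split=> //; apply: DeriveDef.
by have [? ?] := fdd i j; split=> //; apply: DeriveDef.
Qed.

Lemma jet2_C2 O f d H : open O -> jet2 O f d H ->
  C2_on O f /\ forall x, O x -> lap f x = \sum_i H i i x.
Proof.
move=> oO fJ.
have dE i x : O x -> pderiv i f x = d i x.
  by move=> /fJ[_ /(_ i)[_ fd] _]; rewrite /pderiv; case: fd.
have dN i x : O x -> \near x, d i x = pderiv i f x.
  move=> Ox; apply: filterS (open_nbhs_nbhs (conj oO Ox)) => y Oy.
  by rewrite dE.
have HD i j x : O x -> is_derive x (evec R j) (pderiv i f) (H i j x).
  move=> Ox; have [_ _ /(_ i j)[_ fH]] := fJ _ Ox.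
  exact: near_eq_is_derive (dN i _ Ox) fH.
have HE i j x : O x -> pderiv j (pderiv i f) x = H i j x.
  by move=> Ox; have := HD i j _ Ox; rewrite {1}/pderiv; case.
have cont g h x : O x -> (forall y, O y -> g y = h y) ->
    {for x, continuous g} -> {for x, continuous h}.
  move=> Ox gh /continuous_cube gc; apply/continuous_cube => e /gc[a a0 aP].
  have [b b0 bO] := open_cube oO Ox.
  exists (Num.min a b); first by rewrite lt_min a0.
  move=> y yx; rewrite -!gh //.
    by apply: aP; apply: cube_minl yx.
  by apply: bO; apply: cube_minr yx.
split; last by move=> x Ox; apply: eq_bigr => i _; rewrite HE.
move=> x Ox; have [fc fd fH] := fJ _ Ox; split=> // [i|i j].
  have [dic fdi] := fd i; split; first by case: fdi.
  by apply: cont dic => // y Oy; rewrite dE.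
have [Hc _] := fH i j; split; first by have := HD i j _ Ox; case.
by apply: cont Hc => // y Oy; rewrite HE.
Qed.

Lemma jet2_cst O (a : R) : jet2 O (fun _ => a) (fun _ _ => 0) (fun _ _ _ => 0).
Proof.
have c0 (b : R) x i : is_derive x (evec R i) (fun _ : V => b) 0.
  exact: is_derive_cst.
move=> x _; split=> [|i|i j]; first exact: continuous_cst.
  by split; [exact: continuous_cst|exact: c0].
by split; [exact: continuous_cst|exact: c0].
Qed.

Lemma is_derive_coord x i j :
  is_derive x (evec R j) (fun y : V => y ord0 i) (i == j)%:R.
Proof.
apply: is_derive_of_line.
rewrite (_ : (fun t => _) = fun t : R => x ord0 i + (i == j)%:R * t); last first.
  by apply/funext => t; rewrite shiftE mulrC.
apply: (@quadratic_is_derive _ _ _ 0 1) => // t _.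
by rewrite mulr0 addr0 mul0r (_ : _ - _ - _ = 0) ?normr0 //; ring.
Qed.

Lemma jet2_coord O i : jet2 O (fun x => x ord0 i) (fun j _ => (i == j)%:R)
  (fun _ _ _ => 0).
Proof.
move=> x _; split=> [|j|j k]; first exact: coord_cvg.
  by split; [exact: continuous_cst|exact: is_derive_coord].
by split; [exact: continuous_cst|exact: is_derive_cst].
Qed.

Lemma is_derive_add f g x i (a b : R) : is_derive x (evec R i) f a ->
  is_derive x (evec R i) g b -> is_derive x (evec R i) (fun y => f y + g y) (a + b).
Proof. by move=> fd gd; exact: is_deriveD. Qed.

Lemma is_derive_mul f g x i (a b : R) : is_derive x (evec R i) f a ->
  is_derive x (evec R i) g b ->
  is_derive x (evec R i) (fun y => f y * g y) (f x * b + g x * a).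
Proof. by move=> fd gd; exact: is_deriveM. Qed.

Lemma is_derive_chain (P : R -> R) f x i (a p : R) : is_derive (f x) 1 P p ->
  is_derive x (evec R i) f a -> is_derive x (evec R i) (fun y => P (f y)) (p * a).
Proof.
move=> Pd fd; apply: is_derive_of_line.
have x0 : x = x + (0 : R) *: evec R i by rewrite scale0r addr0.
rewrite x0 in Pd fd; have fl := is_derive_line fd.
exact: (@is_derive1_comp _ P (fun t : R => f (x + t *: evec R i)) 0 _ _ Pd fl).
Qed.

Lemma jet2_add O f d H g d' H' : jet2 O f d H -> jet2 O g d' H' ->
  jet2 O (fun x => f x + g x) (fun i x => d i x + d' i x)
    (fun i j x => H i j x + H' i j x).
Proof.
move=> fJ gJ x Ox; have [fc fd fH] := fJ _ Ox; have [gc gd gH] := gJ _ Ox.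
split=> [|i|i j]; first exact: continuous_add.
  have [? ?] := fd i; have [? ?] := gd i.
  by split; [exact: continuous_add|exact: is_derive_add].
have [? ?] := fH i j; have [? ?] := gH i j.
by split; [exact: continuous_add|exact: is_derive_add].
Qed.

Lemma jet2_mul O f d H g d' H' : jet2 O f d H -> jet2 O g d' H' ->
  jet2 O (fun x => f x * g x) (fun i x => f x * d' i x + g x * d i x)
    (fun i j x => f x * H' i j x + d' i x * d j x
      + (g x * H i j x + d i x * d' j x)).
Proof.
move=> fJ gJ x Ox; have [fc fd fH] := fJ _ Ox; have [gc gd gH] := gJ _ Ox.
split=> [|i|i j]; first exact: continuous_mul.
  have [? ?] := fd i; have [? ?] := gd i; split; last exact: is_derive_mul.
  by apply: continuous_add; exact: continuous_mul.
have [fci fdi] := fd i; have [gci gdi] := gd i.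
have [fcj fdj] := fd j; have [gcj gdj] := gd j.
have [? ?] := fH i j; have [? ?] := gH i j; split.
  by apply: continuous_add; apply: continuous_add; exact: continuous_mul.
by apply: is_derive_add; apply: is_derive_mul.
Qed.

Lemma jet2_comp O f d H (P P1 P2 : R -> R) : jet2 O f d H ->
  (forall x, O x -> is_derive (f x) 1 P (P1 (f x))) ->
  (forall x, O x -> is_derive (f x) 1 P1 (P2 (f x))) ->
  (forall x, O x -> {for f x, continuous P2}) ->
  jet2 O (fun x => P (f x)) (fun i x => P1 (f x) * d i x)
    (fun i j x => P1 (f x) * H i j x + d i x * (P2 (f x) * d j x)).
Proof.
move=> fJ PD P1D P2c x Ox; have [fc fd fH] := fJ _ Ox.
have Pc := is_derive1_continuous (PD _ Ox).
have P1c := is_derive1_continuous (P1D _ Ox).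
have P1fc : {for x, continuous (fun x => P1 (f x))}.
  exact: (@continuous_comp _ _ _ f P1).
have P2fc : {for x, continuous (fun x => P2 (f x))}.
  by apply: (@continuous_comp _ _ _ f P2) => //; exact: P2c.
split=> [|i|i j].
- exact: (@continuous_comp _ _ _ f P).
- have [? ?] := fd i; split; first exact: continuous_mul.
  by apply: is_derive_chain => //; exact: PD.
have [? ?] := fd i; have [? ?] := fd j; have [? ?] := fH i j; split.
  by apply: continuous_add; do ?apply: continuous_mul.
by apply: is_derive_mul => //; apply: is_derive_chain => //; exact: P1D.
Qed.

Lemma jet2_eq O f d H g d' H' : jet2 O f d H -> (forall x, f x = g x) ->
  (forall i x, d i x = d' i x) -> (forall i j x, H i j x = H' i j x) ->
  jet2 O g d' H'.
Proof.
move=> fJ fg dd HH; have -> : g = f by apply/funext => x; rewrite fg.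
have -> : d' = d by apply/funext => i; apply/funext => x; rewrite dd.
by have -> : H' = H by do 3!apply/funext => ?; rewrite HH.
Qed.

Lemma jet2_bigsum O n (f : 'I_n -> V -> R) d H :
  (forall k, jet2 O (f k) (d k) (H k)) ->
  jet2 O (fun x => \sum_k f k x) (fun i x => \sum_k d k i x)
    (fun i j x => \sum_k H k i j x).
Proof.
elim: n f d H => [|n IH] f d H fJ.
  by apply: (jet2_eq (@jet2_cst O 0)) => *; rewrite big_ord0.
apply: (jet2_eq (jet2_add (IH _ _ _ (fun k => fJ (widen_ord (leqnSn n) k))) (fJ ord_max)));
  by move=> *; rewrite big_ord_recr.
Qed.

Lemma jet2_dist2 O z : jet2 O (fun x => dot (x - z) (x - z))
  (fun i x => 2 * (x ord0 i - z ord0 i)) (fun i j _ => 2 * (i == j)%:R).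
Proof.
have J k := jet2_add (@jet2_coord O k) (@jet2_cst O (- z ord0 k)).
apply: (jet2_eq (jet2_bigsum (fun k => jet2_mul (J k) (J k)))).
- by move=> x; apply: eq_bigr => k _; rewrite !mxE.
- move=> i x; rewrite (bigD1 i) //= eqxx big1 => [|k ki].
    by rewrite !addr0 mulr1; ring.
  by rewrite (negbTE ki) !(addr0, mulr0).
- move=> i j x; rewrite (bigD1 i) //= eqxx big1 => [|k ki].
    by case: (i == j); rewrite /= ?mulr1n ?mulr0n; ring.
  by rewrite (negbTE ki) !(addr0, mulr0, mul0r).
Qed.

(* The radial factor [P] is a function of the squared distance [s] to [z], so
   that the chain rule involves no square root. *)
Lemma jet2_radial O z f d H (P P1 P2 : R -> R) : jet2 O f d H ->
  (forall x, O x -> let s := dot (x - z) (x - z) in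
    [/\ is_derive s 1 P (P1 s), is_derive s 1 P1 (P2 s) &
        {for s, continuous P2}]) ->
  exists d' H', jet2 O (fun x => f x * P (dot (x - z) (x - z))) d' H' /\
  forall x, O x -> let s := dot (x - z) (x - z) in
    \sum_i H' i i x = P s * \sum_i H i i x
      + 4 * P1 s * \sum_i (x ord0 i - z ord0 i) * d i x
      + f x * (4 * s * P2 s + 2 * N%:R * P1 s).
Proof.
move=> fJ PP.
have PJ := jet2_comp (P := P) (P1 := P1) (P2 := P2) (@jet2_dist2 O z)
  (fun x Ox => let: And3 a _ _ := PP x Ox in a)
  (fun x Ox => let: And3 _ b _ := PP x Ox in b)
  (fun x Ox => let: And3 _ _ c := PP x Ox in c).
do 2!eexists; split; first exact: jet2_mul fJ PJ.
move=> x Ox s; rewrite -/s.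
under eq_bigr => i _.
  rewrite (_ : _ + _ = P s * H i i x + 4 * P1 s * ((x ord0 i - z ord0 i) * d i x)
    + f x * (4 * P2 s * ((x - z) ord0 i * (x - z) ord0 i) + 2 * P1 s)); last first.
    rewrite eqxx !mxE /= -/s; ring.
  over.
rewrite !big_split /= -!mulr_sumr big_split /= -mulr_sumr sumr_const card_ord.
rewrite -[X in 4 * P2 s * X]/s -[_ *+ N]mulr_natl; ring.
Qed.

(** Two mean value theorems: one for the difference [g] of [f] and its translate, one for the
    derivative [d i]. *)
Lemma sdiff_mvt O f d H y (h : R) i : jet2 O f d H -> 0 < h ->
  (forall t : R, `|t| <= h -> O (y + t *: evec R i)) ->
  exists2 t, `|t| <= h & sdiff h i f y = h ^+ 2 * H i i (y + t *: evec R i).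
Proof.
move=> fJ h0 hO.
pose g z := f z + - f (z + (- h) *: evec R i).
have shD (F : V -> R) w (a : R) : is_derive (w + (- h) *: evec R i) (evec R i) F a ->
    is_derive w (evec R i) (fun z => F (z + (- h) *: evec R i)) a.
  move=> Fd; apply: is_derive_of_line.
  rewrite (_ : (fun t => _) = fun t : R =>
    F ((w + (- h) *: evec R i) + t *: evec R i)); last first.
    by apply/funext => t; rewrite addrAC.
  by apply: is_derive_line; rewrite scale0r addr0.
have gD (th : R) : 0 <= th <= 1 -> is_derive (y + (th * h) *: evec R i) (evec R i) g
    ((fun z => d i z + - d i (z + (- h) *: evec R i)) (y + (th * h) *: evec R i)).
  move=> /andP[t0 t1].
  have thh : 0 <= th * h <= h.
    by rewrite mulr_ge0 ?(ltW h0) //= ger_pMl.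
  apply: is_derive_add.
    have O1 : O (y + (th * h) *: evec R i).
      by apply: hO; rewrite ger0_norm; move: thh; lra.
    by have [_ /(_ i)[_ ?] _] := fJ _ O1.
  have O2 : O (y + (th * h) *: evec R i + (- h) *: evec R i).
    by rewrite -addrA -scalerDl; apply: hO; rewrite ler_norml; move: thh; lra.
  have [_ /(_ i)[_ fd] _] := fJ _ O2.
  have := is_derive_mul (is_derive_cst (-1 : R) _ _) (shD _ _ _ fd).
  rewrite /cst mulr0 addr0 mulN1r.
  by rewrite (_ : (fun z => _) = fun z => - f (z + (- h) *: evec R i)) //;
    apply/funext => z; rewrite mulN1r.
have [th th01 gE] := @mvt_coord R N g
  (fun z => d i z + - d i (z + (- h) *: evec R i)) i y h gD.
pose w := y + (th * h) *: evec R i + (- h) *: evec R i.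
have wD (th' : R) : 0 <= th' <= 1 -> O (w + (th' * h) *: evec R i).
  move=> /andP[t0 t1]; rewrite /w -!addrA -!scalerDl; apply: hO.
  have /andP[? ?] : 0 <= th' * h <= h by rewrite mulr_ge0 ?(ltW h0) //= ger_pMl.
  have /andP[? ?] : 0 <= th * h <= h.
    by case/andP: th01 => ? ?; rewrite mulr_ge0 ?(ltW h0) //= ger_pMl.
  by rewrite ler_norml; apply/andP; split; lra.
have [th' th'01 dE] : exists2 th' : R, 0 <= th' <= 1 &
    d i (w + h *: evec R i) - d i w = h * H i i (w + (th' * h) *: evec R i).
  apply: mvt_coord => th' /wD O3.
  by have [_ _ /(_ i i)[_ ?]] := fJ _ O3.
have tb : `|th * h + - h + th' * h| <= h.
  case/andP: th01 => ? ?; case/andP: th'01 => ? ?.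
  have /andP[? ?] : 0 <= th' * h <= h by rewrite mulr_ge0 ?(ltW h0) //= ger_pMl.
  have /andP[? ?] : 0 <= th * h <= h by rewrite mulr_ge0 ?(ltW h0) //= ger_pMl.
  by rewrite ler_norml; apply/andP; split; lra.
exists (th * h + - h + th' * h) => //.
have wE : w + h *: evec R i = y + (th * h) *: evec R i.
  by rewrite /w -addrA -scalerDl addNr scale0r addr0.
have wE' : w + (th' * h) *: evec R i = y + (th * h + - h + th' * h) *: evec R i.
  by rewrite /w -!addrA -!scalerDl !addrA.
rewrite wE wE' in dE.
move: gE; rewrite -/w dE => gE.
have yE : y + h *: evec R i + (- h) *: evec R i = y.
  by rewrite -addrA -scalerDl addrN scale0r addr0.
rewrite expr2 -mulrA -gE /g yE /sdiff.
ring.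
Qed.

Lemma lapd_consistent O f d H x e : open O -> jet2 O f d H -> O x -> 0 < e ->
  near_step x (fun y h => `|lapd h f y - \sum_i H i i x| < e).
Proof.
move=> oO fJ Ox e0.
have [r r0 rO] := open_cube oO Ox.
have N1 : 0 < N%:R + 1 :> R by rewrite ltr_wpDl.
have eN : 0 < e / (N%:R + 1) by rewrite divr_gt0.
have [|i|a a0 aP] := @finite_radius R 'I_N (fun i a => forall y, cube x a y ->
    `|H i i y - H i i x| < e / (N%:R + 1)).
- by move=> i a a' aa aP y yx; apply: aP; apply: subset_cube yx.
- have [_ _ /(_ i i)[/continuous_cube /(_ _ eN) Hc _]] := fJ _ Ox.
  exact: Hc.
pose b := Num.min r a; have b0 : 0 < b by rewrite lt_min r0.
exists (b / 2); first by rewrite divr_gt0.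
move=> y h yx h0 hb.
have near (t : R) i : `|t| <= h -> cube x b (y + t *: evec R i).
  move=> th; rewrite (_ : b = b / 2 + b / 2); last by field.
  by apply: shift_cube yx _; apply: le_trans th (ltW hb).
have sE i : `|sdiff h i f y / h ^+ 2 - H i i x| < e / (N%:R + 1).
  have [t|t th ->] := @sdiff_mvt O f d H y h i fJ h0.
    move=> /(near _ i) yt; apply: rO; apply: subset_cube yt.
    by rewrite /b ge_min lexx.
  rewrite mulrAC divff ?mul1r ?expf_neq0 ?gt_eqF //; apply: aP.
  by apply: subset_cube (near _ i th); rewrite /b ge_min lexx orbT.
rewrite /lapd mulr_suml -sumrB.
apply: le_lt_trans (ler_norm_sum _ _ _) _.
apply: (@le_lt_trans _ _ (\sum_(i < N) e / (N%:R + 1))).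
  by apply: ler_sum => i _; exact: ltW.
rewrite sumr_const card_ord -[ltLHS]mulr_natl mulrCA gtr_pMr // ltr_pdivrMr // mul1r.
by rewrite ltrDl.
Qed.

(** Half of the strict gap at [x] absorbs the variation of [c f], the other half the consistency
    error of [lapd]. A non-strict differential inequality need not pass to the grid. *)
Lemma dsuper_strict O f d H (c : V -> R) x : open O -> jet2 O f d H -> O x ->
  {for x, continuous c} -> \sum_i H i i x < c x * f x ->
  near_step x (fun y h => lapd h f y <= c y * f y).
Proof.
move=> oO fJ Ox cc lt; have [fc _ _] := fJ _ Ox.
pose e := (c x * f x - \sum_i H i i x) / 2.
have e0 : 0 < e by rewrite divr_gt0 // subr_gt0.
have /continuous_cube /(_ e e0) [a a0 aP] := continuous_mul cc fc.
have [b b0 bP] := lapd_consistent oO fJ Ox e0.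
exists (Num.min a b); first by rewrite lt_min a0.
move=> y h yx h0; rewrite lt_min => /andP[_ hb].
have H1 : `|c y * f y - c x * f x| < e.
  by apply: aP; apply: cube_minl yx.
have H2 : `|lapd h f y - \sum_i H i i x| < e.
  by apply: bP => //; apply: subset_cube yx; rewrite ge_min lexx orbT.
by move: H1 H2; rewrite !ltr_norml /e => /andP[? ?] /andP[? ?]; lra.
Qed.

Lemma local_min_lap_ge0 O f d H x r : open O -> jet2 O f d H -> O x -> 0 < r ->
  (forall y, cube x r y -> f x <= f y) -> 0 <= \sum_i H i i x.
Proof.
move=> oO fJ Ox r0 fmin; rewrite leNgt; apply/negP => lt0.
have e0 : 0 < - \sum_i H i i x by rewrite oppr_gt0.
have [b b0 bP] := lapd_consistent oO fJ Ox e0.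
pose h := Num.min b r / 2.
have m0 : 0 < Num.min b r by rewrite lt_min b0.
have h0 : 0 < h by rewrite divr_gt0.
have hm : h < Num.min b r by rewrite /h; lra.
have := bP x h (cube_center x b0) h0 (lt_le_trans hm _).
rewrite ge_min lexx => /(_ isT).
suff : 0 <= lapd h f x by rewrite ltr_norml; lra.
apply: divr_ge0; last exact: sqr_ge0.
apply: sumr_ge0 => i _; rewrite /sdiff.
have hr : h < r by apply: lt_le_trans hm _; rewrite ge_min lexx orbT.
have H1 := fmin _ (@shift_cube0 _ _ x h r i ltac:(by rewrite gtr0_norm)).
have H2 := fmin _ (@shift_cube0 _ _ x (- h) r i ltac:(by rewrite normrN gtr0_norm)).
lra.
Qed.

End Jets.

(** * Strong maximum principle *)

Section StrongMaximum.
Variables (R : realType) (N : nat).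
Local Notation V := 'rV[R]_N.
Implicit Types (x y z : V) (O : set V) (phi c : V -> R).

Lemma norm_le_enorm x : `|x| <= enorm x.
Proof.
rewrite /Num.norm /= mx_normrE; apply/bigmax_leP; split; first exact: enorm_ge0.
by move=> [k i] _; rewrite /= (ord1 k); exact: coord_enorm.
Qed.

Lemma compact_shell z (a b : R) :
  compact [set x : V | a <= dot (x - z) (x - z) <= b].
Proof.
apply: bounded_closed_compact.
  exists (`|z| + (b + 1)); split; first exact: num_real.
  move=> r br x /andP[_ xb]; apply: le_trans (ltW br).
  rewrite -[x](subrK z) addrC; apply: le_trans (ler_normD _ _) _.
  rewrite lerD2l; apply: le_trans (norm_le_enorm _) _.
  have := enorm_ge0 (x - z); rewrite -sqr_enorm in xb.
  have := sqr_ge0 (enorm (x - z) - 1); nra.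
have -> : [set x : V | a <= dot (x - z) (x - z) <= b] =
    (fun x => dot (x - z) (x - z)) @^-1` [set r | a <= r] `&`
    (fun x => dot (x - z) (x - z)) @^-1` [set r | r <= b].
  by apply/seteqP; split => x /=; [move=> /andP[]|move=> [-> ->]].
apply: closedI; apply: preimage_closed.
- by move=> x _; exact: dist2_continuous.
- exact: closed_ge.
- by move=> x _; exact: dist2_continuous.
- exact: closed_le.
Qed.

Lemma shell_min z (a b : R) (f : V -> R) :
  (forall x, a <= dot (x - z) (x - z) <= b -> {for x, continuous f}) ->
  [set x : V | a <= dot (x - z) (x - z) <= b] !=set0 ->
  exists2 x, a <= dot (x - z) (x - z) <= b &
    forall y, a <= dot (y - z) (y - z) <= b -> f x <= f y.
Proof.
move=> fc ne.
have [|x] := EVT_min_rV ne (@compact_shell z a b) (f := f).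
  by apply: continuous_in_subspaceT => x; rewrite inE => /fc.
by rewrite inE => xA xmin; exists x => // y yA; apply: xmin; rewrite inE.
Qed.

Lemma is_derive1_lin (a t : R) : is_derive t 1 (fun t : R => a * t) a.
Proof.
rewrite (_ : (fun t : R => a * t) = a \*: id) //.
by apply: is_derive_eq; rewrite [LHS]mulr1.
Qed.

Lemma is_derive1_explin (a b k t : R) :
  is_derive t 1 (fun t : R => k * expR (a * t) + b) (k * a * expR (a * t)).
Proof.
have H := @is_derive1_comp R expR (fun t : R => a * t) t _ _
  (is_derive_expR _) (is_derive1_lin a t).
have H2 := @is_derive1_comp R (fun t : R => k * t) _ t _ _ (is_derive1_lin k _) H.
have := is_deriveD H2 (is_derive_cst b t (1 : R)).
by rewrite addr0 mulrA mulrAC.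
Qed.

(* On the annulus [e/2 <= |x - z| <= r], compare [phi] with a multiple of
   [exp (- al s) - exp (- al r^2)], [s = |x - z|^2]: for large [al] this is a
   strict subsolution, even for the positive part of [c]. *)
Lemma hopf_ball O phi d H c z (r : R) : open O -> jet2 O phi d H ->
  (forall x, O x -> \sum_i H i i x = c x * phi x) ->
  (forall x, O x -> 0 <= phi x) -> (forall x, O x -> {for x, continuous c}) ->
  0 < r -> (forall x, dot (x - z) (x - z) <= r ^+ 2 -> O x) -> 0 < phi z ->
  forall y, dot (y - z) (y - z) < r ^+ 2 -> 0 < phi y.
Proof.
move=> oO pJ eq p0 cc r0 rO pz y yr.
have Oz : O z by apply: rO; rewrite subrr /dot big1 ?sqr_ge0 // => i _; rewrite mxE mul0r.
have [zc _ _] := pJ _ Oz.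
have m0 : 0 < phi z / 2 by rewrite divr_gt0.
have /continuous_eball /(_ _ m0) [e e0 eP] := zc.
have near_z x : dot (x - z) (x - z) < e ^+ 2 -> phi z / 2 < phi x.
  rewrite -sqr_enorm ltr_pXn2r ?nnegrE ?enorm_ge0 ?(ltW e0) // => /eP.
  by rewrite ltr_norml => /andP[]; lra.
case: (ltP (dot (y - z) (y - z)) ((e / 2) ^+ 2)) => ye.
  apply: lt_trans m0 (near_z _ (lt_trans ye _)).
  by rewrite ltr_pXn2r ?nnegrE ?divr_ge0 ?(ltW e0) //; lra.
have yin : 0 <= dot (y - z) (y - z) <= r ^+ 2 by rewrite dot_ge0 ltW.
have [||x1 _ cmax] := @shell_min z 0 (r ^+ 2) (fun x => - c x).
- by move=> x /andP[_ /rO Ox]; apply: continuousN; exact: cc.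
- by exists y.
(* An upper bound for [c] is enough, whatever its sign, because it multiplies [phi >= 0]. *)
pose La := `|c x1|.
have cLa x : dot (x - z) (x - z) <= r ^+ 2 -> c x <= La.
  move=> xr; have := cmax x; rewrite dot_ge0 xr => /(_ isT).
  by have := ler_norm (c x1); rewrite -/La; lra.
have La0 : 0 <= La by exact: normr_ge0.
pose ep := (e / 2) ^+ 2; have ep0 : 0 < ep by rewrite exprn_gt0 // divr_gt0.
(* Chosen so that [4 s al - 2 N >= La + 1] whenever [s >= ep]; the Laplacian of the exponential then
   exceeds [La] times its value. *)
pose al := (2 * N%:R + La + 1) / (4 * ep) + 1.
have N0 : 0 <= N%:R :> R by exact: ler0n.
have al1 : 1 <= al by rewrite /al lerDr divr_ge0 ?mulr_ge0 ?(ltW ep0) //; lra.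
have alb : 2 * N%:R + La + 1 <= 4 * ep * al.
  rewrite /al mulrDr mulrCA divff ?mulr1; last by rewrite mulf_neq0 ?gt_eqF.
  by move: ep0; lra.
pose m := phi z / 2; pose b := - expR (- al * r ^+ 2).
pose P (s : R) := 1 * expR (- al * s) + b.
pose P1 (s : R) := - al * expR (- al * s) + 0.
pose P2 (s : R) := - al * - al * expR (- al * s).
have PP x : O x -> let s := dot (x - z) (x - z) in
    [/\ is_derive s 1 P (P1 s), is_derive s 1 P1 (P2 s) & {for s, continuous P2}].
  move=> _ s; split.
  - by have := is_derive1_explin (- al) b 1 s; rewrite mul1r /P1 addr0.
  - exact: is_derive1_explin.
  - have := is_derive1_explin (- al) 0 (- al * - al) s.
    rewrite (_ : (fun t => _) = P2); first exact: is_derive1_continuous.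
    by apply/funext => t; rewrite addr0.
have [d' [H' [vJ vL]]] := jet2_radial (@jet2_cst R N O m) PP.
pose w x := phi x + - 1 * (m * P (dot (x - z) (x - z))).
have wJ := jet2_add pJ (jet2_mul (@jet2_cst R N O (- 1)) vJ).
have [||x0 x0in wmin] := @shell_min z ep (r ^+ 2) w.
- by move=> x /andP[_ /rO Ox]; have [] := wJ _ Ox.
- by exists y; rewrite /= ye ltW.
have Ppos s : s <= r ^+ 2 -> 0 <= P s.
  by move=> sr; rewrite /P /b mul1r subr_ge0 ler_expR ler_nM2l // oppr_lt0; lra.
have Pr : P (r ^+ 2) = 0 by rewrite /P /b mul1r subrr.
have [Ox0 s0] : O x0 /\ ep <= dot (x0 - z) (x0 - z) by case/andP: x0in => ? /rO.
have w0 : 0 <= w x0.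
  (* A negative minimum of [w] avoids both spheres: on the inner one [phi > m >= m P], on the outer
     one [P = 0]. At an interior minimum the Laplacian of [w] would be nonnegative, while the choice
     of [al] makes it negative. *)
  rewrite leNgt; apply/negP => wneg.
  have sne : ep < dot (x0 - z) (x0 - z).
    rewrite lt_neqAle s0 andbT; apply/eqP => s0E.
    have : dot (x0 - z) (x0 - z) < e ^+ 2.
      by rewrite -s0E /ep ltr_pXn2r ?nnegrE ?divr_ge0 ?(ltW e0) //; lra.
    move=> /near_z; rewrite -/m => mp.
    have : m * P (dot (x0 - z) (x0 - z)) <= m * 1.
      rewrite ler_pM2l // /P mul1r.
      have : expR (- al * dot (x0 - z) (x0 - z)) <= 1.
        rewrite -expR0 ler_expR mulNr oppr_le0 mulr_ge0 ?dot_ge0 //; lra.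
      by have := expR_gt0 (- al * r ^+ 2); rewrite /b; lra.
    by move: wneg; rewrite /w; lra.
  have sr : dot (x0 - z) (x0 - z) < r ^+ 2.
    rewrite lt_neqAle; case/andP: x0in => _ ->; rewrite andbT; apply/eqP => sE.
    by move: wneg; rewrite /w sE Pr; have := p0 _ Ox0; lra.
  pose g := Num.min (dot (x0 - z) (x0 - z) - ep) (r ^+ 2 - dot (x0 - z) (x0 - z)).
  have g0 : 0 < g by rewrite lt_min !subr_gt0 sne.
  have /continuous_cube /(_ g g0) [q q0 qP] := @dist2_continuous R N z x0.
  have := local_min_lap_ge0 oO wJ Ox0 q0.
  have wloc x : cube x0 q x -> w x0 <= w x.
    move=> /qP; rewrite /g ltr_norml lt_min => /andP[g1 /andP[g2 g3]].
    apply: wmin; apply/andP; split; last by move: g3; lra.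
    have : g <= dot (x0 - z) (x0 - z) - ep by rewrite ge_min lexx.
    by move: g1; rewrite -/g; lra.
  move=> /(_ wloc); rewrite (eq_bigr (fun i => H i i x0 - H' i i x0)); last first.
    by move=> i _; ring.
  rewrite sumrB eq // vL //; set s := dot (x0 - z) (x0 - z).
  rewrite big1 // [X in 4 * _ * X]big1 => [|i _]; last by rewrite mulr0.
  rewrite !mulr0 !add0r; apply/negP; rewrite -ltNge.
  have E0 := expR_gt0 (- al * s); set E := expR (- al * s) in E0.
  have m0' : 0 < m by [].
  have -> : 4 * s * P2 s + 2 * N%:R * P1 s = E * (al * (4 * s * al - 2 * N%:R)).
    by rewrite /P2 /P1 -/E; ring.
  have K1 : La + 1 <= al * (4 * s * al - 2 * N%:R).
    have K0 : 4 * ep * al <= 4 * s * al.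
      by rewrite ler_wpM2r ?ler_wpM2l // ?ltW //; lra.
    have K2 : La + 1 <= 4 * s * al - 2 * N%:R by lra.
    by apply: le_trans K2 _; rewrite ler_peMl //; lra.
  have K3 : m * (E * (La + 1)) <= m * (E * (al * (4 * s * al - 2 * N%:R))).
    by rewrite !ler_wpM2l // ltW.
  have K4 : c x0 * phi x0 <= La * phi x0.
    by rewrite ler_wpM2r ?p0 // cLa // ltW.
  have PE : P s <= E.
    by rewrite /P /b -/E; have := expR_gt0 (- al * r ^+ 2); lra.
  have K5 : La * phi x0 <= La * (m * E).
    rewrite ler_wpM2l //.
    have : m * P s <= m * E by rewrite ler_pM2l.
    by move: wneg; rewrite /w -/s; lra.
  have : 0 < m * E by rewrite mulr_gt0.
  by lra.
have Py : 0 < P (dot (y - z) (y - z)).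
  by rewrite /P /b mul1r subr_gt0 ltr_expR ltr_nM2l // oppr_lt0; lra.
have := wmin y; rewrite ye (ltW yr) => /(_ isT).
have : 0 < m * P (dot (y - z) (y - z)) by rewrite mulr_gt0.
by move: w0; rewrite /w; lra.
Qed.

(** Connectedness: the positivity set is open by continuity. It is relatively closed because a limit
    point [x] has a positive point [z] within [r / 3], and the ball of radius [r / 2] around [z]
    lies in [O] and contains [x]. *)
Lemma strong_positivity O phi d H c : open O -> connected O -> jet2 O phi d H ->
  (forall x, O x -> \sum_i H i i x = c x * phi x) ->
  (forall x, O x -> 0 <= phi x) -> (forall x, O x -> {for x, continuous c}) ->
  (exists2 x, O x & 0 < phi x) -> forall x, O x -> 0 < phi x.
Proof.
move=> oO cO pJ eq p0 cc [x0 Ox0 px0].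
pose B := [set x | O x /\ 0 < phi x].
have Bnbhs x : B x -> nbhs x B.
  move=> [Ox px]; have [pc _ _] := pJ _ Ox.
  have /continuous_cube /(_ _ px) [a a0 aP] := pc.
  have [b b0 bO] := open_cube oO Ox.
  apply/nbhs_cube; exists (Num.min a b); first by rewrite lt_min a0.
  move=> y yx; split.
    by apply: bO; apply: cube_minr yx.
  have : `|phi y - phi x| < phi x.
    by apply: aP; apply: cube_minl yx.
  by rewrite ltr_norml => /andP[]; lra.
suff BO : B = O by move=> x; rewrite -BO => -[].
apply: cO; first by exists x0.
  exists B; first by rewrite openE => x /Bnbhs.
  by apply/seteqP; split => x; [move=> Bx; split=> //; case: Bx|case].
exists (closure B); first exact: closed_closure.
apply/seteqP; split => x; first by move=> Bx; split; [case: Bx|exact: subset_closure].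
move=> [Ox Bx]; split => //.
have /nbhs_eball[r r0 rO] := open_nbhs_nbhs (conj oO Ox).
have r3 : 0 < r / 3 by rewrite divr_gt0.
have [z [[Oz pz] zx]] := Bx _ (eball_nbhs x r3).
apply: (hopf_ball oO pJ eq p0 cc (z := z) (r := r / 2)) => //.
- by rewrite divr_gt0.
- move=> y; rewrite -sqr_enorm ler_pXn2r ?nnegrE ?enorm_ge0 ?divr_ge0 ?(ltW r0) // => yz.
  apply: rO; rewrite /eball /=.
  have -> : y - x = (y - z) + (z - x) by rewrite addrA subrK.
  by apply: le_lt_trans (enorm_triangle _ _) _; move: zx; rewrite /eball /=; lra.
- rewrite -sqr_enorm enorm_sym ltr_pXn2r ?nnegrE ?enorm_ge0 ?divr_ge0 ?(ltW r0) //.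
  by move: zx; rewrite /eball /=; lra.
Qed.

End StrongMaximum.

(** * Radial profiles *)

Section Profiles.
Variables (R : realType) (tau0 : R).
Implicit Types (s p q : R).

(* [s] stands for [|x|^2]. *)
Definition tau s : R := tau0 - ln s.
Definition prof p q s : R := s `^ p * tau s `^ q.

Lemma powRD_gt0 s p q : 0 < s -> s `^ (p + q) = s `^ p * s `^ q.
Proof. by move=> s0; rewrite powRD // (lt0r_neq0 s0) implybT. Qed.

Lemma is_derive_tau s : 0 < s -> is_derive s 1 tau (- s^-1).
Proof.
move=> s0; have := is_deriveB (is_derive_cst tau0 s (1 : R)) (is_derive1_ln s0).
by rewrite sub0r.
Qed.

Lemma is_derive_prof p q s : 0 < s -> 0 < tau s ->
  is_derive s 1 (prof p q) (p * prof (p - 1) q s - q * prof (p - 1) (q - 1) s).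
Proof.
move=> s0 t0.
have D1 := is_derive1_powR p s0.
have D2 := @is_derive1_comp R (fun x : R => x `^ q) tau s _ _ (is_derive1_powR q t0) (is_derive_tau s0).
have D3 := is_deriveM D1 D2; refine (is_derive_eq D3 _).
rewrite /prof; have -> : s `^ p = s * s `^ (p - 1).
  by rewrite -{2}(powRr1 (ltW s0)) -powRD_gt0 ?subrKC.
rewrite /= /GRing.scale /=; field; exact: lt0r_neq0.
Qed.

Lemma prof_gt0 p q s : 0 < s -> 0 < tau s -> 0 < prof p q s.
Proof. by move=> s0 t0; rewrite mulr_gt0 ?powR_gt0. Qed.

Lemma prof_mul s p q : 0 < s -> s * prof (p - 1) q s = prof p q s.
Proof.
move=> s0; rewrite /prof mulrA; congr (_ * _).
by rewrite -{1}(powRr1 (ltW s0)) -powRD_gt0 ?subrKC.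
Qed.

Lemma prof_tau s p q : 0 < tau s -> tau s * prof p (q - 1) s = prof p q s.
Proof.
move=> t0; rewrite /prof mulrCA; congr (_ * _).
by rewrite -{1}(powRr1 (ltW t0)) -powRD_gt0 ?subrKC.
Qed.

Lemma prof_le s p q q' : 0 < s -> 1 <= tau s -> q <= q' -> prof p q s <= prof p q' s.
Proof.
by move=> s0 t1 qq; rewrite ler_wpM2l ?powR_ge0 // ler_powR.
Qed.

Definition dprof p q s := p * prof (p - 1) q s - q * prof (p - 1) (q - 1) s.
Definition ddprof p q s := p * dprof (p - 1) q s - q * dprof (p - 1) (q - 1) s.

Lemma prof_jet p q s : 0 < s -> 0 < tau s ->
  [/\ is_derive s 1 (prof p q) (dprof p q s),
      is_derive s 1 (dprof p q) (ddprof p q s) & {for s, continuous (ddprof p q)}].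
Proof.
move=> s0 t0.
have lin (f g : R -> R) (df dg a b : R) : is_derive s 1 f df -> is_derive s 1 g dg ->
    is_derive s 1 (fun t => a * f t - b * g t) (a * df - b * dg).
  by move=> Df Dg; apply: is_deriveB; apply: is_deriveZ.
have D p' q' : is_derive s 1 (dprof p' q') (ddprof p' q' s).
  by apply: lin; apply: is_derive_prof.
split => //; first exact: is_derive_prof.
have /derivable1_diffP : derivable (ddprof p q) s 1.
  by have := lin _ _ _ _ p q (D (p - 1) q) (D (p - 1) (q - 1)); case.
exact: differentiable_continuous.
Qed.

Lemma dprof_bound s p q : 0 < s -> 1 <= tau s -> `|q| <= 1 ->
  s * `|dprof p q s| <= (`|p| + 1) * prof p q s.
Proof.
move=> s0 t1 q1; have t0 : 0 < tau s by lra.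
rewrite -{1}(gtr0_norm s0) -normrM /dprof mulrBr mulrCA [X in _ - X]mulrCA.
rewrite !prof_mul //; apply: le_trans (ler_normB _ _) _; rewrite (normrM p) (normrM q).
have pn p' q' : `|prof p' q' s| = prof p' q' s by rewrite gtr0_norm ?prof_gt0.
rewrite !pn mulrDl lerD2l.
by rewrite ler_pM ?(ltW (prof_gt0 _ _ s0 t0)) // prof_le //; lra.
Qed.

(* The left-hand side is [mu / |x|^2 - lap] on [f * prof b a], divided by [f],
   when [f] is harmonic and homogeneous of degree 1: the cross term
   [4 P' (x . grad f)] turns [2 N] into [2 N + 4]. *)
Lemma prof_radial (N : nat) (mu b sigma a s : R) :
  mu = 4 * b ^+ 2 + 2 * N%:R * b -> 4 * b + N%:R = - 2 * sigma ->
  0 < s -> 0 < tau s ->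
  mu / s * prof b a s - 4 * s * ddprof b a s - (2 * N%:R + 4) * dprof b a s =
  - 4 * a * (sigma * tau s + a - 1) * prof (b - 1) (a - 2) s.
Proof.
move=> muE sE s0 t0.
have e1 : prof b a s = s * prof (b - 1) a s by rewrite prof_mul.
have e2 q : prof (b - 1) q s = s * prof (b - 1 - 1) q s by rewrite prof_mul.
have e3 : prof (b - 1 - 1) (a - 1) s = tau s * prof (b - 1 - 1) (a - 2) s.
  by rewrite (_ : a - 2 = a - 1 - 1) ?prof_tau //; ring.
have e4 : prof (b - 1 - 1) a s = tau s * prof (b - 1 - 1) (a - 1) s by rewrite prof_tau.
have e5 : a - 1 - 1 = a - 2 by ring.
rewrite /ddprof /dprof e1 !e2 e5 e4 e3 muE.
have -> : sigma = - (4 * b + N%:R) / 2 by rewrite sE; field.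
by field; exact: lt0r_neq0.
Qed.

(** [tau] is at most a constant times [s^(- 1/24)], so its cube uses up only [s^(- 1/8)] of the
    factor [s^(1/4)]. The cube is what later covers the exponent [a1 - 2 >= - 3]. *)
Lemma tau_small e : 0 < e -> exists2 d, 0 < d <= 1 &
  forall s, 0 < s -> s < d -> 0 <= tau s -> s `^ (4^-1) * tau s ^+ 3 <= e.
Proof.
move=> e0; pose K := (`|tau0| + 24) ^+ 3.
have K0 : 0 < K by rewrite exprn_gt0 // ltr_wpDl.
have eK : 0 < e / K by rewrite divr_gt0.
exists (Num.min 1 ((e / K) `^ 8)).
  by rewrite lt_min ltr01 powR_gt0 // ge_min lexx.
move=> s s0; rewrite lt_min => /andP[s1 se] ts0.
pose y := s `^ (- 24^-1).
have y1 : 1 <= y.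
  rewrite /y powRN invf_ge1 ?powR_gt0 //.
  have one : (1 : R) `^ (24^-1) = 1 by rewrite powR1.
  rewrite -[leRHS]one.
  by rewrite ge0_ler_powR ?nnegrE ?invr_ge0 // ltW.
have y0 : 0 < y by lra.
have lny : - ln s = 24 * ln y.
  by rewrite /y ln_powR; field.
have tb : tau s <= (`|tau0| + 24) * y.
  have ly : ln y <= y by have := le_ln1Dx (x := y - 1); rewrite addrCA subrr addr0; lra.
  have := ler_norm tau0; have : `|tau0| * 1 <= `|tau0| * y by rewrite ler_wpM2l.
  by rewrite /tau lny; lra.
have t3 : tau s ^+ 3 <= K * y ^+ 3.
  rewrite /K -exprMn lerXn2r ?nnegrE // mulr_ge0 ?(ltW y0) // addr_ge0 //.
have y3 : s `^ (4^-1) * y ^+ 3 = s `^ (8^-1).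
  rewrite /y -powR_mulrn ?powR_ge0 // -powRrM -powRD_gt0 //.
  by congr (_ `^ _); field.
apply: (@le_trans _ _ (s `^ (4^-1) * (K * y ^+ 3))).
  by rewrite ler_wpM2l ?powR_ge0.
rewrite mulrCA y3 mulrC -ler_pdivlMr //.
have -> : e / K = ((e / K) `^ 8) `^ (8^-1).
  by rewrite -powRrM mulfV ?powRr1 // ltW.
by rewrite ge0_ler_powR ?nnegrE ?ltW ?powR_gt0 // invr_ge0.
Qed.

End Profiles.

(** * Gluing supersolutions *)

Section Gluing.
Variables (R : realType) (N : nat).
Local Notation V := 'rV[R]_N.
Implicit Types (x y z : V) (O : set V) (c f g S : V -> R).

Definition locally_super c f x := near_step x (fun y h => lapd h f y <= c y * f y).

Lemma lapd_eq h f g y : (forall i t, t = h \/ t = - h ->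
    f (y + t *: evec R i) = g (y + t *: evec R i)) -> f y = g y ->
  lapd h f y = lapd h g y.
Proof.
move=> fg fgy; rewrite /lapd /sdiff; congr (_ / _); apply: eq_bigr => i _.
by rewrite fgy !fg //; [left|right].
Qed.

Lemma locally_super_eq c f g x : (\forall y \near x, f y = g y) ->
  locally_super c f x -> locally_super c g x.
Proof.
move=> /nbhs_cube[a a0 aP] [b b0 bP].
have a2 : 0 < a / 2 by rewrite divr_gt0.
have aa : a = a / 2 + a / 2 by field.
exists (Num.min (a / 2) b); first by rewrite lt_min a2.
move=> y h yx h0; rewrite lt_min => /andP[ha hb].
have ya : cube x (a / 2) y by exact: cube_minl yx.
have fgy : f y = g y by apply: aP; apply: subset_cube ya; lra.
rewrite -(@lapd_eq h f g y) -?fgy //.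
  by apply: bP => //; apply: subset_cube yx; rewrite ge_min lexx orbT.
move=> i t th; apply: aP; rewrite aa; apply: shift_cube ya _.
by case: th => ->; rewrite ?normrN gtr0_norm // ltW.
Qed.

Lemma locally_super_min c f g x : locally_super c f x -> locally_super c g x ->
  locally_super c (fun y => Num.min (f y) (g y)) x.
Proof.
have le h u v y : 0 < h -> (forall z, u z <= v z) -> u y = v y ->
    lapd h u y <= lapd h v y.
  move=> h0 uv uvy; rewrite /lapd ler_pM2r ?invr_gt0 ?exprn_gt0 //.
  by apply: ler_sum => i _; rewrite /sdiff uvy lerD2r lerD.
move=> fs gs; apply: near_step_imp (near_step_and fs gs) _ => y h h0 [fy gy].
have [fg|gf] := leP (f y) (g y).
  apply: le_trans fy; apply: le => // [z|]; first by rewrite ge_min lexx.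
  by rewrite min_l.
apply: le_trans gy; apply: le => // [z|]; first by rewrite ge_min lexx orbT.
by rewrite min_r // ltW.
Qed.

Lemma locally_superN c f x : locally_super c (fun y => - f y) x <->
  near_step x (fun y h => c y * f y <= lapd h f y).
Proof.
have E h y : lapd h (fun y => - f y) y = - lapd h f y.
  rewrite /lapd -mulNr -sumrN; congr (_ / _); apply: eq_bigr => i _.
  by rewrite /sdiff; ring.
split=> H; apply: near_step_imp H _ => y h _.
  by rewrite E mulrN lerN2.
by rewrite E mulrN lerN2.
Qed.

Lemma continuous_near_eq f g x : (\forall y \near x, f y = g y) ->
  {for x, continuous f} -> {for x, continuous g}.
Proof.
move=> /nbhs_cube[a a0 aP] /continuous_cube fc; apply/continuous_cube => e /fc[b b0 bP].
exists (Num.min a b); first by rewrite lt_min a0.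
move=> y yx; rewrite -!aP; first by apply: bP; apply: cube_minr yx.
  exact: cube_center.
exact: cube_minl yx.
Qed.

Lemma continuous_min f g x : {for x, continuous f} -> {for x, continuous g} ->
  {for x, continuous (fun y => Num.min (f y) (g y))}.
Proof.
move=> /continuous_cube fc /continuous_cube gc; apply/continuous_cube => e e0.
have [a a0 aP] := fc _ e0; have [b b0 bP] := gc _ e0.
exists (Num.min a b); first by rewrite lt_min a0.
move=> y yx.
have := aP y (subset_cube _ yx); rewrite ge_min lexx => /(_ isT).
have := bP y (subset_cube _ yx); rewrite ge_min lexx orbT => /(_ isT).
rewrite !ltr_norml => /andP[? ?] /andP[? ?].
by case: (leP (f y) (g y)) => ?; case: (leP (f x) (g x)) => ?; apply/andP; split; lra.
Qed.

Definition glue z (r : R) f g : V -> R :=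
  fun x => if enorm (x - z) < r then Num.min (f x) (g x) else g x.

Lemma dist_near z x (a b : R) : a < enorm (x - z) < b ->
  \forall y \near x, a < enorm (y - z) < b.
Proof.
move=> /andP[xa xb].
pose e := Num.min (enorm (x - z) - a) (b - enorm (x - z)).
have e0 : 0 < e by rewrite lt_min !subr_gt0 xa.
apply/nbhs_eball; exists e => // y; rewrite /eball /= /e lt_min => /andP[y1 y2].
have := enorm_triangle (y - x) (x - z); rewrite addrA subrK.
have := enorm_triangle (x - y) (y - z); rewrite addrA subrK enorm_sym.
by move: y1 y2; move=> *; apply/andP; split; lra.
Qed.

(** In the shell the minimum is already [g], so near each point [glue] is either the minimum or [g]
    alone, and no inequality has to be checked across the sphere of radius [r]. *)
Lemma glue_near O z (r' r : R) f g x : open O -> r' < r ->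
  (forall x, O x -> r' < enorm (x - z) < r -> g x <= f x) -> O x ->
  (enorm (x - z) < r /\ \forall y \near x, Num.min (f y) (g y) = glue z r f g y) \/
  (\forall y \near x, g y = glue z r f g y).
Proof.
move=> oO rr gf Ox; case: (ltP (enorm (x - z)) r) => xr; [left|right].
  split=> //; have : -1 < enorm (x - z) < r by rewrite xr andbT; have := enorm_ge0 (x - z); lra.
  move=> /dist_near; apply: filterS => y /andP[_ yr].
  by rewrite /glue yr.
have xr' : r' < enorm (x - z) < enorm (x - z) + 1 by apply/andP; split; lra.
have ON := open_nbhs_nbhs (conj oO Ox).
apply: filterS (filterI (dist_near xr') ON) => y [/andP[ya _] Oy].
rewrite /glue; case: ifP => // yr; rewrite min_r //.
by apply: gf => //; rewrite ya.
Qed.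

Lemma glue_super O c z (r' r : R) f g : open O -> r' < r ->
  (forall x, O x -> enorm (x - z) < r -> locally_super c f x) ->
  dsuper O c g ->
  (forall x, O x -> r' < enorm (x - z) < r -> g x <= f x) ->
  dsuper O c (glue z r f g).
Proof.
move=> oO rr fs gs gf x Ox.
have [[xr E]|E] := glue_near oO rr gf Ox; apply: locally_super_eq E _.
  by apply: locally_super_min; [exact: fs|exact: gs].
exact: gs.
Qed.

Lemma glue_continuous O z (r' r : R) f g : open O -> r' < r ->
  (forall x, O x -> enorm (x - z) < r -> {for x, continuous f}) ->
  (forall x, O x -> {for x, continuous g}) ->
  (forall x, O x -> r' < enorm (x - z) < r -> g x <= f x) ->
  forall x, O x -> {for x, continuous (glue z r f g)}.
Proof.
move=> oO rr fs gs gf x Ox.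
have [[xr E]|E] := glue_near oO rr gf Ox; apply: continuous_near_eq E _.
  by apply: continuous_min; [exact: fs|exact: gs].
exact: gs.
Qed.

End Gluing.

(** * Defining functions and distance to the boundary *)

Section Boundary.
Variables (R : realType) (N : nat).
Local Notation V := 'rV[R]_N.
Implicit Types (x y z : V) (O : set V).

Lemma cube_is_open z (r : R) : open (cube z r).
Proof.
rewrite openE => x /cube_open[e e0 eP].
by apply/nbhs_cube; exists e.
Qed.

Lemma bdry_notin O x : open O -> bdry O x -> ~ O x.
Proof. by move=> oO [_ nI] Ox; apply: nI; exact: open_nbhs_nbhs. Qed.

(** The first exit point of the segment from [O]: it is outside [O] because [O] is open, and in the
    closure because all earlier points are inside. *)
Lemma segment_bdry O x y : open O -> O x -> ~ O y ->
  exists2 q, bdry O q & enorm (x - q) <= enorm (x - y).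
Proof.
move=> oO Ox nOy.
pose L (t : R) : V := x + t *: (y - x).
pose E := [set t : R | 0 <= t <= 1 /\ ~ O (L t)].
have E1 : E 1 by split; [rewrite ler01 lexx|rewrite /L scale1r addrC subrK].
have hE : has_inf E by split; [exists 1|exists 0 => t [/andP[]]].
pose t0 := inf E.
have t00 : 0 <= t0 by apply: lb_le_inf; [exists 1|move=> t [/andP[]]].
have t01 : t0 <= 1 by apply: ge_inf => //; exact: hE.2.
pose D := enorm (y - x) + 1.
have D0 : 0 < D by rewrite ltr_wpDl // enorm_ge0.
have dist t t' : enorm (L t - L t') = `|t - t'| * enorm (y - x).
  rewrite -enormZ /L; congr enorm; rewrite scalerBl opprD addrACA subrr add0r //.
have Lnear t e : 0 < e -> `|t - t0| < e / D -> enorm (L t - L t0) < e.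
  move=> e0 te; rewrite dist; apply: (@le_lt_trans _ _ (`|t - t0| * D)).
    by rewrite ler_wpM2l // /D lerDl.
  by rewrite -ltr_pdivlMr.
have nO0 : ~ O (L t0).
  move=> O0; have /nbhs_eball[e e0 eO] := open_nbhs_nbhs (conj oO O0).
  have eD : 0 < e / D by rewrite divr_gt0.
  have [t [tt nOt] tlt] := inf_adherent eD hE.
  apply: (nOt); apply: eO; apply: Lnear => //.
  have : t0 <= t by apply: ge_inf; [exact: hE.2|split].
  by rewrite -/t0 in tlt => ?; rewrite ger0_norm ?subr_ge0 //; lra.
have tpos : 0 < t0.
  rewrite lt_neqAle t00 andbT; apply/eqP => t0E; apply: nO0.
  by rewrite -t0E /L scale0r addr0.
exists (L t0).
  split; last by move=> /interior_subset /nO0.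
  move=> B /nbhs_eball[e e0 eB].
  have eD : 0 < e / D by rewrite divr_gt0.
  pose t := Num.max 0 (t0 - e / D / 2).
  have tt : t < t0 by rewrite /t gt_max tpos /=; lra.
  exists (L t); split.
    apply: contrapT => nOt.
    have Et : E t.
      by split => //; rewrite /t le_max lexx /= ge_max ler01 /=; lra.
    have : t0 <= t by apply: ge_inf => //; exact: hE.2.
    by rewrite leNgt tt.
  apply: eB; apply: Lnear => //; rewrite distrC gtr0_norm ?subr_gt0 //.
  have : t0 - e / D / 2 <= t by rewrite /t le_max lexx orbT.
  by lra.
rewrite -{1}(_ : L 0 = x); last by rewrite /L scale0r addr0.
rewrite dist sub0r normrN ger0_norm // enorm_sym.
by rewrite ler_piMl // enorm_ge0.
Qed.

Lemma rho_le O x y : open O -> O x -> ~ O y -> rho O x <= enorm (x - y).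
Proof.
move=> oO Ox nOy; have [q qO qx] := segment_bdry oO Ox nOy.
apply: le_trans qx; apply: ge_inf; last by exists q.
by exists 0 => _ [z _ ->]; exact: enorm_ge0.
Qed.

Lemma rho_ge O x (m : R) : bdry O !=set0 ->
  (forall y, bdry O y -> m <= enorm (x - y)) -> m <= rho O x.
Proof.
move=> [y0 y0O] H; apply: lb_le_inf; first by exists (enorm (x - y0)), y0.
by move=> _ [y yO ->]; exact: H.
Qed.

Lemma increment (f : V -> R) (d : 'I_N -> V -> R) z (r : R) x y :
  (forall w i, cube z r w -> is_derive w (evec R i) f (d i w)) ->
  cube z r x -> cube z r y ->
  exists w : 'I_N -> V,
    f y - f x = \sum_i (y ord0 i - x ord0 i) * d i (w i) /\
    forall i, cube z r (w i) /\ forall j, exists2 th : R, 0 <= th <= 1 &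
      w i ord0 j = x ord0 j + th * (y ord0 j - x ord0 j).
Proof.
move=> fd xr yr.
have H (i : 'I_N) : exists w : V, f (stair x y i + (y ord0 i - x ord0 i) *: evec R i)
      - f (stair x y i) = (y ord0 i - x ord0 i) * d i w /\
    (cube z r w /\ forall j, exists2 th : R, 0 <= th <= 1 &
      w ord0 j = x ord0 j + th * (y ord0 j - x ord0 j)).
  have wth (th : R) : 0 <= th <= 1 ->
      let w := stair x y i + (th * (y ord0 i - x ord0 i)) *: evec R i in
      forall j, exists2 th : R, 0 <= th <= 1 & w ord0 j = x ord0 j + th * (y ord0 j - x ord0 j).
    move=> th01 w j; rewrite /w shiftE mxE; case: (eqVneq j i) => [->|ji].
      by exists th => //; rewrite ltnn mulr1.
    rewrite mulr0 addr0; case: ifP => _.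
      by exists 1; [rewrite ler01 lexx|rewrite mul1r subrKC].
    by exists 0; [rewrite ler01 lexx|rewrite mul0r addr0].
  have conv (w : V) : (forall j, exists2 th : R, 0 <= th <= 1 &
      w ord0 j = x ord0 j + th * (y ord0 j - x ord0 j)) -> cube z r w.
    move=> wj j; have [th /andP[t0 t1] ->] := wj j.
    have := xr j; have := yr j; rewrite !ltr_norml => /andP[y1 y2] /andP[x1 x2].
    set a := x ord0 j - z ord0 j in x1 x2; set b := y ord0 j - z ord0 j in y1 y2.
    have -> : x ord0 j + th * (y ord0 j - x ord0 j) - z ord0 j =
      (1 - th) * a + th * b by rewrite /a /b; ring.
    case: (eqVneq th 0) => [->|th0]; first by rewrite subr0 mul1r mul0r addr0 x1.
    have tp : 0 < th by rewrite lt_neqAle eq_sym th0.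
    have : th * b < th * r by rewrite ltr_pM2l.
    have : th * - r < th * b by rewrite ltr_pM2l.
    have : (1 - th) * a <= (1 - th) * r by rewrite ler_wpM2l ?subr_ge0 // ltW.
    have : (1 - th) * - r <= (1 - th) * a by rewrite ler_wpM2l ?subr_ge0 // ltW.
    by move=> *; apply/andP; split; lra.
  have [th th01 E] := @mvt_coord R N f (d i) i (stair x y i) (y ord0 i - x ord0 i)
    (fun th th01 => fd _ i (conv _ (wth th th01))).
  by eexists; split; [exact: E|split; [apply: conv|]; exact: wth].
have [w wP] := choice H.
exists w; split; first by rewrite (stair_telescope f x y); apply: eq_bigr => i _; case: (wP i).
by move=> i; case: (wP i).
Qed.

Definition l1 x : R := \sum_i `|x ord0 i|.

Lemma l1_enorm x : l1 x <= N%:R * enorm x.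
Proof.
apply: le_trans (ler_sum _ (fun i _ => coord_enorm x i)) _.
by rewrite sumr_const card_ord -[leLHS]mulr_natl lexx.
Qed.

(** Both points move. This strict form is required because the distance to the boundary compares [x]
    with points near it, not with the centre [z]. *)
Lemma strict_differentiable (f : V -> R) (d : 'I_N -> V -> R) z (r e : R) : 0 < r ->
  (forall w i, cube z r w -> is_derive w (evec R i) f (d i w)) ->
  (forall i, {for z, continuous (d i)}) -> 0 < e ->
  exists2 a, 0 < a <= r & forall x y, cube z a x -> cube z a y ->
    `|f y - f x - \sum_i (y ord0 i - x ord0 i) * d i z| <= e * enorm (y - x).
Proof.
move=> r0 fd dc e0.
have N1 : 0 < N%:R + 1 :> R by rewrite ltr_wpDl.
have eN : 0 < e / (N%:R + 1) by rewrite divr_gt0.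
have [|i|a a0 aP] := @finite_radius R 'I_N (fun i a => forall y, cube z a y ->
    `|d i y - d i z| < e / (N%:R + 1)).
- by move=> i a a' aa aP y yx; apply: aP; apply: subset_cube yx.
- by have /continuous_cube /(_ _ eN) := dc i.
exists (Num.min a r); first by rewrite lt_min a0 r0 ge_min lexx orbT.
move=> x y xa ya.
have fd' w i : cube z (Num.min a r) w -> is_derive w (evec R i) f (d i w).
  by move=> wa; apply: fd; apply: subset_cube wa; rewrite ge_min lexx orbT.
have [w [-> wP]] := increment fd' xa ya.
rewrite -sumrB; apply: le_trans (ler_norm_sum _ _ _) _.
apply: (@le_trans _ _ (\sum_i `|(y - x) ord0 i| * (e / (N%:R + 1)))).
  apply: ler_sum => i _; rewrite -mulrBr normrM !mxE ler_wpM2l //; apply: ltW.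
  apply: aP; have [wc _] := wP i; apply: subset_cube wc; rewrite ge_min lexx //.
rewrite -mulr_suml -/(l1 (y - x)).
apply: (@le_trans _ _ ((N%:R * enorm (y - x)) * (e / (N%:R + 1)))).
  by rewrite ler_wpM2r ?l1_enorm // ltW.
have -> : N%:R * enorm (y - x) * (e / (N%:R + 1)) =
    (N%:R / (N%:R + 1)) * (e * enorm (y - x)) by ring.
rewrite ler_piMl ?mulr_ge0 ?enorm_ge0 ?(ltW e0) //.
by rewrite ler_pdivrMr // mul1r lerDl.
Qed.

Lemma defining_function O (nrm : V -> V) p : open O ->
  C2_boundary_with_normal O nrm -> bdry O p ->
  exists r G d H, [/\ 0 < r, jet2 (cube p r) G d H,
    forall x, cube p r x -> (O x <-> 0 < G x), G p = 0 &
    \sum_i d i p ^+ 2 = 1].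
Proof.
move=> oO C2 pO; have [r [g [r0 gC2 gn gO _]]] := C2 _ pO.
have /nbhs_cube[a a0 aP] := eball_nbhs p r0.
have pp : eball p r p by rewrite /eball /= subrr enorm0.
pose k := enorm (grad g p).
have k0 : 0 < k by apply: enorm_gt0; exact: gn.
(* The sign makes [G] positive inside; the scaling makes the gradient a unit vector at [p], and
   nearby only approximately so. *)
pose G x := - k^-1 * g x.
have gJ := jet2_sub aP (jet2_pderiv gC2).
have GJ := jet2_mul (@jet2_cst R N (cube p a) (- k^-1)) gJ.
have kN : - k^-1 < 0 by rewrite oppr_lt0 invr_gt0.
exists a, G; do 2!eexists; split.
- exact: a0.
- exact: GJ.
- by move=> x /aP xr; rewrite gO // /G nmulr_rgt0.
- rewrite /G (_ : g p = 0) ?mulr0 //; apply/eqP; rewrite eq_le; apply/andP; split.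
    rewrite leNgt; apply/negP => gp.
    have [gc _ _] := gC2 _ pp; have /continuous_cube /(_ _ gp) [b b0 bP] := gc.
    have m0 : 0 < Num.min a b by rewrite lt_min a0.
    have [y [Oy yp]] := pO.1 _ (cube_nbhs p m0).
    have yr : eball p r y by apply: aP; apply: cube_minl yp.
    have gy : g y < 0 by rewrite -gO.
    have : `|g y - g p| < g p.
      by apply: bP; apply: cube_minr yp.
    by rewrite ltr_norml => /andP[]; lra.
  by rewrite leNgt; apply/negP => /(gO _ pp); exact: bdry_notin.
- rewrite (eq_bigr (fun i => k^-1 ^+ 2 * (grad g p ord0 i * grad g p ord0 i))).
    rewrite -mulr_sumr -[X in _ * X]/(dot (grad g p) (grad g p)) -sqr_enorm -/k.
    by rewrite -exprMn mulVf ?expr1n // gt_eqF.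
  by move=> i _; rewrite /= mxE mulr0 addr0; ring.
Qed.

End Boundary.

(** * The defining function near the origin *)

Section OriginChart.
Variables (R : realType) (N : nat).
Local Notation V := 'rV[R]_N.
Implicit Types (x y z : V) (O : set V).

(** For the bound from below, going from [x] a length [G x / (1 - e)] against the gradient at 0
    leaves [O]. For the bound from above, [G <= 0] at a nearby boundary point [y] and the gradient
    has length 1, so [G x <= (1 + e) |x - y|]; distant boundary points are harmless. *)
Lemma rho_chart O (G : V -> R) (d : 'I_N -> V -> R) (r e : R) :
  open O -> bdry O 0 -> 0 < r ->
  (forall w i, cube 0 r w -> is_derive w (evec R i) G (d i w)) ->
  (forall i, {for 0, continuous (d i)}) ->
  (forall x, cube 0 r x -> (O x <-> 0 < G x)) -> \sum_i d i 0 ^+ 2 = 1 ->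
  (forall x, cube 0 r x -> `|G x| <= 2 * enorm x) ->
  0 < e < 1 ->
  exists2 a, 0 < a <= r & forall x, O x -> cube 0 a x ->
    (1 - e) * rho O x <= G x <= (1 + e) * rho O x.
Proof.
move=> oO bO r0 GD dc GO d1 G2 /andP[e0 e1].
have [a /andP[a0 ar] aP] := strict_differentiable r0 GD dc e0.
pose n : V := \row_i d i 0.
have n1 : enorm n = 1.
  by rewrite /enorm /dot (eq_bigr (fun i => d i 0 ^+ 2)) ?d1 ?sqrtr1 // => i _; rewrite !mxE.
have nE x y : \sum_i (y ord0 i - x ord0 i) * d i 0 = dot (y - x) n.
  by apply: eq_bigr => i _; rewrite !mxE.
have N1 : 0 <= N%:R :> R by exact: ler0n.
(* Since [|x| <= N a'] and [G x <= 2 |x|], the step length is at most [a / 2], which keeps the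
   displaced point in the cube; boundary points outside that cube are farther from [x] than
   [G x]. *)
pose a' := a * (1 - e) / (4 * (N%:R + 1)).
have den : 0 < 4 * (N%:R + 1) :> R by rewrite mulr_gt0 // ltr_wpDl.
have a'0 : 0 < a' by rewrite divr_gt0 ?mulr_gt0 ?subr_gt0.
have a'E : a' * (4 * (N%:R + 1)) = a * (1 - e) by rewrite /a' divfK // gt_eqF.
have ae : a * (1 - e) <= a by rewrite ger_pMr //; lra.
have Na : 0 <= N%:R * a' by rewrite mulr_ge0 // ltW.
have a'a : a' <= a by lra.
exists a'; first by rewrite a'0 (le_trans a'a).
move=> x Ox xa'.
have xr : cube 0 r x by apply: subset_cube xa'; apply: le_trans ar.
have xa : cube 0 a x by apply: subset_cube xa'.
have xN : enorm x <= N%:R * a' by exact: cube_enorm (ltW a'0) xa'.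
have Gp : 0 < G x by apply/GO.
have G2x : G x <= 2 * enorm x by have := G2 _ xr; rewrite gtr0_norm.
apply/andP; split.
  pose t := G x / (1 - e).
  have t0 : 0 < t by rewrite divr_gt0 ?subr_gt0.
  have tE : t * (1 - e) = G x by rewrite /t divfK // gt_eqF ?subr_gt0.
  pose y := x - t *: n.
  have xy : x - y = t *: n by rewrite /y opprB addrC subrK.
  have xyn : enorm (x - y) = t by rewrite xy enormZ n1 mulr1 gtr0_norm.
  have tb : t * 2 <= a.
    rewrite -(@ler_pM2r _ (1 - e)) ?subr_gt0 // mulrAC tE; lra.
  have ya : cube 0 a y.
    move=> i; have := xa' i; rewrite !mxE !subr0 => xi.
    have ni : `|d i 0| <= 1 by have := coord_enorm n i; rewrite n1 mxE.
    apply: le_lt_trans (ler_normB _ _) _; rewrite normrM (gtr0_norm t0).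
    have : t * `|d i 0| <= t * 1 by rewrite ler_pM2l.
    lra.
  have yr : cube 0 r y by exact: subset_cube ya.
  have nOy : ~ O y.
    move=> /(GO _ yr) Gy; have := aP _ _ ya xa.
    rewrite nE xy dotZl -sqr_enorm n1 expr1n mulr1 -xy xyn ler_norml => /andP[].
    by move=> ? ?; move: tE; rewrite mulrBr mulr1; lra.
  have := rho_le oO Ox nOy; rewrite xyn => rt.
  by rewrite -tE mulrC ler_pM2r // subr_gt0.
rewrite -ler_pdivrMl; last by lra.
apply: rho_ge; first by exists 0.
move=> y yO; rewrite ler_pdivrMl; last by lra.
have nOy := bdry_notin oO yO.
have xy0 := enorm_ge0 (x - y).
case: (pselect (cube 0 a y)) => ya.
  have Gy : G y <= 0.
    by rewrite leNgt; apply/negP => Gy; apply: nOy; apply/GO => //; exact: subset_cube ya.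
  have := aP _ _ ya xa; rewrite nE ler_norml => /andP[_].
  by have := dot_le (x - y) n; rewrite n1 mulr1; lra.
have ay : a <= enorm y.
  rewrite leNgt; apply/negP => ya'; apply: ya => i.
  by rewrite mxE subr0; apply: le_lt_trans ya'; exact: coord_enorm.
have := enorm_triangle x (y - x); rewrite addrC subrK enorm_sym => H.
have : 0 <= e * enorm (x - y) by rewrite mulr_ge0 // ltW.
lra.
Qed.

(** The quantity [x . grad G - G] measures the failure of [G] to be homogeneous of degree 1. That it
    is [O(|x|^2)], by Lipschitz first derivatives, is what transfers the half-space computation from
    [x_N] to [G]. *)
Lemma origin_chart O (nrm : V -> V) : open O ->
  C2_boundary_with_normal O nrm -> bdry O 0 ->
  exists r G d H C, [/\ 0 < r, 0 < C, jet2 (cube 0 r) G d H,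
    forall x, cube 0 r x -> (O x <-> 0 < G x) &
    (forall x, cube 0 r x -> [/\ `|\sum_i H i i x| <= C,
       `|\sum_i x ord0 i * d i x - G x| <= C * dot x x,
       3 / 4 <= \sum_i d i x ^+ 2 & `|G x| <= 2 * enorm x]) /\
    (forall e, 0 < e < 1 -> exists2 a, 0 < a <= r & forall x, O x -> cube 0 a x ->
       (1 - e) * rho O x <= G x <= (1 + e) * rho O x)].
Proof.
move=> oO C2 bO.
have [r [G [d [H [r0 GJ GO G0 d1]]]]] := defining_function oO C2 bO.
have c00 : cube (0 : V) r 0 by exact: cube_center.
have [Gc Gd GH] := GJ _ c00.
have GD w i : cube 0 r w -> is_derive w (evec R i) G (d i w).
  by move=> /GJ[_ /(_ i)[]].
have dc i : {for 0, continuous (d i)} by have [] := Gd i.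
have e14 : 0 < 4^-1 :> R by rewrite invr_gt0.
have [a1 /andP[a10 a1r] a1P] := strict_differentiable r0 GD dc ltr01.
pose K := \sum_i \sum_j `|H i j 0| + 1.
have Hb i j : `|H i j 0| <= K - 1.
  rewrite /K addrK (bigD1 i) //= (bigD1 j) //= -addrA lerDl addr_ge0 ?sumr_ge0 //.
  by move=> k _; exact: sumr_ge0.
have [|[i j]|a2 a20 a2P] := @finite_radius R ('I_N * 'I_N)%type
    (fun ij a => forall y, cube (0 : V) a y -> `|H ij.1 ij.2 y| <= K).
- by move=> ij a a' aa aP y ya; apply: aP; exact: subset_cube ya.
- have [/continuous_cube /(_ _ ltr01) [a a0 aP] _] := GH i j.
  exists a => // y /aP /= Hy; have := Hb i j.
  have := ler_normD (H i j y - H i j 0) (H i j 0); rewrite subrK; lra.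
have [a3 a30 a3P] : exists2 a, 0 < a & forall y, cube (0 : V) a y ->
    3 / 4 <= \sum_i d i y ^+ 2.
  have : {for (0 : V), continuous (fun y => \sum_i d i y ^+ 2)}.
    apply: continuous_bigsum => i; exact: continuous_mul (dc i) (dc i).
  move=> /continuous_cube /(_ _ e14) [a a0 aP]; exists a => // y /aP.
  by rewrite d1 ltr_norml => /andP[]; lra.
pose b := Num.min r (Num.min a1 (Num.min a2 a3)).
have b0 : 0 < b by rewrite !lt_min r0 a10 a20 a30.
have br : b <= r by rewrite ge_min lexx.
have sub1 : cube (0 : V) b `<=` cube 0 a1 by apply: subset_cube; rewrite !ge_min lexx !orbT.
have sub2 : cube (0 : V) b `<=` cube 0 a2 by apply: subset_cube; rewrite !ge_min lexx !orbT.
have sub3 : cube (0 : V) b `<=` cube 0 a3 by apply: subset_cube; rewrite !ge_min lexx !orbT.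
have subr : cube (0 : V) b `<=` cube 0 r by apply: subset_cube.
have c0b : cube (0 : V) b 0 by exact: cube_center.
have K0 : 0 <= K by rewrite addr_ge0 // sumr_ge0 // => i _; exact: sumr_ge0.
have N0 : 0 <= N%:R :> R by exact: ler0n.
have GD' w i : cube 0 b w -> is_derive w (evec R i) G (d i w).
  by move=> /subr; exact: GD.
have dlip i w x : cube 0 b w -> cube 0 b x -> (forall j, `|w ord0 j - x ord0 j| <= `|x ord0 j|) ->
    `|d i w - d i x| <= K * (N%:R * enorm x).
  move=> wb xb wx.
  have dD v j : cube 0 b v -> is_derive v (evec R j) (d i) (H i j v).
    by move=> /subr /GJ[_ _ /(_ i j)[]].
  have [u [-> uP]] := increment dD xb wb.
  apply: le_trans (ler_norm_sum _ _ _) _.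
  apply: (@le_trans _ _ (\sum_j K * `|x ord0 j|)).
    apply: ler_sum => j _; rewrite normrM mulrC ler_pM //.
    by have [/sub2 uj _] := uP j; have := a2P (i, j) _ uj.
  by rewrite -mulr_sumr ler_wpM2l // -/(l1 x) l1_enorm.
have G2 x : cube 0 b x -> `|G x| <= 2 * enorm x.
  move=> /sub1 xa; have := a1P 0 x (cube_center _ a10) xa.
  rewrite G0 !subr0 mul1r => H1.
  have H2 : `|\sum_i (x ord0 i - (0 : V) ord0 i) * d i 0| <= enorm x.
    have nE (u : V) : \sum_i (u ord0 i - (0 : V) ord0 i) * d i 0 =
        dot u (\row_i d i 0).
      by apply: eq_bigr => i _; rewrite !mxE subr0.
    have n1 : enorm (\row_i d i 0 : V) = 1.
      by rewrite /enorm /dot (eq_bigr (fun i => d i 0 ^+ 2)) ?d1 ?sqrtr1 // => i _; rewrite !mxE.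
    rewrite nE; have := dot_le x (\row_i d i 0); have := dot_le (- x) (\row_i d i 0).
    by rewrite dotNl enormN n1 mulr1 ler_norml => ? ?; apply/andP; split; lra.
  have := ler_normD (G x - \sum_i (x ord0 i - (0 : V) ord0 i) * d i 0)
    (\sum_i (x ord0 i - (0 : V) ord0 i) * d i 0).
  rewrite subrK; lra.
exists b, G, d, H, (K * N%:R * N%:R + K * N%:R + 1); split.
- exact: b0.
- by rewrite ltr_wpDl // addr_ge0 ?mulr_ge0.
- exact: jet2_sub GJ.
- by move=> x /subr; exact: GO.
split; last first.
  by move=> e e01; apply: (rho_chart oO bO b0 GD' dc) => // x /subr; exact: GO.
move=> x xb; split.
- apply: le_trans (ler_norm_sum _ _ _) _.
  apply: (@le_trans _ _ (\sum_(i < N) K)).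
    by apply: ler_sum => i _; apply: (a2P (i, i)); exact: sub2.
  rewrite sumr_const card_ord -[leLHS]mulr_natl mulrC.
  have : 0 <= K * N%:R * N%:R by rewrite !mulr_ge0.
  by lra.
- have [w [E wP]] := increment GD' c0b xb.
  move: E; rewrite G0 subr0 => ->.
  rewrite -sumrB; apply: le_trans (ler_norm_sum _ _ _) _.
  apply: (@le_trans _ _ (\sum_i `|x ord0 i| * (K * (N%:R * enorm x)))).
    apply: ler_sum => i _; rewrite mxE subr0 -mulrBr normrM ler_wpM2l //.
    rewrite distrC; have [wb wj] := wP i; apply: dlip => // j.
    have [th /andP[t0 t1] ->] := wj j; rewrite mxE subr0 add0r.
    rewrite -{2}[x ord0 j]mul1r -mulrBl normrM ler_piMl // ler_norml.
    by apply/andP; split; lra.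
  rewrite -mulr_suml -/(l1 x) -sqr_enorm.
  apply: (@le_trans _ _ (N%:R * enorm x * (K * (N%:R * enorm x)))).
    by rewrite ler_wpM2r ?l1_enorm // !mulr_ge0 // enorm_ge0.
  have -> : N%:R * enorm x * (K * (N%:R * enorm x)) = K * N%:R * N%:R * enorm x ^+ 2 by ring.
  rewrite ler_wpM2r ?sqr_ge0 //.
  have : 0 <= K * N%:R by rewrite mulr_ge0.
  lra.
- by apply: a3P; exact: sub3.
- exact: G2.
Qed.

End OriginChart.

(** * Barriers at the origin *)

Lemma subr_half_bounds (R : realType) (u v : R) : v <= u / 2 -> 0 <= v ->
  u / 2 <= u - v <= u.
Proof. by move=> *; apply/andP; split; lra. Qed.

(** The linear bookkeeping for the corrector [w]: [m] is the residual of its first term with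
    curvature errors [e1], [e2]; [n] is the gradient term of [G^2], and [t1], [t2], [t3] are its
    curvature, radial and zero-order errors. Here [n] absorbs [e1], [e2], [t1], and [m] absorbs
    [t2], [t3]. *)
Lemma corrector_balance (R : realType) (Q m k c2 c5 c6 n e1 e2 t1 t2 t3 : R) :
  k <= m -> c2 <= k -> c5 + c6 <= c2 -> 3 / 2 * Q <= n ->
  - (Q / 4) <= e1 + e2 -> e1 + e2 <= Q / 4 -> - (Q / 2) <= t1 -> t1 <= Q / 2 ->
  - c5 <= t2 -> t2 <= c5 -> - c6 <= t3 -> t3 <= c6 ->
  Q / 2 <= m - e1 - e2 + (t1 + n + t2 + t3).
Proof. by move=> *; lra. Qed.

Section ErrorTerms.
Variables (R : realType) (C Q T g e s h k : R).
Hypotheses (C0 : 0 < C) (Q0 : 0 < Q) (T0 : 0 < T) (g0 : 0 < g) (g2 : g <= 2 * e).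

Lemma curvature_term : `|h| <= C -> e <= (8 * C)^-1 -> `|2 * Q * g * h| <= Q / 2.
Proof.
move=> hC eC; rewrite normrM gtr0_norm ?mulr_gt0 //.
apply: (@le_trans _ _ (2 * Q * (2 * e) * C)).
  apply: ler_pM => //; first by rewrite !mulr_ge0 // ltW.
  by rewrite ler_pM2l // mulr_gt0.
have H8 : 8 * C * e <= 1 by rewrite mulrC -ler_pdivlMr ?mulr_gt0 // div1r.
have : Q * (8 * C * e) <= Q * 1 by rewrite ler_pM2l.
by lra.
Qed.

Lemma radial_term q : `|h - g| <= C * s -> s <= e ->
  `|8 * q * T * g * h| <= g * (8 * `|q| * (2 + C) * (e * T)).
Proof.
move=> hg se.
have X : `|h| <= (2 + C) * e.
  rewrite -[X in `|X|](subrK g) [2 + C]addrC mulrDl; apply: le_trans (ler_normD _ _) _.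
  by rewrite (gtr0_norm g0) lerD // (le_trans hg) // ler_pM2l.
rewrite normrM [X in X * _](_ : _ = 8 * `|q| * T * g); last first.
  by rewrite !normrM (gtr0_norm T0) (gtr0_norm g0) (@gtr0_norm _ 8).
apply: (@le_trans _ _ (8 * `|q| * T * g * ((2 + C) * e))).
  by rewrite ler_wpM2l // !mulr_ge0 // ltW.
by rewrite [leRHS](_ : _ = 8 * `|q| * T * g * ((2 + C) * e)) //; ring.
Qed.

Lemma zero_order_term : `|g * g * T * k| <= g * (2 * `|k| * (e * T)).
Proof.
rewrite normrM gtr0_norm ?mulr_gt0 //.
have : g * (g * (T * `|k|)) <= g * (2 * e * (T * `|k|)).
  by rewrite ler_pM2l // ler_wpM2r // mulr_ge0 // ltW.
by lra.
Qed.

End ErrorTerms.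

Section LocalBarriers.
Variables (R : realType) (N : nat) (mu sigma b tau0 S0 a0 a1 kap : R).
Local Notation V := 'rV[R]_N.
Local Notation tau := (tau tau0).
Local Notation prof := (prof tau0).
Local Notation dprof := (dprof tau0).
Local Notation ddprof := (ddprof tau0).
(** [muE] is the indicial equation of [x_N s^b], and [sigma] measures the distance to its double
    root. By [prof_radial], [a0E] says that [tau^a0] leaves no residual in the half space, and [a1E]
    that the residual of [tau^a1] is positive with constant [kap]. *)
Hypotheses (muE : mu = 4 * b ^+ 2 + 2 * N%:R * b)
  (bE : 4 * b + N%:R = - 2 * sigma) (S00 : 0 < S0)
  (tau1 : forall s, 0 < s -> s <= S0 -> 1 <= tau s)
  (a0E : forall s, 0 < s -> s <= S0 -> a0 * (sigma * tau s + a0 - 1) = 0)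
  (a1E : forall s, 0 < s -> s <= S0 -> kap <= - 4 * a1 * (sigma * tau s + a1 - 1))
  (kap0 : 0 < kap) (a01 : `|a0| <= 1) (a11 : `|a1| <= 1).
Implicit Types (x y : V) (U : set V).

Let tpos s : 0 < s -> s <= S0 -> 0 < tau s.
Proof. by move=> s0 s1; have := tau1 s0 s1; lra. Qed.

Definition pot x : R := mu / enorm x ^+ 2.

Lemma radial_jet U f d H p a : jet2 U f d H ->
  (forall x, U x -> 0 < dot x x /\ dot x x <= S0) ->
  exists d' H', jet2 U (fun x => f x * prof p a (dot x x)) d' H' /\
    forall x, U x -> let s := dot x x in
    \sum_i H' i i x = prof p a s * \sum_i H i i x
      + 4 * dprof p a s * \sum_i x ord0 i * d i x
      + f x * (4 * s * ddprof p a s + 2 * N%:R * dprof p a s).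
Proof.
move=> fJ Us.
have PP x : U x -> let s := dot (x - 0) (x - 0) in
    [/\ is_derive s 1 (prof p a) (dprof p a s),
        is_derive s 1 (dprof p a) (ddprof p a s) &
        {for s, continuous (ddprof p a)}].
  by move=> /Us[s0 s1] s; rewrite /s subr0; apply: prof_jet => //; exact: tpos.
have [d' [H' [J E]]] := jet2_radial fJ PP.
exists d', H'; split.
  apply: (jet2_eq J) => [x|i x|i j x]; first by rewrite subr0.
    by [].
  by [].
move=> x Ux s; have := E x Ux; rewrite /= subr0 -/s => ->.
by congr (_ + _ * _ + _); apply: eq_bigr => i _; rewrite mxE subr0.
Qed.

Lemma solution_jet U f d H a : jet2 U f d H ->
  (forall x, U x -> 0 < dot x x /\ dot x x <= S0) ->
  exists d' H', jet2 U (fun x => f x * prof b a (dot x x)) d' H' /\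
    forall x, U x -> let s := dot x x in
    pot x * (f x * prof b a s) - \sum_i H' i i x =
      f x * (- 4 * a * (sigma * tau s + a - 1) * prof (b - 1) (a - 2) s)
      - prof b a s * \sum_i H i i x
      - 4 * dprof b a s * (\sum_i x ord0 i * d i x - f x).
Proof.
move=> fJ Us; have [d' [H' [J E]]] := radial_jet b a fJ Us.
exists d', H'; split => // x Ux s; rewrite E // -/s.
have [s0 s1] := Us _ Ux.
rewrite -(prof_radial a muE bE s0 (tpos s0 s1)) /pot sqr_enorm -/s.
by ring.
Qed.

(** The exponent [q] is halfway between [b - 1/2] and [b]. With [eta = s^(1/4)], the profile [s^q]
    exceeds [s^b] by a factor [1 / eta], while [sqrt s] times it is smaller than [s^b] by a factor
    [eta]; in both cases [eta] beats the logarithms. *)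
Lemma profile_small (q := b - 4^-1) (C1 C2 : R) : 0 < C1 -> 0 < C2 ->
  exists2 e, 0 < e <= 1 & forall s, 0 < s -> s < e -> s <= S0 ->
  [/\ C2 * (Num.sqrt s * prof (q - 1) 0 s) <= kap * prof (b - 1) (a1 - 2) s,
      forall a, `|a| <= 1 -> C1 * prof b a s <= prof q 0 s / 4 &
      2 * Num.sqrt s * prof q 0 s <= prof b a1 s / 2].
Proof.
move=> C10 C20.
pose e0 := Num.min 4^-1 (Num.min (kap / C2) (4 * C1)^-1).
have e00 : 0 < e0.
  rewrite !lt_min; apply/and3P; split; first by rewrite invr_gt0.
    exact: divr_gt0.
  by rewrite invr_gt0 mulr_gt0.
have [e e1 eP] := tau_small tau0 e00.
exists e => // s s0 se sS.
have t1 := tau1 s0 sS; have t0 := tpos s0 sS.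
have := eP s s0 se (ltW t0); set eta := s `^ 4^-1 => etat.
have eta0 : 0 < eta by rewrite powR_gt0.
have sq : Num.sqrt s = eta * eta.
  rewrite -powR12_sqrt ?ltW // /eta -powRD_gt0 //; congr (_ `^ _); by field.
have tauM p a : prof p a s * tau s = prof p (a + 1) s.
  by rewrite mulrC -{1}[a](addrK 1) prof_tau.
have etaM p a : eta * prof (p - 4^-1) a s = prof p a s.
  by rewrite /prof mulrA -powRD_gt0 // subrKC.
have ett : eta * tau s <= eta * tau s ^+ 3.
  rewrite ler_pM2l // exprS ler_peMr ?(ltW t0) //.
  by rewrite exprn_ege1.
have h1 : eta * tau s ^+ 3 <= 4^-1.
  by apply: le_trans etat _; rewrite ge_min lexx.
have h2 : eta * tau s ^+ 3 <= kap / C2.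
  by apply: le_trans etat _; rewrite !ge_min lexx !orbT.
have h3 : eta * tau s ^+ 3 <= (4 * C1)^-1.
  by apply: le_trans etat _; rewrite !ge_min lexx !orbT.
have P0 p a : 0 < prof p a s by apply: prof_gt0.
have [am aM] : -1 <= a1 /\ a1 <= 1 by move: a11; rewrite ler_norml => /andP[].
split.
- rewrite sq -mulrA (_ : q - 1 = b - 1 - 4^-1); last by rewrite /q; ring.
  rewrite (etaM (b - 1) 0).
  have -> : prof (b - 1) 0 s = prof (b - 1) (-3) s * tau s ^+ 3.
    by rewrite !exprS expr0 mulr1 !mulrA !tauM; congr (prof _ _ s); ring.
  have H : prof (b - 1) (-3) s <= prof (b - 1) (a1 - 2) s by apply: prof_le => //; lra.
  have K : C2 * (eta * tau s ^+ 3) <= kap by rewrite mulrC -ler_pdivlMr.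
  apply: (@le_trans _ _ (kap * prof (b - 1) (-3) s)); last by rewrite ler_pM2l.
  rewrite (_ : C2 * _ = C2 * (eta * tau s ^+ 3) * prof (b - 1) (-3) s); last by ring.
  by rewrite ler_pM2r.
- move=> a /ler_normlP[_ a1'].
  apply: (@le_trans _ _ (C1 * prof b 1 s)); first by rewrite ler_pM2l // prof_le.
  have -> : prof b 1 s = (eta * tau s) * prof q 0 s.
    by rewrite mulrAC (etaM b 0) tauM add0r.
  rewrite mulrA mulrC ler_pM2l //.
  have := le_trans ett h3; rewrite invfM -ler_pdivrMr ?invr_gt0 // invrK mulrC; lra.
- rewrite sq (_ : 2 * _ * _ = 2 * eta * (eta * prof q 0 s)); last by ring.
  rewrite (etaM b 0).
  have -> : prof b 0 s = tau s * prof b (-1) s by rewrite mulrC tauM addNr.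
  have X1 : prof b (-1) s <= prof b a1 s by exact: prof_le.
  have X2 : (eta * tau s) * prof b (-1) s <= 4^-1 * prof b (-1) s.
    by rewrite ler_pM2r // (le_trans ett).
  rewrite -mulrA [eta * _]mulrA.
  set X := eta * tau s * _ in X2 *.
  lra.
Qed.

Lemma profile_dprof s a : 0 < s -> s <= S0 -> `|a| <= 1 ->
  s * `|dprof b a s| <= (`|b| + 1) * prof b a s.
Proof. by move=> s0 s1 aa; apply: dprof_bound => //; exact: tau1. Qed.

(* The corrector [w]: the negative square of [G] supplies the positive term
   [2 Q |grad G|^2], which does not degenerate at the boundary and so absorbs
   the curvature errors; the first term of [w] absorbs the rest. *)
Lemma local_barriers O r G d H C (q := b - 4^-1)
    (u0 := fun x => G x * prof b a0 (dot x x))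
    (w := fun x => G x * prof b a1 (dot x x) + - 1 * (G x * G x * prof q 0 (dot x x))) :
  0 < r -> 0 < C -> jet2 (cube 0 r) G d H -> (forall x, O x -> x != 0) ->
  (forall x, cube 0 r x -> (O x <-> 0 < G x)) ->
  (forall x, cube 0 r x -> [/\ `|\sum_i H i i x| <= C,
       `|\sum_i x ord0 i * d i x - G x| <= C * dot x x,
       3 / 4 <= \sum_i d i x ^+ 2 & `|G x| <= 2 * enorm x]) ->
  exists rad dU HU dW HW, let U := O `&` eball 0 rad in
    [/\ 0 < rad /\ rad <= r, forall x, eball 0 rad x -> dot x x <= S0,
        jet2 U u0 dU HU /\ jet2 U w dW HW,
        forall x, U x -> `|pot x * u0 x - \sum_i HU i i x| <= prof q 0 (dot x x) / 4 &
        forall x, U x -> prof q 0 (dot x x) / 2 <= pot x * w x - \sum_i HW i i x /\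
          G x * prof b a1 (dot x x) / 2 <= w x <= G x * prof b a1 (dot x x)].
Proof.
move=> r0 C0 GJ O0 GO Gb.
(* [C1] collects the curvature errors of one profile, [C] from the Laplacian of [G] and
   [4 C (|b| + 1)] from the radial cross term. [C2] collects the radial and zero-order errors of
   [G^2 s^q]. *)
pose C1 := C * (1 + 4 * (`|b| + 1)).
pose K := `|4 * q * (q - 1) + 2 * N%:R * q - mu|.
pose C2 := 8 * `|q| * (2 + C) + 2 * K + 1.
have C10 : 0 < C1 by rewrite mulr_gt0 //; have := normr_ge0 b; lra.
have C20 : 0 < C2.
  have : 0 <= 8 * `|q| * (2 + C) by rewrite !mulr_ge0 //; lra.
  by have := normr_ge0 (4 * q * (q - 1) + 2 * N%:R * q - mu); rewrite /C2 -/K; lra.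
have [e /andP[e0 e1] eP] := profile_small C10 C20.
pose rad := Num.min r (Num.min (e / 2) (Num.min S0 (8 * C)^-1)).
have rad0 : 0 < rad.
  rewrite !lt_min r0 S00 /=; apply/andP; split; first by rewrite divr_gt0.
  by rewrite invr_gt0 mulr_gt0.
have radr : rad <= r by rewrite ge_min lexx.
have rade : rad <= e / 2 by rewrite !ge_min lexx !orbT.
have radS : rad <= S0 by rewrite !ge_min lexx !orbT.
have radC : rad <= (8 * C)^-1 by rewrite !ge_min lexx !orbT.
have bs x : eball 0 rad x -> dot x x <= enorm x /\ enorm x < rad.
  rewrite /eball /= subr0 => xr; split => //; rewrite -sqr_enorm expr2.
  by rewrite ler_piMr ?enorm_ge0 //; lra.
have bS x : eball 0 rad x -> dot x x <= S0 by move=> /bs[]; lra.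
pose U := O `&` eball 0 rad.
have UJ : jet2 U G d H.
  apply: jet2_sub GJ => x [_]; rewrite /eball /= subr0 => xr; apply: eball_cube.
  by rewrite subr0; exact: lt_le_trans radr.
have Us x : U x -> 0 < dot x x /\ dot x x <= S0.
  by move=> [Ox xr]; split; [apply: dot_gt0; exact: O0|exact: bS].
have [dU [HU [J0 E0]]] := solution_jet a0 UJ Us.
have [d1 [H1 [J1 E1]]] := solution_jet a1 UJ Us.
have [d2 [H2 [J2 E2]]] := radial_jet q 0 (jet2_mul UJ UJ) Us.
have JW := jet2_add J1 (jet2_mul (@jet2_cst R N U (- 1)) J2).
have data x : U x -> let s := dot x x in
    [/\ 0 < G x, G x <= 2 * enorm x, `|\sum_i H i i x| <= C,
      `|\sum_i x ord0 i * d i x - G x| <= C * s & 3 / 4 <= \sum_i d i x ^+ 2] /\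
    [/\ 0 < s, s <= S0, s <= enorm x, enorm x <= (8 * C)^-1 & s < e].
  move=> Ux s; have [s0 sS] := Us _ Ux; have [Ox xr] := Ux.
  have [sx xrad] := bs _ xr.
  have xc : cube 0 r x.
    by apply: eball_cube; rewrite subr0; exact: lt_le_trans radr.
  have Gp : 0 < G x by apply/GO.
  have [? ? ? G2] := Gb _ xc; rewrite gtr0_norm // in G2.
  split; split => //; first exact: le_trans (ltW xrad) radC.
  apply: le_lt_trans sx _; apply: lt_trans xrad _; apply: le_lt_trans rade _.
  by rewrite ltr_pdivrMr // mulr_natr mulr2n ltrDl.
have err x a (s := dot x x) : U x -> `|a| <= 1 ->
    `|prof b a s * \sum_i H i i x
      + 4 * dprof b a s * (\sum_i x ord0 i * d i x - G x)| <= prof q 0 s / 4.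
  move=> Ux aa; have [[Gp G2 HC xC dC] [s0 sS sx xC8 se]] := data _ Ux.
  rewrite -/s in xC s0 sS sx se.
  have [_ P2 _] := eP s s0 se sS.
  apply: le_trans _ (P2 _ aa); apply: le_trans (ler_normD _ _) _.
  have P0 : 0 < prof b a s by apply: prof_gt0 => //; exact: tpos.
  have I1 : `|prof b a s * \sum_i H i i x| <= C * prof b a s.
    by rewrite normrM (gtr0_norm P0) mulrC ler_pM2r.
  have I2 : `|4 * dprof b a s * (\sum_i x ord0 i * d i x - G x)| <=
      4 * C * ((`|b| + 1) * prof b a s).
    rewrite !normrM (@gtr0_norm _ 4) //.
    apply: (@le_trans _ _ (4 * `|dprof b a s| * (C * s))).
      by rewrite ler_wpM2l // mulr_ge0.
    rewrite (_ : 4 * `|dprof b a s| * (C * s) = 4 * C * (s * `|dprof b a s|)); last by ring.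
    by rewrite ler_wpM2l ?mulr_ge0 ?(ltW C0) // profile_dprof.
  rewrite (_ : C1 * _ = C * prof b a s + 4 * C * ((`|b| + 1) * prof b a s)).
    exact: lerD.
  by rewrite /C1; ring.
exists rad, dU, HU; do 2!eexists; split.
- by [].
- exact: bS.
- split; [exact: J0|exact: JW].
- move=> x Ux; have [_ [s0 sS _ _ _]] := data _ Ux.
  rewrite /u0 E0 // (_ : - 4 * a0 * _ = - 4 * (a0 * (sigma * tau (dot x x) + a0 - 1))); last by ring.
  rewrite a0E // mulr0 mul0r mulr0 sub0r -opprD normrN; exact: (err x a0 Ux a01).
move=> x Ux; have [[Gp G2 HC xC dC] [s0 sS sx xC8 se]] := data _ Ux.
pose s := dot x x; rewrite -/s in xC s0 sS sx se *.
have [P1 P2 P3] := eP s s0 se sS.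
have t0 := tpos s0 sS.
have Q0 : 0 < prof q 0 s by exact: prof_gt0.
pose T := prof (q - 1) 0 s; have T0 : 0 < T by exact: prof_gt0.
have QT : prof q 0 s = s * T by rewrite /T prof_mul.
have e1' : Num.sqrt s = enorm x by [].
rewrite e1' -/q -/T in P1 P3.
have rho0 : 0 <= enorm x by exact: enorm_ge0.
have GQ : G x * G x * prof q 0 s <= G x * prof b a1 s / 2.
  rewrite -[leLHS]mulrA -[leRHS]mulrA ler_pM2l //; apply: le_trans _ P3.
  by rewrite ler_pM2r.
have GQ0 : 0 <= G x * G x * prof q 0 s.
  by apply: mulr_ge0; [apply: mulr_ge0|]; exact: ltW.
split; last first.
  by rewrite /w /= -/s mulN1r subr_half_bounds.
have S2 : \sum_i H2 i i x - pot x * (G x * G x * prof q 0 s) =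
    2 * prof q 0 s * G x * \sum_i H i i x + 2 * prof q 0 s * \sum_i d i x ^+ 2
    + 8 * q * T * G x * \sum_i x ord0 i * d i x
    + G x * G x * T * (4 * q * (q - 1) + 2 * N%:R * q - mu).
  rewrite E2 // -/s /pot sqr_enorm -/s.
  rewrite (eq_bigr (fun i => 2 * G x * H i i x + 2 * d i x ^+ 2)); last by move=> i _; ring.
  rewrite big_split /= -!mulr_sumr.
  rewrite (eq_bigr (F1 := fun i => x ord0 i * (G x * d i x + G x * d i x))
    (fun i => 2 * G x * (x ord0 i * d i x))); last by move=> i _; ring.
  rewrite -mulr_sumr.
  have D1 : dprof q 0 s = q * T by rewrite /dprof mul0r subr0.
  have D2 : s * ddprof q 0 s = q * (q - 1) * T.
    rewrite /ddprof mul0r subr0 /dprof mul0r subr0 -/T.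
    have <- : s * prof (q - 1 - 1) 0 s = T by rewrite prof_mul.
    by ring.
  rewrite -[4 * s * _]mulrA D1 D2 QT; field; exact: lt0r_neq0.
rewrite /= (eq_bigr (fun i => H1 i i x - H2 i i x)); last by move=> i _; ring.
rewrite sumrB /w -/s.
have L1 := E1 _ Ux; rewrite /= -/s in L1.
have A1 := err _ _ Ux a11; rewrite -/s in A1.
have B1 : kap * (G x * prof (b - 1) (a1 - 2) s) <=
   G x * (- 4 * a1 * (sigma * tau s + a1 - 1) * prof (b - 1) (a1 - 2) s).
  rewrite mulrCA ler_pM2l // ler_pM2r ?prof_gt0 //; exact: a1E.
have B2 : G x * (C2 * (enorm x * T)) <= kap * (G x * prof (b - 1) (a1 - 2) s).
  by rewrite [leRHS]mulrCA ler_pM2l.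
have B3 : 3 / 2 * prof q 0 s <= 2 * prof q 0 s * \sum_i d i x ^+ 2.
  have -> : 3 / 2 * prof q 0 s = 2 * prof q 0 s * (3 / 4) by field.
  by rewrite ler_pM2l //; exact: mulr_gt0.
have B4 : `|2 * prof q 0 s * G x * \sum_i H i i x| <= prof q 0 s / 2.
  exact: (curvature_term C0 Q0 Gp G2 HC xC8).
have B5 : `|8 * q * T * G x * \sum_i x ord0 i * d i x| <=
    G x * (8 * `|q| * (2 + C) * (enorm x * T)).
  exact: (radial_term C0 T0 Gp G2 q xC sx).
have B6 : `|G x * G x * T * (4 * q * (q - 1) + 2 * N%:R * q - mu)| <=
    G x * (2 * K * (enorm x * T)).
  exact: zero_order_term.
have GT : 0 <= G x * (enorm x * T).
  by apply: mulr_ge0; [exact: ltW|apply: mulr_ge0 => //; exact: ltW].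
move: S2 L1 A1 B4 B5 B6; rewrite !ler_norml => S2 L1 /andP[? ?] /andP[? ?] /andP[? ?] /andP[? ?].
have B2' : G x * (8 * `|q| * (2 + C) * (enorm x * T)) + G x * (2 * K * (enorm x * T))
   <= G x * (C2 * (enorm x * T)).
  rewrite -mulrDr -mulrDl ler_pM2l // /C2 ler_wpM2r ?lerDl //.
  by apply: mulr_ge0 => //; exact: ltW.
rewrite (_ : pot x * _ - _ = (pot x * (G x * prof b a1 s) - \sum_i H1 i i x) +
  (\sum_i H2 i i x - pot x * (G x * G x * prof q 0 s))); last by ring.
rewrite L1 S2; exact: (corrector_balance B1 B2 B2' B3).
Qed.

End LocalBarriers.

(** * A [C^2] cutoff *)

Section Cutoff.
Variable R : realType.
Implicit Types (s x z : R).

Lemma quadratic_is_derive_at (f : R -> R) (x a C : R) :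
  (forall z, `|z - x| < 1 -> `|f z - f x - (z - x) * a| <= C * (z - x) ^+ 2) ->
  is_derive x 1 f a.
Proof.
move=> H.
have D : is_derive (0 : R) 1 (fun t => f (x + t)) a.
  apply: (@quadratic_is_derive _ _ _ C 1) => // t t1.
  have := H (x + t); rewrite addrAC subrr add0r addr0; exact.
have S : is_derive x 1 (fun z : R => z - x) 1.
  have := is_deriveB (is_derive_id x (1 : R)) (is_derive_cst x x (1 : R)).
  by rewrite subr0.
rewrite -(subrr x) in D.
have := @is_derive1_comp R (fun t => f (x + t)) (fun z : R => z - x) x _ _ D S.
rewrite mulr1 (_ : _ \o _ = f) //.
by apply/funext => z /=; rewrite subrKC.
Qed.

(** The cube of this positive part is [C^2], which suffices for a cutoff of class [jet2]. *)
Definition ppart s1 s : R := Num.max (s - s1) 0.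

Lemma ppart_ge0 s1 s : 0 <= ppart s1 s.
Proof. by rewrite /ppart le_max lexx orbT. Qed.

Lemma ppartP s1 s : (s1 <= s /\ ppart s1 s = s - s1) \/ (s < s1 /\ ppart s1 s = 0).
Proof.
rewrite /ppart; case: (leP s1 s) => H; [left|right]; split=> //.
  by rewrite max_l // subr_ge0.
by rewrite max_r // subr_le0 ltW.
Qed.

Lemma cube_taylor (s s1 z n : R) : s1 <= s -> s1 <= z -> z - s <= 1 -> s - s1 <= n ->
  `|(z - s1) ^+ 3 - (s - s1) ^+ 3 - (z - s) * (3 * (s - s1) ^+ 2)|
    <= (3 * n + 3) * (z - s) ^+ 2.
Proof.
move=> h1 h2 h3 h4.
rewrite (_ : _ - _ = (z - s) ^+ 2 * ((z - s1) + 2 * (s - s1))); last by ring.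
rewrite ger0_norm; last by rewrite mulr_ge0 ?sqr_ge0 //; lra.
by rewrite mulrC ler_wpM2r ?sqr_ge0 //; lra.
Qed.

Lemma cube_taylor_neg (X Z n : R) : 0 <= X -> Z <= 0 -> X - Z <= 1 -> 0 <= n ->
  `|0 - X ^+ 3 - (Z - X) * (3 * X ^+ 2)| <= (3 * n + 3) * (Z - X) ^+ 2.
Proof.
move=> h1 h2 h3 h4.
rewrite (_ : _ - _ = X ^+ 2 * (2 * X - 3 * Z)); last by ring.
rewrite ger0_norm; last by rewrite mulr_ge0 ?sqr_ge0 //; lra.
rewrite mulrC; apply: ler_pM; rewrite ?sqr_ge0 //; [lra|lra|].
by rewrite -[leRHS]sqrrN opprB lerXn2r ?nnegrE //; lra.
Qed.

Lemma cube_taylor_pos (X Z n : R) : X <= 0 -> 0 <= Z -> Z - X <= 1 -> 0 <= n ->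
  `|Z ^+ 3| <= (3 * n + 3) * (Z - X) ^+ 2.
Proof.
move=> h1 h2 h3 h4; rewrite ger0_norm ?exprn_ge0 // exprS.
by apply: ler_pM; rewrite ?sqr_ge0 //; [lra|rewrite lerXn2r ?nnegrE //; lra].
Qed.

Lemma cutoff_jet s1 s : [/\ is_derive s 1 (fun t => ppart s1 t ^+ 3) (3 * ppart s1 s ^+ 2),
  is_derive s 1 (fun t => 3 * ppart s1 t ^+ 2) (6 * ppart s1 s) &
  {for s, continuous (fun t => 6 * ppart s1 t)}].
Proof.
split.
- apply: (@quadratic_is_derive_at _ _ _ (3 * `|s - s1| + 3)) => z zs.
  have n0 := normr_ge0 (s - s1); have n1 := ler_norm (s - s1).
  move: zs; rewrite ltr_norml => /andP[z1 z2].
  have zs : z - s = (z - s1) - (s - s1) by ring.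
  case: (ppartP s1 s) => [[h1 ->]|[h1 ->]]; case: (ppartP s1 z) => [[h2 ->]|[h2 ->]].
  - apply: cube_taylor => //; lra.
  - rewrite zs !expr0n /=; apply: cube_taylor_neg => //; lra.
  - rewrite zs !expr0n /= !mulr0 !subr0; apply: cube_taylor_pos => //; lra.
  - by rewrite !expr0n /= !mulr0 !subr0 normr0 mulr_ge0 ?sqr_ge0 //; lra.
- apply: (@quadratic_is_derive_at _ _ _ 3) => z zs.
  case: (ppartP s1 s) => [[h1 ->]|[h1 ->]]; case: (ppartP s1 z) => [[h2 ->]|[h2 ->]].
  - rewrite (_ : _ - _ - _ = 3 * (z - s) ^+ 2) ?ger0_norm //; last by ring.
    by rewrite mulr_ge0 ?sqr_ge0.
  - rewrite !expr0n /= mulr0 (_ : _ - _ = 3 * ((s - s1) * ((s - z) + (s1 - z)))); last by ring.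
    rewrite ger0_norm; last by rewrite !mulr_ge0 //; lra.
    by rewrite ler_pM2l //; nra.
  - rewrite !expr0n /= !mulr0 !subr0 ger0_norm; last by rewrite mulr_ge0 ?sqr_ge0.
    by rewrite ler_pM2l // lerXn2r ?nnegrE //; lra.
  - by rewrite !expr0n /= !mulr0 !subr0 normr0 mulr_ge0 ?sqr_ge0.
apply/cvgrPdist_lt => e e0; exists (e / 6); first by rewrite /= divr_gt0.
move=> t /=; rewrite ltr_pdivlMr // => ts.
rewrite -mulrBr normrM (@gtr0_norm _ 6) // mulrC.
apply: le_lt_trans ts; rewrite ler_pM2r // ler_norml.
have := ler_norm (s - t); have := ler_norm (- (s - t)); rewrite normrN.
by case: (ppartP s1 s) => [[h1 ->]|[h1 ->]]; case: (ppartP s1 t) => [[h2 ->]|[h2 ->]];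
  move=> ? ?; apply/andP; split; lra.
Qed.

End Cutoff.

(** * Comparison of radial profiles *)

Section ProfileLimits.
Variables (R : realType) (b tau0 : R).
Local Notation tau := (tau tau0).
Local Notation prof := (prof tau0).

Lemma prof_ratio a a' (e : R) : a < a' -> 0 < e ->
  exists2 d, 0 < d & forall s, 0 < s -> s < d -> 1 <= tau s ->
    prof b a s <= e * prof b a' s.
Proof.
move=> aa e0; have da : 0 < a' - a by rewrite subr_gt0.
have e1 : 0 < e^-1 by rewrite invr_gt0.
(* At this [d] one has [tau d ^ (a' - a) = 1 / e], and [tau] grows as [s] decreases. *)
exists (expR (tau0 - (e^-1) `^ (a' - a)^-1)); first exact: expR_gt0.
move=> s s0 sd t1; have t0 : 0 < tau s by lra.
have ts : e^-1 `^ (a' - a)^-1 <= tau s.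
  move: sd; rewrite -{1}[s]lnK ?posrE // ltr_expR /tau; lra.
have : e^-1 <= tau s `^ (a' - a).
  have -> : e^-1 = (e^-1 `^ (a' - a)^-1) `^ (a' - a).
    by rewrite -powRrM mulVf ?powRr1 ?ltW // gt_eqF.
  by rewrite ge0_ler_powR ?nnegrE ?powR_ge0 // ltW.
rewrite -(ler_pM2l e0) divff ?gt_eqF // => H.
rewrite /prof mulrCA ler_wpM2l ?powR_ge0 //.
have -> : a' = (a' - a) + a by rewrite subrK.
rewrite powRD_gt0 // mulrA -[leLHS]mul1r ler_wpM2r ?powR_ge0 //.
Qed.

Lemma prof_antimono a s s' : b <= 0 -> a <= 1 -> 0 < s' -> s' <= s -> 1 <= tau s ->
  prof b a s <= prof b 1 s'.
Proof.
move=> b0 a1 s'0 ss t1; have s0 : 0 < s by exact: lt_le_trans ss.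
apply: (@le_trans _ _ (prof b 1 s)); first exact: prof_le.
have tt : tau s <= tau s' by rewrite /tau lerD2l lerN2 ler_ln ?posrE.
rewrite /prof; apply: ler_pM; rewrite ?powR_ge0 //.
  rewrite -[b]opprK powRN [leRHS]powRN lef_pV2 ?posrE ?powR_gt0 //.
  by rewrite ge0_ler_powR ?nnegrE ?oppr_ge0 // ltW.
by rewrite !powRr1 //; lra.
Qed.

Lemma prof_ge1 q s : q <= 0 -> 0 < s -> s <= 1 -> 1 <= prof q 0 s.
Proof.
move=> q0 s0 s1; rewrite /prof powRr0 mulr1 -[q]opprK powRN.
rewrite invf_ge1 ?powR_gt0 //.
have one : (1 : R) `^ (- q) = 1 by rewrite powR1.
by rewrite -[leRHS]one ge0_ler_powR ?nnegrE ?oppr_ge0 // ltW.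
Qed.

End ProfileLimits.

(** * Barriers at the other boundary points *)

(* Here [g], [h], [D], [s] are the values of [G], [lap G], [|grad G|^2] and
   [|x - z|^2] in the barrier [K (G - a G^2) + k2 |x - z|^2]; the term
   [- 2 K a D] dominates all the others. *)
Lemma barrier_inequality (R : realType) (c m C a K k2 n g h D s : R) :
  0 <= m -> 0 <= C -> 0 <= k2 -> 0 <= n -> `|c| <= m -> `|h| <= C ->
  a = 2 * (2 * C + m + 1) -> K = k2 * (2 * n + m) + 1 -> 0 <= g -> g <= (4 * a)^-1 ->
  3 / 4 <= D -> 0 <= s -> s <= 1 ->
  0 <= K * (g - a * g ^+ 2) + k2 * s /\
  K * (h - a * (2 * g * h + 2 * D)) + k2 * (2 * n) <
    c * (K * (g - a * g ^+ 2) + k2 * s).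
Proof.
move=> m0 C0 k0 n0 cm hC aE KE g0 ga D34 s0 s1.
have a0 : 2 <= a by lra.
have K0 : 1 <= K by rewrite KE lerDr mulr_ge0 //; lra.
have ag : a * g <= 4^-1.
  rewrite -ler_pdivlMl; last by lra.
  by rewrite -invfM mulrC.
have g1 : g <= 1.
  have : 2 * g <= a * g by rewrite ler_wpM2r.
  by lra.
have gag : a * g ^+ 2 <= 4^-1 * g by rewrite expr2 mulrA ler_wpM2r.
have v0 : 0 <= K * (g - a * g ^+ 2) + k2 * s.
  by rewrite addr_ge0 ?mulr_ge0 //; lra.
split=> //.
have v1 : K * (g - a * g ^+ 2) + k2 * s <= K + k2.
  apply: lerD; last by rewrite ler_piMr.
  rewrite ler_piMr //; first by lra.
  have : 0 <= a * g ^+ 2 by rewrite mulr_ge0 ?sqr_ge0 //; lra.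
  by lra.
set v := K * _ + _ in v0 v1 *.
have cv : - (m * (K + k2)) <= c * v.
  rewrite lerNl; apply: le_trans (ler_norm _) _; rewrite normrN normrM.
  by rewrite ler_pM // ger0_norm.
have h1 : K * h <= K * C by rewrite ler_pM2l; [exact: le_trans (ler_norm _) hC|lra].
have h2 : - (K * (a * g * (2 * h))) <= K * (4^-1 * (2 * C)).
  rewrite -mulrN ler_pM2l; last by lra.
  apply: le_trans (ler_norm _) _; rewrite normrN normrM.
  apply: ler_pM => //; first by rewrite ger0_norm ?mulr_ge0 //; lra.
  by rewrite normrM (@ger0_norm _ 2) // ler_pM2l.
have h3 : K * a * (3 / 4) <= K * a * D by rewrite ler_pM2l // mulr_gt0; lra.
have h4 : K * a = K * (2 * (2 * C + m + 1)) by rewrite aE.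
have h5 : 0 <= K * C by rewrite mulr_ge0 //; lra.
have h6 : 0 <= K * m by rewrite mulr_ge0 //; lra.
have -> : K * (h - a * (2 * g * h + 2 * D)) + k2 * (2 * n) =
   K * h - K * (a * g * (2 * h)) - 2 * (K * a * D) + k2 * (2 * n) by ring.
have h7 : K = k2 * (2 * n) + k2 * m + 1 by rewrite KE mulrDr.
move: h3; rewrite h4 => h3; lra.
Qed.

Lemma cvg_within (R : realType) (N : nat) (O : set 'rV[R]_N) (f : 'rV[R]_N -> R)
    (z : 'rV[R]_N) (l : R) :
  (forall e, 0 < e -> exists2 d, 0 < d &
     forall x, O x -> enorm (x - z) < d -> `|f x - l| < e) ->
  f @ within O (nbhs z) --> l.
Proof.
move=> H; apply/cvgrPdist_lt => e /H[d d0 dP]; rewrite near_withinE.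
by apply/nbhs_eball; exists d => // x xz Ox; rewrite distrC; exact: dP.
Qed.

Section BoundaryBarrier.
Variables (R : realType) (N : nat).
Local Notation V := 'rV[R]_N.
Implicit Types (x y z : V).

(** The local function [v] vanishes at [z], while its term [k2 |x - z|^2] lifts it above [W] on a
    shell. The minimum of the two is therefore a global supersolution that tends to 0 at [z] and is
    still [W] at distance [rad]. *)
Lemma boundary_barrier (O : set V) (nrm : V -> V) (c W : V -> R) z (rad m M : R) :
  open O -> C2_boundary_with_normal O nrm -> bdry O z -> 0 < rad ->
  (forall x, enorm (x - z) < rad -> `|c x| <= m) ->
  (forall x, O x -> enorm (x - z) < rad -> W x <= M) ->
  (forall x, O x -> {for x, continuous c}) ->
  dsuper O c W -> (forall x, O x -> {for x, continuous W}) ->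
  (forall x, O x -> 0 <= W x) ->
  exists S : V -> R, [/\ dsuper O c S, forall x, O x -> {for x, continuous S},
    forall x, O x -> 0 <= S x, forall x, rad <= enorm (x - z) -> S x = W x &
    forall e, 0 < e -> exists2 d, 0 < d &
      forall x, O x -> enorm (x - z) < d -> S x < e].
Proof.
move=> oO C2 zO rad0 cm WM cc Wsup Wc W0.
have [r [G [d [H [r0 GJ GO G0 d1]]]]] := defining_function oO C2 zO.
have zc : cube z r z by exact: cube_center.
have [Gc Gd GH] := GJ _ zc.
have m0 : 0 <= m by apply: le_trans (cm z _); rewrite ?subrr ?enorm0.
pose C := `|\sum_i H i i z| + 1.
have C0 : 0 <= C by rewrite addr_ge0.
pose a := 2 * (2 * C + m + 1).
have a0 : 0 < (4 * a)^-1 by rewrite invr_gt0 mulr_gt0 // /a mulr_gt0 //; lra.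
have near_z : \forall x \near z, [/\ cube z r x, `|\sum_i H i i x| <= C,
    3 / 4 <= \sum_i d i x ^+ 2 & `|G x| < (4 * a)^-1].
  have n1 := cube_nbhs z r0.
  have n2 : \forall x \near z, `|\sum_i H i i x| <= C.
    have /continuous_cube /(_ 1 ltr01) [e e0 eP] :
      {for z, continuous (fun x => \sum_i H i i x)}.
      by apply: continuous_bigsum => i; have [] := GH i i.
    apply/nbhs_cube; exists e => // x /eP /= Hx.
    have := ler_normD (\sum_i H i i x - \sum_i H i i z) (\sum_i H i i z).
    by rewrite subrK /C => /le_trans; apply; rewrite addrC lerD2l ltW.
  have n3 : \forall x \near z, 3 / 4 <= \sum_i d i x ^+ 2.
    have /continuous_cube /(_ 4^-1) [|e e0 eP] :
      {for z, continuous (fun x => \sum_i d i x ^+ 2)}.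
    - apply: continuous_bigsum => i; have [dc _] := Gd i.
      exact: (continuous_mul dc dc).
    - by rewrite invr_gt0.
    apply/nbhs_cube; exists e => // x /eP /=.
    by rewrite d1 ltr_norml => /andP[]; lra.
  have n4 : \forall x \near z, `|G x| < (4 * a)^-1.
    have /continuous_cube /(_ _ a0) [e e0 eP] := Gc.
    by apply/nbhs_cube; exists e => // x /eP; rewrite G0 subr0.
  by apply: filterS (filterI n1 (filterI n2 (filterI n3 n4))) => x [? [? []]].
have /nbhs_eball[t0 t00 t0P] := near_z.
pose t := Num.min t0 (Num.min rad 1).
have tp : 0 < t by rewrite !lt_min t00 rad0 ltr01.
have trad : t <= rad by rewrite !ge_min lexx !orbT.
have tt0 : t <= t0 by rewrite ge_min lexx.
have t1 : t <= 1 by rewrite !ge_min lexx !orbT.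
(* On the inner radius of the shell, [k2 (t / 2)^2 = |M|], which dominates [W]. *)
pose k2 := 4 * `|M| / t ^+ 2.
have k20 : 0 <= k2 by apply: divr_ge0; [exact: mulr_ge0|exact: sqr_ge0].
pose K := k2 * (2 * N%:R + m) + 1.
pose v x := K * (G x + - a * (G x * G x)) + k2 * dot (x - z) (x - z).
have vJ0 := jet2_add
  (jet2_mul (@jet2_cst R N (cube z r) K)
    (jet2_add GJ (jet2_mul (@jet2_cst R N (cube z r) (- a)) (jet2_mul GJ GJ))))
  (jet2_mul (@jet2_cst R N (cube z r) k2) (@jet2_dist2 R N (cube z r) z)).
have [vc _ _] := vJ0 _ zc.
have sE x : dot (x - z) (x - z) = enorm (x - z) ^+ 2 by rewrite sqr_enorm.
have loc x : O x -> enorm (x - z) < t -> [/\ cube z r x, 0 <= v x & locally_super c v x].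
  move=> Ox xt.
  have [xc HC dC Ga] := t0P _ (lt_le_trans xt tt0).
  have Gp : 0 < G x by apply/GO.
  have s1 : dot (x - z) (x - z) <= 1.
    by rewrite sE -(expr1n R 2) lerXn2r ?nnegrE ?enorm_ge0 //; lra.
  have cx : `|c x| <= m by apply: cm; exact: lt_le_trans trad.
  rewrite gtr0_norm // in Ga.
  have [v0 vL] := barrier_inequality (n := N%:R) m0 C0 k20 (ler0n _ _) cx HC
    (erefl a) (erefl K) (ltW Gp) (ltW Ga) dC (dot_ge0 _) s1.
  have vE : K * (G x - a * G x ^+ 2) + k2 * dot (x - z) (x - z) = v x by rewrite /v; ring.
  rewrite vE in v0 vL.
  split => //.
  apply: (dsuper_strict (@cube_is_open R N z r) vJ0 xc (cc _ Ox)).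
  apply: le_lt_trans vL; rewrite le_eqVlt; apply/orP; left; apply/eqP.
  rewrite (eq_bigr (fun i => (K * H i i x - K * a * 2 * G x * H i i x)
     - K * a * 2 * d i x ^+ 2 + k2 * 2)); last first.
    by move=> i _; rewrite eqxx mulr1n; ring.
  rewrite big_split /= !sumrB -!mulr_sumr sumr_const card_ord -[_ *+ N]mulr_natl; ring.
have shell x : O x -> t / 2 < enorm (x - z) < t -> W x <= v x.
  move=> Ox /andP[xt1 xt].
  have [xc HC dC Ga] := t0P _ (lt_le_trans xt tt0).
  have Gp : 0 < G x by apply/GO.
  rewrite gtr0_norm // in Ga.
  have := WM _ Ox (lt_le_trans xt trad) => /le_trans; apply.
  have K1 : 1 <= K by rewrite /K lerDr mulr_ge0 // addr_ge0 ?mulr_ge0.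
  have aa : 0 < a by rewrite /a; lra.
  have aG : a * G x <= 1.
    have : a * G x <= a * (4 * a)^-1 by rewrite ler_pM2l // ltW.
    by rewrite invfM mulrCA divff ?gt_eqF // mulr1; lra.
  have g0 : 0 <= K * (G x + - a * (G x * G x)).
    rewrite mulr_ge0 //; first by lra.
    have : (a * G x) * G x <= 1 * G x by rewrite ler_pM2r.
    by lra.
  have Mk : M <= k2 * (t / 2) ^+ 2.
    rewrite /k2 expr_div_n mulrA divfK ?expf_neq0 ?gt_eqF //.
    have := ler_norm M; lra.
  apply: le_trans Mk _; rewrite /v.
  have : k2 * (t / 2) ^+ 2 <= k2 * dot (x - z) (x - z).
    by rewrite ler_wpM2l // sE lerXn2r ?nnegrE ?enorm_ge0 ?divr_ge0 ?ltW.
  by lra.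
have tlt : t / 2 < t by lra.
exists (glue z t v W); split.
- by apply: glue_super oO tlt _ Wsup shell => x Ox xt; have [] := loc _ Ox xt.
- apply: glue_continuous oO tlt _ Wc shell => x Ox xt.
  by have [/vJ0[]] := loc _ Ox xt.
- move=> x Ox; rewrite /glue; case: ifP => xt; last exact: W0.
  by rewrite le_min W0 // andbT; have [] := loc _ Ox xt.
- by move=> x xr; rewrite /glue ltNge (le_trans trad xr).
- move=> e e0; have /continuous_eball /(_ _ e0) [d' d'0 d'P] := vc.
  exists (Num.min d' t); first by rewrite lt_min d'0.
  move=> x Ox; rewrite lt_min => /andP[xd xt]; rewrite /glue xt.
  have vz : v z = 0.
    rewrite /v subrr G0 !mulr0 addr0 mulr0 add0r /dot big1 ?mulr0 // => i _.
    by rewrite mxE mul0r.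
  have vx : `|v x - v z| < e by exact: d'P.
  rewrite vz subr0 in vx.
  apply: le_lt_trans (_ : Num.min (v x) (W x) <= v x) _; first by rewrite ge_min lexx.
  exact: le_lt_trans (ler_norm _) vx.
Qed.

End BoundaryBarrier.

(** * Existence and asymptotics *)

(** Here [u], [w], [x] are the residuals of [u0], the corrector and the cutoff. As [Q >= 1], the
    multiple [k] of [w] pays for the bounded negative residual of the cutoff. *)
Lemma cutoff_balance (R : realType) (Q u w x La M k : R) :
  1 <= Q -> - (Q / 4) <= u -> Q / 2 <= w -> - M <= x -> 0 <= La -> 0 <= M ->
  k = 1 + 4 * (La * M) -> 0 < u + k * w + La * x.
Proof.
move=> Q1 uQ wQ xM L0 M0 kE.
have LM : 0 <= La * M by exact: mulr_ge0.
have kw : k * (Q / 2) <= k * w by rewrite ler_pM2l //; lra.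
have Lx : - (La * M) <= La * x by rewrite -mulrN ler_wpM2l.
have LQ : La * M * 1 <= La * M * Q by rewrite ler_wpM2l.
move: kw; rewrite kE; lra.
Qed.

(** Two relative errors of size [e / 4] are compounded, one from [G] against [rho] and one from the
    lower-order profile; for [e < 1] both [(1 + e/4)^2] and [(1 - e/4)^2] are within [e] of 1. *)
Lemma ratio_bound (R : realType) (phi g p0 p1 rh k e1 e2 e : R) :
  0 < g -> 0 < p0 -> 0 <= k -> 0 < e < 1 -> e1 = e / 4 -> k * e2 <= e / 4 -> 0 <= k * e2 ->
  p1 <= e2 * p0 -> g * p0 - k * (g * p1) <= phi -> phi <= g * p0 + k * (g * p1) ->
  (1 - e1) * rh <= g -> g <= (1 + e1) * rh ->
  `|phi / (rh * p0) - 1| < e.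
Proof.
move=> g0 p00 k0 /andP[e0 elt] e1E ke ke0 p1e lo up r1 r2.
have rh0 : 0 < rh.
  rewrite ltNge; apply/negP => rhn.
  have : (1 + e1) * rh <= 0 by rewrite mulr_ge0_le0 //; lra.
  by lra.
have P0 : 0 < rh * p0 by rewrite mulr_gt0.
have kp : k * (g * p1) <= e / 4 * (g * p0).
  have -> : k * (g * p1) = k * g * p1 by ring.
  apply: (@le_trans _ _ (k * g * (e2 * p0))).
    by rewrite ler_wpM2l // mulr_ge0 // ltW.
  rewrite (_ : k * g * (e2 * p0) = k * e2 * (g * p0)); last by ring.
  by rewrite ler_wpM2r // mulr_ge0 ?ltW.
have gl : (1 - e / 4) * (rh * p0) <= g * p0 by rewrite mulrA ler_pM2r // -e1E.
have gu : g * p0 <= (1 + e / 4) * (rh * p0) by rewrite mulrA ler_pM2r // -e1E.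
have -> : phi / (rh * p0) - 1 = (phi - rh * p0) / (rh * p0).
  by field; rewrite !gt_eqF.
rewrite normrM normfV (gtr0_norm P0) ltr_pdivrMr // ltr_norml.
move: (g * p0) (rh * p0) (k * (g * p1)) P0 kp gl gu lo up => X Y Z Y0 kp gl gu lo up.
have eY : 0 < e * Y by rewrite mulr_gt0.
have H1 : (1 - e / 4) * X <= phi by lra.
have H2 : phi <= (1 + e / 4) * X by lra.
have H3 : (1 - e / 4) * ((1 - e / 4) * Y) <= (1 - e / 4) * X by rewrite ler_wpM2l //; lra.
have H4 : (1 + e / 4) * X <= (1 + e / 4) * ((1 + e / 4) * Y) by rewrite ler_wpM2l //; lra.
have eeY : e * (e * Y) <= 1 * (e * Y) by rewrite ler_wpM2r // ltW.
have eeY0 : 0 <= e * (e * Y) by rewrite mulr_ge0 // ltW.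
by apply/andP; split; lra.
Qed.

Section Core.
Variables (R : realType) (N : nat) (mu sigma b tau0 S0 a0 a1 kap : R).
Local Notation V := 'rV[R]_N.
Local Notation tau := (tau tau0).
Local Notation prof := (prof tau0).
Hypotheses (muE : mu = 4 * b ^+ 2 + 2 * N%:R * b)
  (bE : 4 * b + N%:R = - 2 * sigma) (S00 : 0 < S0)
  (tau1 : forall s, 0 < s -> s <= S0 -> 1 <= tau s)
  (a0E : forall s, 0 < s -> s <= S0 -> a0 * (sigma * tau s + a0 - 1) = 0)
  (a1E : forall s, 0 < s -> s <= S0 -> kap <= - 4 * a1 * (sigma * tau s + a1 - 1))
  (kap0 : 0 < kap) (a01 : `|a0| <= 1) (a11 : `|a1| <= 1)
  (a10 : a1 < a0) (a0a1 : a0 <= a1 + 1) (b0 : b <= 0).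
Variables (O : set V) (nrm : V -> V) (i0 : 'I_N).
Hypotheses (oO : open O) (cO : connected O) (C2 : C2_boundary_with_normal O nrm)
  (bO : bdry O 0) (Opos : forall x, O x -> 0 < x ord0 i0)
  (OS : forall x, O x -> dot x x <= S0).
Implicit Types x y : V.
Local Notation c := (pot mu).

Let O0 x : O x -> x != 0.
Proof. by move=> /Opos; apply: contraTneq => ->; rewrite mxE ltxx. Qed.

Let Os x : O x -> 0 < dot x x /\ dot x x <= S0.
Proof. by move=> Ox; split; [apply: dot_gt0; exact: O0|exact: OS]. Qed.

Let Ppos p a x : O x -> 0 < prof p a (dot x x).
Proof.
move=> /Os[s0 s1]; apply: prof_gt0 => //; have := tau1 s0 s1.
exact: lt_le_trans.
Qed.

Let c_cont x : O x -> {for x, continuous c}.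
Proof. by move=> /O0; exact: potential_continuous. Qed.

(** The first summand is an exact solution and the second makes the inequality strict. The factor 2
    matches [G <= 2 x_N], which puts [u0] below [Wbar]. *)
Definition Wbar x := 2 * (x ord0 i0 * prof b a0 (dot x x) + x ord0 i0 * prof b a1 (dot x x)).

(* [x_N] is positive on [O], harmonic and homogeneous of degree 1. *)
Lemma Wbar_super : dsuper O c Wbar /\ forall x, O x -> {for x, continuous Wbar}.
Proof.
have [d1 [H1 [J1 E1]]] := solution_jet muE bE tau1 a0 (@jet2_coord R N O i0) Os.
have [d2 [H2 [J2 E2]]] := solution_jet muE bE tau1 a1 (@jet2_coord R N O i0) Os.
have J := jet2_mul (@jet2_cst R N O 2) (jet2_add J1 J2).
have xd x : \sum_i x ord0 i * (i0 == i)%:R - x ord0 i0 = 0.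
  rewrite (bigD1 i0) //= eqxx mulr1 big1 ?addr0 ?subrr // => i ii.
  by rewrite eq_sym (negbTE ii) mulr0.
split; last by move=> x /J[].
move=> x Ox; apply: (dsuper_strict oO J Ox (c_cont Ox)).
have [s0 s1] := Os Ox.
have L1 := E1 _ Ox; have L2 := E2 _ Ox.
rewrite /= xd [X in prof b a0 (dot x x) * X]big1 // !mulr0 !subr0 in L1.
rewrite /= xd [X in prof b a1 (dot x x) * X]big1 // !mulr0 !subr0 in L2.
have L10 : x ord0 i0 * (- 4 * a0 * (sigma * tau (dot x x) + a0 - 1) *
    prof (b - 1) (a0 - 2) (dot x x)) = 0.
  by rewrite -[- 4 * a0 * _]mulrA a0E // mulr0 mul0r mulr0.
rewrite L10 in L1.
have : 0 < x ord0 i0 * (- 4 * a1 * (sigma * tau (dot x x) + a1 - 1) *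
    prof (b - 1) (a1 - 2) (dot x x)).
  apply: mulr_gt0; first exact: Opos.
  by apply: mulr_gt0; [exact: lt_le_trans (a1E s0 s1)|exact: Ppos].
rewrite -L2 => L.
rewrite (eq_bigr (fun i => 2 * (H1 i i x + H2 i i x))); last by move=> i _; ring.
rewrite -mulr_sumr big_split /= /Wbar -subr_gt0.
rewrite [ltRHS](_ : _ = 2 * ((c x * (x ord0 i0 * prof b a0 (dot x x)) - \sum_i H1 i i x) +
   (c x * (x ord0 i0 * prof b a1 (dot x x)) - \sum_i H2 i i x))); last by ring.
by rewrite L1 add0r mulr_gt0.
Qed.

Lemma Wbar_ge x : O x -> 2 * (x ord0 i0 * prof b a0 (dot x x)) <= Wbar x.
Proof.
move=> Ox; rewrite /Wbar ler_pM2l // lerDl mulr_ge0 // ltW ?Opos //.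
exact: Ppos.
Qed.

Lemma Wbar_gt0 x : O x -> 0 < Wbar x.
Proof.
move=> Ox; apply: lt_le_trans (Wbar_ge Ox).
by apply: mulr_gt0 => //; apply: mulr_gt0; [exact: Opos|exact: Ppos].
Qed.

Lemma Wbar_le x s : O x -> 0 < s -> s <= dot x x ->
  Wbar x <= 4 * ((S0 + 1) * prof b 1 s).
Proof.
move=> Ox s0 sx; have [x0 x1] := Os Ox; have t1 := tau1 x0 x1.
have [_ a01'] := ler_normlP _ _ a01; have [_ a11'] := ler_normlP _ _ a11.
have P0 := prof_antimono b0 a01' s0 sx t1.
have P1 := prof_antimono b0 a11' s0 sx t1.
have xi : x ord0 i0 <= S0 + 1.
  apply: le_trans (ler_norm _) _; apply: le_trans (coord_enorm _ _) _.
  have := sqr_ge0 (enorm x - 1); rewrite -sqr_enorm in x1 *.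
  have := S00; nra.
have X := Opos Ox.
have K a : prof b a (dot x x) <= prof b 1 s ->
    x ord0 i0 * prof b a (dot x x) <= (S0 + 1) * prof b 1 s.
  by move=> Pa; apply: ler_pM => //; apply: ltW => //; exact: Ppos.
have := K _ P0; have := K _ P1; rewrite /Wbar; lra.
Qed.

Local Notation q := (b - 4^-1).

Lemma near_package : exists rad G dU HU dW HW, let U := O `&` eball 0 rad in
  let u0 := fun x => G x * prof b a0 (dot x x) in
  let w := fun x => G x * prof b a1 (dot x x) + - 1 * (G x * G x * prof q 0 (dot x x)) in
  [/\ 0 < rad /\ rad <= 1, jet2 U u0 dU HU /\ jet2 U w dW HW,
    forall x, U x -> `|c x * u0 x - \sum_i HU i i x| <= prof q 0 (dot x x) / 4 /\
       prof q 0 (dot x x) / 2 <= c x * w x - \sum_i HW i i x,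
    forall x, U x -> G x * prof b a1 (dot x x) / 2 <= w x <= G x * prof b a1 (dot x x) /\
       0 < G x <= 2 * x ord0 i0 &
    (forall z, bdry O z -> enorm z < rad -> forall e, 0 < e ->
       exists2 d, 0 < d & forall x, enorm (x - z) < d -> G x < e) /\
    (forall e, 0 < e < 1 -> exists2 a, 0 < a & forall x, O x -> enorm x < a ->
       (1 - e) * rho O x <= G x <= (1 + e) * rho O x)].
Proof.
have [r [G [d [H [C [r0 C0 GJ GO [Gb Gr]]]]]]] := origin_chart oO C2 bO.
have h01 : 0 < (2^-1 : R) < 1 by apply/andP; split; lra.
have [a /andP[a_gt0 ar] aP] := Gr _ h01.
pose r' := Num.min a 1.
have r'0 : 0 < r' by rewrite lt_min a_gt0 ltr01.
have r'a : r' <= a by rewrite ge_min lexx.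
have r'1 : r' <= 1 by rewrite ge_min lexx orbT.
have sub : cube (0 : V) r' `<=` cube 0 r by apply: subset_cube; exact: le_trans r'a ar.
have [rad [dU [HU [dW [HW]]]]] := local_barriers muE bE S00 tau1 a0E a1E kap0 a01 a11
  r'0 C0 (jet2_sub sub GJ) O0 (fun x xr => GO x (sub x xr)) (fun x xr => Gb x (sub x xr)).
move=> [[rad0 radr] _ [JU JW] HL HW'].
exists rad, G, dU, HU, dW, HW; split.
- by split=> //; exact: le_trans radr r'1.
- by [].
- by move=> x Ux; split; [exact: HL|have [] := HW' _ Ux].
- move=> x Ux; have [_ ->] := HW' _ Ux; split => //; have [Ox xr] := Ux.
  have xa : cube 0 a x.
    apply: eball_cube; move: xr; rewrite /eball /= => /lt_le_trans; apply.
    exact: le_trans radr r'a.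
  apply/andP; split; first by apply/GO => //; apply: subset_cube xa.
  have /andP[_ /le_trans] := aP _ Ox xa; apply.
  (* The projection of [x] to the hyperplane [x_N = 0] lies outside [O], so [rho <= x_N]; together
     with [G <= 3/2 rho] this gives [G <= 2 x_N]. *)
  have nO : ~ O (x + (- x ord0 i0) *: evec R i0).
    by move=> /Opos; rewrite shiftE eqxx mulr1 subrr ltxx.
  have := rho_le oO Ox nO.
  rewrite opprD addrA subrr add0r scaleNr opprK enormZ.
  have -> : enorm (evec R i0) = 1.
    rewrite /enorm /dot (bigD1 i0) //= evecE eqxx mulr1 big1 ?addr0 ?sqrtr1 // => i ii.
    by rewrite evecE (negbTE ii) mul0r.
  rewrite mulr1 gtr0_norm ?Opos // => H1.
  have := Opos Ox; lra.
- split.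
    move=> z zO zr e e0.
    have zc : cube 0 r z.
      apply: sub; apply: eball_cube; rewrite subr0; exact: lt_le_trans zr radr.
    have Gz : G z <= 0.
      rewrite leNgt; apply/negP => Gz; apply: (bdry_notin oO zO); exact/GO.
    have [/continuous_eball /(_ e e0) [t t0 tP] _ _] := GJ _ zc.
    exists t => // x /tP; rewrite ltr_norml => /andP[_]; lra.
  move=> e /Gr[t /andP[t0 _] tP]; exists t => // x Ox xt; apply: tP => //.
  by apply: eball_cube; rewrite subr0.
Qed.

(** * From local barriers to global sub- and supersolutions *)

Section NearOrigin.
Variables (rad : R) (G : V -> R) (dU dW : 'I_N -> V -> R) (HU HW : 'I_N -> 'I_N -> V -> R).
Let U := O `&` eball 0 rad.
Let u0 x := G x * prof b a0 (dot x x).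
Let w x := G x * prof b a1 (dot x x) + - 1 * (G x * G x * prof q 0 (dot x x)).
Hypotheses (rad0 : 0 < rad) (rad1 : rad <= 1)
  (JU : jet2 U u0 dU HU) (JW : jet2 U w dW HW)
  (LU : forall x, U x -> `|c x * u0 x - \sum_i HU i i x| <= prof q 0 (dot x x) / 4)
  (LW : forall x, U x -> prof q 0 (dot x x) / 2 <= c x * w x - \sum_i HW i i x)
  (wb : forall x, U x -> G x * prof b a1 (dot x x) / 2 <= w x <= G x * prof b a1 (dot x x))
  (Gb : forall x, U x -> 0 < G x <= 2 * x ord0 i0).

Let Uopen : open U.
Proof.
apply: openI => //; rewrite openE => x xr.
have : -1 < enorm (x - 0) < rad.
  by apply/andP; split; [apply: lt_le_trans (enorm_ge0 _); lra|exact: xr].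
by move=> /dist_near; apply: filterS => y /andP[].
Qed.

Let Uin x : O x -> enorm x < rad -> U x.
Proof. by move=> Ox xr; split => //; rewrite /eball /= subr0. Qed.

Let rad8 : 0 < (rad / 8) ^+ 2.
Proof. by rewrite exprn_gt0 // divr_gt0. Qed.

Let rad4 : rad / 4 < rad.
Proof. by rewrite ltr_pdivrMr // ltr_pMr // ltr1n. Qed.

(** Large enough that [u0 <= kapA w] on the shell [rad / 8 < |x| < rad / 4]: there [a0 <= a1 + 1]
    costs one factor [tau], and [w] is at least half of its first term. *)
Definition kapA := 2 * `|tau ((rad / 8) ^+ 2)| + 1.
(** The maximum of [u0 - kapA w] and 0, continued by 0; it is written as the negative of a minimum
    so that the gluing of supersolutions applies. *)
Definition Asub x := - glue 0 (rad / 4) (fun y => kapA * w y + - 1 * u0 y) (fun=> 0) x.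

Let kapA1 : 1 <= kapA.
Proof. by rewrite /kapA lerDr mulr_ge0. Qed.

Let w_gt0 x : U x -> 0 < w x.
Proof.
move=> Ux; have /andP[+ _] := wb Ux; apply: lt_le_trans.
have /andP[G0 _] := Gb Ux; rewrite divr_gt0 //; apply: mulr_gt0 => //.
by apply: Ppos; case: Ux.
Qed.

Let u0_gt0 x : U x -> 0 < u0 x.
Proof.
move=> Ux; have /andP[G0 _] := Gb Ux; apply: mulr_gt0 => //.
by apply: Ppos; case: Ux.
Qed.

Let A_shell x : O x -> rad / 8 < enorm (x - 0) < rad / 4 ->
  0 <= kapA * w x + - 1 * u0 x.
Proof.
move=> Ox; rewrite subr0 => /andP[x1 x2].
have Ux : U x by apply: Uin => //; exact: lt_trans x2 rad4.
have [s0 sS] := Os Ox; have t1 := tau1 s0 sS.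
have /andP[w1 _] := wb Ux; have /andP[G0 _] := Gb Ux.
have ts : tau (dot x x) <= `|tau ((rad / 8) ^+ 2)|.
  apply: le_trans (ler_norm _); rewrite /tau lerD2l lerN2 ler_ln ?posrE //.
  by rewrite -sqr_enorm lerXn2r ?nnegrE ?enorm_ge0 ?divr_ge0 ?ltW.
have P1 := Ppos b a1 Ox.
have P0 : prof b a0 (dot x x) <= tau (dot x x) * prof b a1 (dot x x).
  have -> : tau (dot x x) * prof b a1 (dot x x) = prof b (a1 + 1) (dot x x).
    by rewrite -[in LHS](addrK 1 a1) prof_tau //; exact: lt_le_trans t1.
  exact: prof_le.
have K1 : u0 x <= `|tau ((rad / 8) ^+ 2)| * (G x * prof b a1 (dot x x)).
  rewrite mulrCA ler_pM2l //; apply: le_trans P0 _; by rewrite ler_pM2r.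
have K2 : `|tau ((rad / 8) ^+ 2)| * (G x * prof b a1 (dot x x)) <=
   `|tau ((rad / 8) ^+ 2)| * (2 * w x).
  by rewrite ler_wpM2l //; lra.
rewrite mulN1r subr_ge0; apply: le_trans K1 _; apply: le_trans K2 _.
by rewrite /kapA mulrDl mul1r; have := ltW (w_gt0 Ux); lra.
Qed.

Let A_glue : dsuper O c (fun x => - Asub x) /\
  forall x, O x -> {for x, continuous Asub}.
Proof.
have lt48 : rad / 8 < rad / 4 by have := rad0; lra.
have U4 x : O x -> enorm (x - 0) < rad / 4 -> U x.
  by move=> Ox; rewrite subr0 => x2; apply: Uin => //; exact: lt_trans x2 rad4.
have J := jet2_add (jet2_mul (@jet2_cst R N U kapA) JW) (jet2_mul (@jet2_cst R N U (- 1)) JU).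
have E : (fun x => - Asub x) = glue 0 (rad / 4) (fun y => kapA * w y + - 1 * u0 y) (fun=> 0).
  by apply/funext => x; rewrite /Asub opprK.
split.
  rewrite E; apply: (glue_super oO lt48) => [x Ox x4|x Ox|]; last exact: A_shell.
    have Ux := U4 _ Ox x4.
    apply: (dsuper_strict Uopen J Ux (c_cont Ox)).
    rewrite (eq_bigr (fun i => kapA * HW i i x - HU i i x)); last by move=> i _; ring.
    rewrite sumrB -mulr_sumr -subr_gt0.
    have := LU Ux; rewrite ler_norml => /andP[_ L1]; have L2 := LW Ux.
    have Q0 := Ppos q 0 Ox.
    have L3 : kapA * (prof q 0 (dot x x) / 2) <= kapA * (c x * w x - \sum_i HW i i x).
      by rewrite ler_pM2l //; exact: lt_le_trans kapA1.
    have L4 : 1 * (prof q 0 (dot x x) / 2) <= kapA * (prof q 0 (dot x x) / 2).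
      by rewrite ler_pM2r // divr_gt0.
    rewrite mulN1r; lra.
  exists 1 => // y h _ _ _; rewrite mulr0 /lapd big1 ?mul0r // => i _.
  by rewrite /sdiff; ring.
move=> x Ox; apply: continuousN.
apply: (glue_continuous oO lt48 _ _ A_shell) => // [y Oy y4|y Oy].
  by have [] := J _ (U4 _ Oy y4).
exact: continuous_cst.
Qed.

Lemma Asub_sub : dsub O c Asub.
Proof. by move=> x Ox; apply/locally_superN; exact: A_glue.1. Qed.

Lemma Asub_cont x : O x -> {for x, continuous Asub}.
Proof. exact: A_glue.2. Qed.

Lemma Asub_ge0 x : O x -> 0 <= Asub x.
Proof.
move=> Ox; rewrite /Asub oppr_ge0 /glue; case: ifP => // _.
by rewrite ge_min lexx orbT.
Qed.

Lemma Asub_out x : rad / 4 <= enorm x -> Asub x = 0.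
Proof. by move=> xr; rewrite /Asub /glue subr0 ltNge xr oppr0. Qed.

Lemma Asub_near x : O x -> enorm x < rad / 4 -> u0 x - kapA * w x <= Asub x.
Proof.
move=> Ox xr; rewrite /Asub /glue subr0 xr lerNr.
by rewrite ge_min; apply/orP; left; rewrite mulN1r opprB.
Qed.

Lemma Asub_le x : O x -> U x -> Asub x <= u0 x.
Proof.
move=> Ox Ux; rewrite /Asub /glue; case: ifP => _; last by rewrite oppr0 ltW // u0_gt0.
rewrite lerNl le_min; apply/andP; split; last by rewrite oppr_le0 ltW // u0_gt0.
rewrite mulN1r lerDr mulr_ge0 //; last by rewrite ltW // w_gt0.
exact: le_trans ler01 kapA1.
Qed.

Lemma u0_W x : U x -> u0 x <= Wbar x.
Proof.
move=> Ux; have [Ox _] := Ux; apply: le_trans _ (Wbar_ge Ox).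
have /andP[_ G2] := Gb Ux; rewrite mulrA ler_pM2r //; exact: Ppos.
Qed.

Lemma Asub_W x : O x -> Asub x <= Wbar x.
Proof.
move=> Ox; case: (ltP (enorm x) (rad / 4)) => xr; last first.
  by rewrite Asub_out // ltW // Wbar_gt0.
have Ux : U x by apply: Uin => //; exact: lt_trans xr rad4.
exact: le_trans (Asub_le Ox Ux) (u0_W Ux).
Qed.

(** Where the cutoff is not zero, [s >= s1] bounds the potential by [|mu| / s1]; the numbers 24 and
    6 are the derivative terms estimated with [s] and [p] at most 1. *)
Lemma cutoff_lower (s s1 p : R) (n : nat) : 0 < s1 -> 0 < s -> s <= 1 ->
  (s1 <= s /\ p = s - s1) \/ (s < s1 /\ p = 0) ->
  - (24 + 6 * n%:R + `|mu| / s1) <=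
    mu / s * p ^+ 3 - (4 * s * (6 * p) + 2 * n%:R * (3 * p ^+ 2)).
Proof.
move=> s10 s0 s1' H; have n0 : 0 <= n%:R :> R by [].
have M0 : 0 <= `|mu| / s1 by rewrite divr_ge0 // ltW.
case: H => [[h ->]|[_ ->]]; last first.
  by rewrite !expr0n /= !mulr0 addr0 subr0 oppr_le0 addr_ge0 // addr_ge0 // mulr_ge0.
set p' := s - s1; have p0 : 0 <= p' by rewrite subr_ge0.
have p1 : p' <= 1 by rewrite /p'; lra.
have H1 : `|mu / s * p' ^+ 3| <= `|mu| / s1 * 1.
  rewrite normrM; apply: ler_pM => //.
    rewrite normrM normfV (gtr0_norm s0) ler_wpM2l // lef_pV2 ?posrE //.
  by rewrite ger0_norm ?exprn_ge0 // exprn_ile1.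
have H2 : s * p' <= 1 * 1 by apply: ler_pM => //; exact: ltW.
have H3 : n%:R * p' ^+ 2 <= n%:R * 1 by rewrite ler_wpM2l // exprn_ile1.
move: H1; rewrite ler_norml mulr1 => /andP[H1 _].
lra.
Qed.

(** To be glued to [Wbar], the supersolution [u0 + kB w] must exceed it near [|x| = rad]. A multiple
    of a cutoff achieves this without changing the function near 0, at the price of a larger
    [kB]. *)
Lemma upper_barrier : exists kB S, [/\ 0 <= kB, dsuper O c S,
  forall x, O x -> {for x, continuous S}, forall x, O x -> Asub x <= S x &
  forall x, O x -> enorm x < rad / 2 -> S x <= u0 x + kB * w x].
Proof.
pose s1 := (rad / 2) ^+ 2.
have rad2 : 0 < rad / 2 by rewrite divr_gt0.
have s10 : 0 < s1 by rewrite exprn_gt0.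
pose t1 := (3 / 4 * rad) ^+ 2.
have t34 : 0 < 3 / 4 * rad by rewrite mulr_gt0 // divr_gt0.
have t10 : 0 < t1 by rewrite exprn_gt0.
pose h := t1 - s1.
have h0 : 0 < h.
  by rewrite subr_gt0 ltrXn2r ?nnegrE ?ltW // mulrC ltr_pM2r //; lra.
pose Wm := `|4 * ((S0 + 1) * prof b 1 t1)|.
(* The cutoff is at least [h^3] on the outer shell, so [La] times it is at least [Wm], a bound for
   [Wbar] there. *)
pose La := Wm / h ^+ 3.
have La0 : 0 <= La.
  by apply: divr_ge0; [exact: normr_ge0|rewrite exprn_ge0 // ltW].
pose M := 24 + 6 * N%:R + `|mu| / s1.
have M0 : 0 <= M by rewrite !addr_ge0 ?mulr_ge0 // invr_ge0 ltW.
pose kB := 1 + 4 * (La * M).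
have kB0 : 0 <= kB.
  by apply: addr_ge0 => //; apply: mulr_ge0 => //; exact: mulr_ge0.
(* The cutoff vanishes for [|x| < rad / 2] and lifts the local barrier above
   [Wbar] on the shell [3 rad / 4 < |x| < rad]. *)
pose P (t : R) := ppart s1 t ^+ 3.
have PP x : U x -> let s := dot (x - 0) (x - 0) in
    [/\ is_derive s 1 P (3 * ppart s1 s ^+ 2),
        is_derive s 1 (fun t => 3 * ppart s1 t ^+ 2) (6 * ppart s1 s) &
        {for s, continuous (fun t => 6 * ppart s1 t)}].
  by move=> _ s; exact: cutoff_jet.
have [dX [HX [JX EX]]] := jet2_radial (P1 := fun t => 3 * ppart s1 t ^+ 2)
  (P2 := fun t => 6 * ppart s1 t) (@jet2_cst R N U 1) PP.
pose chi x := 1 * P (dot (x - 0) (x - 0)).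
pose B1 x := u0 x + kB * w x + La * chi x.
have JB := jet2_add (jet2_add JU (jet2_mul (@jet2_cst R N U kB) JW))
  (jet2_mul (@jet2_cst R N U La) JX).
have chi0 x : 0 <= chi x by rewrite /chi mul1r exprn_ge0 // ppart_ge0.
have Us x : U x -> 0 < dot x x /\ dot x x <= 1.
  move=> [Ox]; rewrite /eball /= subr0 => xr; have [s0 _] := Os Ox; split => //.
  rewrite -sqr_enorm expr_le1 ?enorm_ge0 //; apply: ltW.
  exact: lt_le_trans xr rad1.
have sup x : O x -> enorm (x - 0) < rad -> locally_super c B1 x.
  rewrite subr0 => Ox xr; have Ux := Uin Ox xr.
  apply: (dsuper_strict Uopen JB Ux (c_cont Ox)).
  rewrite (eq_bigr (fun i => HU i i x + kB * HW i i x + La * HX i i x)); last first.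
    by move=> i _; ring.
  rewrite !big_split /= -!mulr_sumr -subr_gt0.
  rewrite [ltRHS](_ : _ = (c x * u0 x - \sum_i HU i i x) +
     kB * (c x * w x - \sum_i HW i i x) + La * (c x * chi x - \sum_i HX i i x)); last first.
    by rewrite /B1 /chi; ring.
  have := LU Ux; rewrite ler_norml => /andP[L1 _].
  have [s0 sS] := Us _ Ux.
  have Lchi : - M <= c x * chi x - \sum_i HX i i x.
    have := EX _ Ux; rewrite /= subr0 => ->.
    rewrite big1 // [X in 4 * _ * X]big1 => [|i _]; last by rewrite mulr0.
    rewrite !mulr0 !add0r /chi subr0 !mul1r /pot sqr_enorm.
    exact: cutoff_lower s10 s0 sS (ppartP _ _).
  apply: (cutoff_balance _ L1 (LW Ux) Lchi La0 M0) => //.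
  by apply: prof_ge1 => //; rewrite subr_le0 (le_trans b0) // invr_ge0.
have shell x : O x -> 3 / 4 * rad < enorm (x - 0) < rad -> Wbar x <= B1 x.
  rewrite subr0 => Ox /andP[x1 x2]; have Ux := Uin Ox x2.
  have ts : t1 <= dot x x by rewrite -sqr_enorm lerXn2r ?nnegrE ?enorm_ge0 // ltW.
  have W1 : Wbar x <= Wm by apply: le_trans (Wbar_le Ox t10 ts) (ler_norm _).
  have hp : h <= ppart s1 (dot x x).
    case: (ppartP s1 (dot x x)) => [[_ ->]|[sx _]]; first by rewrite lerD2r.
    by move: h0; rewrite /h; lra.
  have chih : h ^+ 3 <= chi x.
    rewrite /chi subr0 mul1r lerXn2r ?nnegrE ?ppart_ge0 //; exact: ltW.
  have : La * h ^+ 3 <= La * chi x by rewrite ler_wpM2l.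
  rewrite /La divfK ?expf_neq0 ?gt_eqF // -/La => K1.
  apply: le_trans W1 _; apply: le_trans K1 _.
  rewrite /B1 lerDr addr_ge0 //; first by rewrite ltW // u0_gt0.
  by rewrite mulr_ge0 // ltW // w_gt0.
have lt34 : 3 / 4 * rad < rad by rewrite gtr_pMl //; lra.
have [Wsup Wcont] := Wbar_super.
exists kB, (glue 0 rad B1 Wbar); split=> //.
- exact: glue_super oO lt34 sup Wsup shell.
- apply: (glue_continuous oO lt34 _ Wcont shell) => x Ox; rewrite subr0 => xr.
  by have [] := JB _ (Uin Ox xr).
- move=> x Ox; rewrite /glue subr0; case: ifP => xr; last exact: Asub_W.
  have Ux := Uin Ox xr.
  rewrite le_min Asub_W // andbT; apply: le_trans (Asub_le Ox Ux) _.
  rewrite /B1 -addrA lerDl addr_ge0 //; last by rewrite mulr_ge0.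
  by rewrite mulr_ge0 // ltW // w_gt0.
- move=> x Ox xr; have xr' : enorm x < rad by apply: lt_trans xr _; rewrite ltr_pdivrMr // ltr_pMr // ltr1n.
  rewrite /glue subr0 xr' ge_min /B1; apply/orP; left.
  rewrite (_ : chi x = 0) ?mulr0 ?addr0 //.
  rewrite /chi subr0 mul1r /P; case: (ppartP s1 (dot x x)) => [[sx _]|[_ ->]].
    have : dot x x < s1 by rewrite -sqr_enorm ltrXn2r ?nnegrE ?enorm_ge0 // ltW.
    by rewrite ltNge sx.
  by rewrite expr0n.
Qed.

Hypotheses
  (Gbd : forall z, bdry O z -> enorm z < rad -> forall e, 0 < e ->
     exists2 d, 0 < d & forall x, enorm (x - z) < d -> G x < e)
  (Gr : forall e, 0 < e < 1 -> exists2 a, 0 < a & forall x, O x -> enorm x < a ->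
     (1 - e) * rho O x <= G x <= (1 + e) * rho O x).

(** For [|z| < rad / 2] the bound [u0 + kB w] tends to 0 at [z] because [G] does. For the other [z]
    the subsolution [Asub] vanishes within [rad / 4] of [z], so a local barrier glued to [Wbar] lies
    above it and minimality applies. *)
Lemma boundary_vanishing phi kB S : (forall x, O x -> 0 <= phi x) -> 0 <= kB ->
  (forall x, O x -> phi x <= S x) ->
  (forall x, O x -> enorm x < rad / 2 -> S x <= u0 x + kB * w x) ->
  (forall S', (forall x, O x -> Asub x <= S' x) -> dsuper O c S' ->
     forall x, O x -> {for x, continuous S'} -> phi x <= S' x) ->
  forall z, bdry O z -> z != 0 -> phi @ within O (nbhs z) --> (0 : R).
Proof.
move=> phi0 kB0 phiS SB phimin z zO z0; apply: cvg_within => e e0.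
have zp := enorm_gt0 z0.
case: (ltP (enorm z) (rad / 2)) => zr.
  pose s' := (enorm z / 2) ^+ 2.
  have z2 : 0 < enorm z / 2 by rewrite divr_gt0.
  have s'0 : 0 < s' by rewrite exprn_gt0.
  pose Pm := (1 + kB) * (`|prof b 1 s'| + 1).
  have Pm0 : 0 < Pm by apply: mulr_gt0; [rewrite ltr_pwDl | rewrite ltr_wpDl].
  have zr' : enorm z < rad by apply: lt_trans zr _; rewrite ltr_pdivrMr // ltr_pMr // ltr1n.
  have [d d0 dP] := Gbd zO zr' (divr_gt0 e0 Pm0).
  exists (Num.min d (Num.min (enorm z / 2) (rad / 2 - enorm z))).
    by rewrite !lt_min d0 z2 subr_gt0.
  move=> x Ox; rewrite !lt_min => /and3P[xd xz xr].
  have T1 := enorm_triangle (x - z) z; rewrite subrK in T1.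
  have T2 := enorm_triangle (z - x) x; rewrite subrK enorm_sym in T2.
  have xr2 : enorm x < rad / 2 by apply: le_lt_trans T1 _; rewrite -ltrBrDr.
  have Ux : U x.
    by apply: Uin => //; apply: lt_trans xr2 _; rewrite ltr_pdivrMr // ltr_pMr // ltr1n.
  have sx : s' <= dot x x.
    rewrite -sqr_enorm lerXn2r ?nnegrE ?enorm_ge0 ?(ltW z2) //.
    rewrite -(lerD2l (enorm z / 2)) -splitr; apply: le_trans T2 _.
    by rewrite lerD2r ltW.
  have [t0 t1] := Os Ox; have tt := tau1 t0 t1.
  have /andP[G0 _] := Gb Ux; have Gx := dP _ xd.
  have Pb a : a <= 1 -> G x * prof b a (dot x x) <= G x * (`|prof b 1 s'| + 1).
    move=> aa; rewrite ler_pM2l //.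
    apply: le_trans (prof_antimono b0 aa s'0 sx tt) _.
    by apply: le_trans (ler_norm _) _; rewrite lerDl.
  have [_ a01'] := ler_normlP _ _ a01; have [_ a11'] := ler_normlP _ _ a11.
  rewrite subr0 ger0_norm ?phi0 //.
  apply: le_lt_trans (phiS _ Ox) _; apply: le_lt_trans (SB _ Ox xr2) _.
  apply: (@le_lt_trans _ _ (G x * Pm)); last by rewrite -ltr_pdivlMr.
  have /andP[_ w2] := wb Ux.
  have K1 : kB * w x <= kB * (G x * (`|prof b 1 s'| + 1)).
    by rewrite ler_wpM2l // (le_trans w2) // Pb.
  rewrite (_ : G x * Pm = G x * (`|prof b 1 s'| + 1) + kB * (G x * (`|prof b 1 s'| + 1))).
    by apply: lerD => //; exact: Pb.
  by rewrite /Pm; ring.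
have rad40 : 0 < rad / 4 by rewrite divr_gt0.
have r42 : rad / 4 + rad / 4 = rad / 2 by field.
have far x : enorm (x - z) < rad / 4 -> rad / 4 < enorm x.
  move=> xz; have := enorm_triangle (z - x) x; rewrite subrK enorm_sym => T.
  rewrite -(ltrD2l (rad / 4)) r42; apply: le_lt_trans zr _; apply: le_lt_trans T _.
  by rewrite ltrD2r.
have s4 : 0 < (rad / 4) ^+ 2 by rewrite exprn_gt0.
have [Wsup Wcont] := Wbar_super.
have cb x : enorm (x - z) < rad / 4 -> `|c x| <= `|mu| / (rad / 4) ^+ 2.
  move=> /far xr; have x0 : 0 < enorm x ^+ 2 by rewrite exprn_gt0 // (lt_trans rad40).
  rewrite /pot normrM normfV (gtr0_norm x0) ler_wpM2l // lef_pV2 ?posrE //.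
  by rewrite lerXn2r ?nnegrE ?enorm_ge0 ?ltW.
have Wb' x : O x -> enorm (x - z) < rad / 4 -> Wbar x <= 4 * ((S0 + 1) * prof b 1 ((rad / 4) ^+ 2)).
  move=> Ox /far xr; apply: Wbar_le => //.
  by rewrite -sqr_enorm lerXn2r ?nnegrE ?enorm_ge0 ?ltW.
have [S' [S'sup S'c S'0 S'W S'lim]] := boundary_barrier oO C2 zO rad40 cb Wb' c_cont Wsup
  Wcont (fun x Ox => ltW (Wbar_gt0 Ox)).
have [d d0 dP] := S'lim e e0.
exists d => // x Ox xd; rewrite subr0 ger0_norm ?phi0 //.
apply: le_lt_trans (dP _ Ox xd); apply: phimin => // [y Oy|]; last exact: S'c.
case: (ltP (enorm (y - z)) (rad / 4)) => yz; last by rewrite S'W // Asub_W.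
by rewrite Asub_out ?S'0 // ltW // far.
Qed.

Lemma core_near : (0 < N)%N -> exists phi d H, [/\ jet2 O phi d H,
  forall x, O x -> 0 < phi x, forall x, O x -> \sum_i H i i x = c x * phi x,
  forall z, bdry O z -> z != 0 -> phi @ within O (nbhs z) --> (0 : R) &
  forall e, 0 < e < 1 -> exists2 t, 0 < t & forall x, O x -> enorm x < t ->
    `|phi x / (rho O x * prof b a0 (dot x x)) - 1| < e].
Proof.
move=> N0.
have [kB [S [kB0 Ssup Scont AS SB]]] := upper_barrier.
have [Wsup Wcont] := Wbar_super.
(* The construction runs between [Asub] and [Wbar]; the sharper [S] and the barriers at other
   boundary points enter afterwards, through minimality. *)
have [phi [d [H [J eq AW phimin]]]] := sub_super_solution N0 oO O0 Asub_cont Wcont Asub_W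
  Asub_sub Wsup.
have phiA x : O x -> Asub x <= phi x by move=> /AW /andP[].
have phiS x : O x -> phi x <= S x by move=> Ox; apply: phimin => //; exact: Scont.
have phi0 x : O x -> 0 <= phi x by move=> Ox; apply: le_trans (Asub_ge0 Ox) (phiA _ Ox).
have r24 : rad / 4 <= rad / 2.
  by rewrite ler_pM2l // lef_pV2 ?posrE // ler_nat.
pose k := Num.max kapA kB.
have kk : 1 <= k by rewrite le_max kapA1.
have k0 : 0 <= k by exact: le_trans kk.
have two x : O x -> enorm x < rad / 4 ->
    G x * prof b a0 (dot x x) - k * (G x * prof b a1 (dot x x)) <= phi x /\
    phi x <= G x * prof b a0 (dot x x) + k * (G x * prof b a1 (dot x x)).
  move=> Ox xr; have Ux : U x by apply: Uin => //; exact: lt_trans xr rad4.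
  have /andP[_ w2] := wb Ux; have w0 := ltW (w_gt0 Ux).
  split.
    apply: le_trans (phiA _ Ox); apply: le_trans _ (Asub_near Ox xr).
    rewrite lerD2l lerN2; apply: (@le_trans _ _ (k * w x)).
      by rewrite ler_wpM2r // le_max lexx.
    by rewrite ler_wpM2l.
  apply: le_trans (phiS _ Ox) _; apply: le_trans (SB _ Ox (lt_le_trans xr r24)) _.
  rewrite lerD2l; apply: (@le_trans _ _ (k * w x)).
    by rewrite ler_wpM2r // le_max lexx orbT.
  by rewrite ler_wpM2l.
have rat e : 0 < e -> exists2 t, 0 < t & forall x, O x -> enorm x < t ->
    prof b a1 (dot x x) <= e * prof b a0 (dot x x).
  move=> e0; have [t t0 tP] := @prof_ratio R b tau0 a1 a0 e a10 e0.
  exists (Num.min 1 t); first by rewrite lt_min ltr01.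
  move=> x Ox; rewrite lt_min => /andP[x1 xt]; have [s0 sS] := Os Ox.
  apply: tP => //; last exact: tau1.
  apply: le_lt_trans xt; rewrite -sqr_enorm expr2 ler_piMr ?enorm_ge0 //.
  exact: ltW.
have pos : forall x, O x -> 0 < phi x.
  apply: (strong_positivity oO cO J eq phi0 c_cont).
  (* With this ratio the correction is at most half of the leading term, so [phi] is positive at
     some point near 0. *)
  have e0 : 0 < (2 * k)^-1 by rewrite invr_gt0 mulr_gt0 // (lt_le_trans ltr01).
  have [t t0 tP] := rat _ e0.
  have m0 : 0 < Num.min t (rad / 4) by rewrite lt_min t0 divr_gt0.
  have [x [Ox]] := bO.1 _ (eball_nbhs 0 m0).
  rewrite /eball /= subr0 lt_min => /andP[xt xr].
  exists x => //; have [lo _] := two _ Ox xr; apply: lt_le_trans lo.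
  have Ux : U x by apply: Uin => //; exact: lt_trans xr rad4.
  have /andP[G0 _] := Gb Ux.
  have P0 := Ppos b a0 Ox.
  have : k * (G x * prof b a1 (dot x x)) <= k * (G x * ((2 * k)^-1 * prof b a0 (dot x x))).
    by rewrite ler_wpM2l // ler_pM2l // tP.
  have -> : k * (G x * ((2 * k)^-1 * prof b a0 (dot x x))) = G x * prof b a0 (dot x x) / 2.
    by field; rewrite gt_eqF // (lt_le_trans ltr01).
  move=> K; rewrite subr_gt0; apply: le_lt_trans K _.
  have X : 0 < G x * prof b a0 (dot x x) by exact: mulr_gt0.
  by rewrite ltr_pdivrMr // ltr_pMr // ltr1n.
exists phi, d, H; split => //.
  exact: boundary_vanishing phi0 kB0 phiS SB phimin.
move=> e /andP[e0 e1].
have e4 : 0 < e / 4 < 1.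
  by rewrite divr_gt0 //= ltr_pdivrMr // mul1r (lt_trans e1) // ltr1n.
have [t1 t10 t1P] := Gr e4.
have kp : 0 < k by exact: lt_le_trans kk.
have e2 : 0 < e / 4 / k by rewrite divr_gt0 //; case/andP: e4.
have [t2 t20 t2P] := rat _ e2.
exists (Num.min t1 (Num.min t2 (rad / 4))); first by rewrite !lt_min t10 t20 divr_gt0.
move=> x Ox; rewrite !lt_min => /and3P[xt1 xt2 xr].
have Ux : U x by apply: Uin => //; exact: lt_trans xr rad4.
have /andP[G0 _] := Gb Ux; have [lo up] := two _ Ox xr.
have /andP[r1 r2] := t1P _ Ox xt1.
have ke : k * (e / 4 / k) = e / 4 by rewrite mulrC divfK // gt_eqF.
apply: (ratio_bound G0 (Ppos b a0 Ox) k0 _ (erefl (e / 4)) _ _ (t2P _ Ox xt2) lo up r1 r2).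
- by rewrite e0.
- by rewrite ke.
- by rewrite ke ltW //; case/andP: e4.
Qed.

End NearOrigin.

Theorem core : (0 < N)%N -> exists phi d H, [/\ jet2 O phi d H,
  forall x, O x -> 0 < phi x, forall x, O x -> \sum_i H i i x = c x * phi x,
  forall z, bdry O z -> z != 0 -> phi @ within O (nbhs z) --> (0 : R) &
  forall e, 0 < e < 1 -> exists2 t, 0 < t & forall x, O x -> enorm x < t ->
    `|phi x / (rho O x * prof b a0 (dot x x)) - 1| < e].
Proof.
move=> N0.
have [rad [G [dU [HU [dW [HW]]]]]] := near_package.
move=> [[r0 r1] [JU JW] L wG [Gb Gr]].
apply: (core_near r0 r1 JU JW _ _ _ _ Gb Gr N0).
- by move=> x /L[].
- by move=> x /L[].
- by move=> x /wG[].
- by move=> x /wG[].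
Qed.

End Core.

(** * Transfer to the stated asymptotic profiles *)

Lemma powR_dot (R : realType) (N : nat) (x : 'rV[R]_N) (p : R) :
  dot x x `^ p = enorm x `^ (2 * p).
Proof. by rewrite powRrM powR_mulrn ?enorm_ge0 // sqr_enorm. Qed.

(** For [r < 1] numerator and denominator differ by the constant [tau0 / 2 - 1], while the
    denominator tends to infinity. *)
Lemma log_profile_ratio (R : realType) (tau0 e : R) : 0 < e ->
  exists2 t, 0 < t & forall r, 0 < r -> r < t ->
    `|2^-1 * (tau0 - 2 * ln r) / (`|ln r| + 1) - 1| < e.
Proof.
move=> e0; pose K := `|tau0 / 2 - 1| / e.
have K0 : 0 <= K by rewrite divr_ge0 // ltW.
exists (expR (- K)); first exact: expR_gt0.
move=> r r0; rewrite -ltr_ln ?posrE ?expR_gt0 // expRK => rK.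
have l0 : ln r < 0 by apply: lt_le_trans rK _; rewrite oppr_le0.
rewrite (ltr0_norm l0).
have l1 : 0 < - ln r + 1 by lra.
have -> : 2^-1 * (tau0 - 2 * ln r) / (- ln r + 1) - 1 = (tau0 / 2 - 1) / (- ln r + 1).
  by field; exact: lt0r_neq0.
rewrite normrM normfV (gtr0_norm l1) ltr_pdivrMr // [ltRHS]mulrC -ltr_pdivrMr // -/K; lra.
Qed.

(** [P] is the profile produced by the construction and [m] the required one; the constant [k] makes
    [k P] asymptotic to [m]. *)
Lemma rescaled_solution (R : realType) (N : nat) (mu k : R) (O : set 'rV[R]_N)
    (P m phi : 'rV[R]_N -> R) d H :
  open O -> 0 < k -> jet2 O phi d H -> (forall x, O x -> 0 < phi x) ->
  (forall x, O x -> \sum_i H i i x = pot mu x * phi x) ->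
  (forall z, bdry O z -> z != 0 -> phi @ within O (nbhs z) --> (0 : R)) ->
  (forall x, O x -> P x != 0) ->
  (forall e, 0 < e < 1 -> exists2 t, 0 < t & forall x, O x -> enorm x < t ->
    `|phi x / (rho O x * P x) - 1| < e) ->
  (forall e, 0 < e -> exists2 t, 0 < t & forall x, O x -> enorm x < t ->
    `|k * P x / m x - 1| < e) ->
  let psi x := k * phi x in
  [/\ C2_on O psi, forall x, O x -> 0 < psi x,
    forall x, O x -> - lap psi x + mu / (enorm x ^+ 2) * psi x = 0,
    forall z, bdry O z -> z != 0 -> psi @ within O (nbhs z) --> (0 : R) &
    (fun x => psi x / (rho O x * m x)) @ within O (nbhs (0 : 'rV[R]_N)) --> (1 : R)].
Proof.
move=> oO k0 J pos eq bd P0 lim1 lim2 psi.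
have [C2 lapE] := jet2_C2 oO (jet2_mul (@jet2_cst R N O k) J).
split=> //.
- by move=> x Ox; rewrite mulr_gt0 // pos.
- move=> x Ox; rewrite lapE // (eq_bigr (fun i => k * H i i x)) => [|i _]; last by ring.
  by rewrite -mulr_sumr eq // /psi /pot; ring.
- move=> z zO z0; rewrite -(mulr0 k); apply: cvgM; first exact: cvg_cst.
  exact: bd.
have L1 : (fun x => phi x / (rho O x * P x)) @ within O (nbhs (0 : 'rV[R]_N)) --> (1 : R).
  apply: cvg_within => e e0.
  have h : 0 < Num.min e 2^-1 < 1.
    by rewrite lt_min e0 invr_gt0 ltr0n gt_min invf_lt1 ?ltr1n ?ltr0n ?orbT.
  have [t t0 tP] := lim1 _ h; exists t => // x Ox; rewrite subr0 => xt.
  by apply: lt_le_trans (tP _ Ox xt) _; rewrite ge_min lexx.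
have L2 : (fun x => k * P x / m x) @ within O (nbhs (0 : 'rV[R]_N)) --> (1 : R).
  apply: cvg_within => e /lim2[t t0 tP]; exists t => // x Ox.
  by rewrite subr0; exact: tP.
have := cvgM L1 L2; rewrite mulr1; move=> L; apply: (cvg_near_eq (L _)).
rewrite near_withinE; apply: filterE => x Ox /=.
by rewrite /psi !invfM -[RHS]mulr1 -[X in _ = _ * X](mulVf (P0 _ Ox)); ring.
Qed.

Theorem theoremB (R : realType) (N : nat) (O : set 'rV[R]_N)
    (nrm : 'rV[R]_N -> 'rV[R]_N) (mu : R) :
  (2 <= N)%N ->
  bounded_domain O ->
  C2_boundary_with_normal O nrm ->
  cond_C1 O nrm ->
  mu1 R N <= mu ->
  exists phi : 'rV[R]_N -> R,
    [/\ C2_on O phi,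
        (forall x, O x -> 0 < phi x),
        (forall x, O x -> - lap phi x + mu / (enorm x ^+ 2) * phi x = 0),
        (forall xi, bdry O xi -> xi != 0 ->
           phi @ within O (nbhs xi) --> (0 : R)) &
        ((mu1 R N < mu ->
           (fun x => phi x / (rho O x * enorm x `^ (alpha_minus N mu - 1)))
             @ within O (nbhs (0 : 'rV[R]_N)) --> (1 : R)) /\
        (mu = mu1 R N ->
           (fun x => phi x / (rho O x * enorm x `^ (- (N%:R / 2))
                              * (`|ln (enorm x)| + 1)))
             @ within O (nbhs (0 : 'rV[R]_N)) --> (1 : R)))].
Proof.
move=> N2 [oO cO On0 [M OM]] C2 [b0O Opos0 _] mu_ge.
have N0 : (0 < N)%N by exact: ltn_trans N2.
have lt0 : (N.-1 < N)%N by rewrite prednK.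
pose i0 : 'I_N := Ordinal lt0.
have Opos x : O x -> 0 < x ord0 i0 by move=> Ox; apply: Opos0 => //=; rewrite prednK.
have O0 x : O x -> x != 0.
  by move=> /Opos; apply: contraTneq => ->; rewrite mxE ltxx.
pose S0 : R := M ^+ 2 + 1.
have S00 : 0 < S0 by rewrite ltr_wpDl ?sqr_ge0.
have OS x : O x -> dot x x <= S0.
  move=> Ox; rewrite -sqr_enorm /S0; apply: (@le_trans _ _ (M ^+ 2)); last by rewrite lerDl.
  have M0 : 0 <= M by apply: le_trans (OM _ Ox); exact: enorm_ge0.
  by rewrite lerXn2r ?nnegrE ?enorm_ge0 // OM.
pose nn : R := N%:R.
have nn0 : 0 <= nn by rewrite ler0n.
pose D := mu + nn ^+ 2 / 4.
have D0 : 0 <= D by move: mu_ge; rewrite /mu1 /D -/nn; lra.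
pose sigma := Num.sqrt D.
have sg0 : 0 <= sigma by exact: sqrtr_ge0.
have sgD : sigma ^+ 2 = D by exact: sqr_sqrtr.
(* With this [b], [s^b = |x|^(alpha_- - 1)] for [s = |x|^2]. *)
pose b := (alpha_minus N mu - 1) / 2.
have bs : b = - (nn / 4) - sigma / 2.
  by rewrite /b /alpha_minus -/nn -/D -/sigma; field.
have muE : mu = 4 * b ^+ 2 + 2 * N%:R * b.
  rewrite -/nn bs (_ : mu = D - nn ^+ 2 / 4); last by rewrite /D addrK.
  by rewrite -sgD; field.
have bE : 4 * b + N%:R = - 2 * sigma by rewrite -/nn bs; field.
have b0 : b <= 0 by rewrite bs; lra.
(* The term [ln S0] gives [tau >= 1 + 3 / sigma] on [O], hence [sigma tau >= 3] if [sigma > 0]. If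
   [sigma = 0], the quotient [3 / sigma] is 0 by convention and [tau >= 1] remains. *)
pose tau0 : R := 1 + 3 / sigma + ln S0.
have tauS s : 0 < s -> s <= S0 -> 1 + 3 / sigma <= tau tau0 s.
  move=> s0 sS; have : ln s <= ln S0 by rewrite ler_ln ?posrE.
  by rewrite /tau /tau0; lra.
have q0 : 0 <= 3 / sigma by rewrite divr_ge0.
have tau1 s : 0 < s -> s <= S0 -> 1 <= tau tau0 s.
  by move=> s0 sS; apply: le_trans (tauS _ s0 sS); rewrite lerDl.
have Pn0 a x : O x -> prof tau0 b a (dot x x) != 0.
  move=> Ox; have s0 := dot_gt0 (O0 _ Ox); apply/lt0r_neq0/prof_gt0 => //.
  exact: lt_le_trans (tau1 _ s0 (OS _ Ox)).
case: (eqVneq mu (mu1 R N)) => [crit|noncrit].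
  have sgE : sigma = 0.
    by rewrite /sigma (_ : D = 0) ?sqrtr0 // /D crit /mu1 -/nn mulNr addNr.
  have a0E s : 0 < s -> s <= S0 -> (1 : R) * (sigma * tau tau0 s + 1 - 1) = 0.
    by rewrite sgE mul0r add0r subrr mulr0.
  (* With [sigma = 0] the exponent [a1 = 1/2] is the midpoint of 0 and [a0 = 1], the two exponents
     without residual; its residual constant is exactly 1. *)
  have a1E s : 0 < s -> s <= S0 ->
      (1 : R) <= - 4 * 2^-1 * (sigma * tau tau0 s + 2^-1 - 1).
    by rewrite sgE mul0r add0r; lra.
  have [||||phi [d [H [J pos eq bd lim]]]] :=
    core muE bE S00 tau1 a0E a1E ltr01 _ _ _ _ b0 oO cO C2 b0O Opos OS N0.
  - by rewrite normr1.
  - by rewrite gtr0_norm; lra.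
  - by lra.
  - by lra.
  (* [tau tau0 (|x|^2) = tau0 - 2 ln |x|], hence the factor 1/2. *)
  pose m (x : 'rV[R]_N) := enorm x `^ (- (nn / 2)) * (`|ln (enorm x)| + 1).
  have k0 : 0 < 2^-1 :> R by rewrite invr_gt0.
  have [|C2f posf eqf bdf limf] :=
    @rescaled_solution R N mu 2^-1 O (fun y => prof tau0 b 1 (dot y y)) m phi d H oO k0 J pos eq bd (Pn0 1) lim.
    move=> e /(log_profile_ratio tau0)[t t0 tP]; exists t => // x Ox xt.
    have x0 := enorm_gt0 (O0 _ Ox); have := tP _ x0 xt.
    congr (`|_ - 1| < e); rewrite /m /prof powR_dot /tau -sqr_enorm lnXn // powRr1.
      rewrite (_ : 2 * b = - (nn / 2)); last by rewrite bs sgE; field.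
      have := lt0r_neq0 (powR_gt0 (- (nn / 2)) x0); move: (_ `^ _) => E E0.
      have l0 : 0 < `|ln (enorm x)| + 1 by rewrite ltr_wpDl.
      move: (_ + 1) l0 => l /lt0r_neq0 l0; rewrite -[ln _ *+ 2]mulr_natl; field.
      by rewrite l0 E0.
    have s0 := dot_gt0 (O0 _ Ox); have := tau1 _ s0 (OS _ Ox).
    by rewrite /tau -sqr_enorm lnXn //; exact: le_trans.
  exists (fun x => 2^-1 * phi x); split=> //; split=> [|_]; first by rewrite crit ltxx.
  by under eq_fun do rewrite -mulrA.
have sgp : 0 < sigma.
  rewrite sqrtr_gt0 lt_neqAle D0 andbT eq_sym; apply: contra noncrit => /eqP.
  by rewrite /D /mu1 -/nn => ?; apply/eqP; lra.
have a0E s : 0 < s -> s <= S0 -> (0 : R) * (sigma * tau tau0 s + 0 - 1) = 0.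
  by rewrite mul0r.
(* With [a0 = 0] and [a1 = - 1] the residual constant is [4 (sigma tau - 2)], at least 4 because
   [sigma tau >= 3]. *)
have a1E s : 0 < s -> s <= S0 -> (4 : R) <= - 4 * (-1) * (sigma * tau tau0 s + (-1) - 1).
  move=> s0 sS; have : sigma * (3 / sigma) <= sigma * tau tau0 s.
    by rewrite ler_pM2l //; apply: le_trans (tauS _ s0 sS); rewrite lerDr.
  by rewrite mulrC divfK ?lt0r_neq0 //; lra.
have [|||||phi [d [H [J pos eq bd lim]]]] :=
  core muE bE S00 tau1 a0E a1E _ _ _ _ _ b0 oO cO C2 b0O Opos OS N0.
- by [].
- by rewrite normr0.
- by rewrite normrN normr1.
- by rewrite oppr_lt0.
- by rewrite addNr.
pose m (x : 'rV[R]_N) := enorm x `^ (alpha_minus N mu - 1).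
have [|C2f posf eqf bdf limf] :=
  @rescaled_solution R N mu 1 O (fun y => prof tau0 b 0 (dot y y)) m phi d H oO ltr01 J pos eq bd (Pn0 0) lim.
  move=> e e0; exists 1 => // x Ox _.
  rewrite mul1r /prof powRr0 mulr1 powR_dot (mulrC 2) divfK //.
  by rewrite divff ?subrr ?normr0 // lt0r_neq0 // powR_gt0 // enorm_gt0 // O0.
exists (fun x => 1 * phi x); split=> //; split=> // crit.
by rewrite crit eqxx in noncrit.
Qed.
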